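(* Let $\mathbb{F}$ be a local field of characteristic $2$, let $n\ge1$ and $V=\mathbb{F}^n$. Assume that for every local field $\mathbb{E}$ of characteristic $2$ and every $m<n$, every $(\widetilde{G}(W),\chi)$-equivariant distribution on $\mathfrak{gl}(W)\times W\times W^*$ is $0$, where $W=\mathbb{E}^m$. Let $\xi$ be a $(\widetilde{G}(V),\chi)$-equivariant distribution on $\mathfrak{gl}(V)\times V\times V^*$. Then for any point $(A,v,\phi)$ in the support of $\xi$ and any integer $k\ge0$, we have $\langle A^kv,\phi\rangle=0$.
   Context: A local field is a non-discrete locally compact topological field; in characteristic $2$ it is automatically non-archimedean. For a locally compact totally disconnected Hausdorff space $X$, let $\mathcal{S}(X)$ be the space of locally constant compactly supported functions $X\to\mathbb{C}$; a distribution on $X$ is a $\mathbb{C}$-linear functional on $\mathcal{S}(X)$. Its support is the complement of the largest open subset $U$ such that it vanishes on all functions in $\mathcal{S}(X)$ supported in $U$. For a local field $\mathbb{E}$ and $W=\mathbb{E}^m$: $\mathfrak{gl}(W)$ is the space of linear endomorphisms of $W$; $W$ is identified with column vectors and $W^*$ with row vectors, so that transposition $t$ gives maps $\mathfrak{gl}(W)\to\mathfrak{gl}(W)$, $W\to W^*$, $W^*\to W$; $\langle v,\phi\rangle=\phi(v)$ is the natural pairing. For $g\in GL(W)$, $g^*:W^*\to W^*$ is the dual map, so $(g^* )^{-1}\phi=\phi g^{-1}$. $\widetilde{G}(W):=GL(W)\rtimes\{\pm1\}$ is the semidirect product in which $-1$ acts on $GL(W)$ by $A\mapsto(A^t)^{-1}$.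 It acts on $\mathfrak{gl}(W)\times W\times W^*$ by $$(g,1).(A,v,\phi)=(gAg^{-1},\,gv,\,(g^* )^{-1}\phi),\qquad (g,-1).(A,v,\phi)=(gA^tg^{-1},\,g\phi^t,\,(g^* )^{-1}v^t).$$ $\chi:\widetilde{G}(W)\to\{\pm1\}$ is the character $(g,\delta)\mapsto\delta$. A distribution $\xi$ is $(\widetilde{G}(W),\chi)$-equivariant if $\xi(x\mapsto\Phi(h.x))=\chi(h)\,\xi(\Phi)$ for all $h\in\widetilde{G}(W)$ and all test functions $\Phi$. *)

(* Defs.v *)
From HB Require Import structures.
From mathcomp Require Import all_boot all_order all_algebra.
From mathcomp Require Import all_classical all_reals topology normedtype.
From mathcomp Require Import complex.

Set Implicit Arguments.
Unset Strict Implicit.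
Unset Printing Implicit Defensive.

Import Order.TTheory GRing.Theory Num.Theory.

Local Open Scope classical_set_scope.
Local Open Scope ring_scope.

HB.mixin Record TopologicalZmodule_isTopologicalField K
    & TopologicalZmodule K & GRing.Field K := {
  mulf_continuous : continuous (fun x : K * K => x.1 * x.2) ;
  invf_continuous : forall x : K, x != 0 -> {for x, continuous (@GRing.inv K)} ;
}.

#[short(type="topologicalFieldType")]
HB.structure Definition TopologicalField :=
  {K of TopologicalZmodule K & GRing.Field K
        & TopologicalZmodule_isTopologicalField K}.

(* As usual, locally compact topological fields are understood to be
   Hausdorff; [locally_compact] itself does not include this. *)
HB.mixin Record TopologicalField_isLocalField K & TopologicalField K := {
  localf_hausdorff : hausdorff_space K ;
  localf_locally_compact : locally_compact [set: K] ;
  localf_not_discrete : ~ (forall U : set K, open U) ;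
}.

#[short(type="localFieldType")]
HB.structure Definition LocalField :=
  {K of TopologicalField K & TopologicalField_isLocalField K}.

Section TestFunctions.
Variables (R : realType) (X : topologicalType).

Definition locally_constant (f : X -> R[i]) : Prop :=
  forall x, \forall y \near x, f y = f x.

Definition fsupport (f : X -> R[i]) : set X := closure [set x | f x != 0].

Definition schwartz : {pred X -> R[i]} :=
  mem [set f | locally_constant f /\ compact (fsupport f)].

Lemma schwartz_submod_closed : submod_closed schwartz.
Proof.
split.
  rewrite inE; split=> [x|]; first exact: filterE.
  rewrite /fsupport (_ : [set x | _] = set0) ?closure0 //; first exact: compact0.
  by apply/seteqP; split=> x //=; rewrite /GRing.zero /= eqxx.
move=> a f g; rewrite !inE => -[lf cf] [lg cg]; split=> [x|].
  by have := lf x; have := lg x; apply: filterS2 => y /= e1 e2; rewrite !fctE e1 e2.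
apply: (subclosed_compact _ (compactU cf cg)); first exact: closed_closure.
rewrite /fsupport -closureU; apply: closureS => x /= nfg.
have [f0|] := eqVneq (f x) 0; last by left.
have [g0|] := eqVneq (g x) 0; last by right.
by move: nfg; rewrite !fctE /= f0 g0 scaler0 addr0 eqxx.
Qed.

HB.instance Definition _ :=
  GRing.isSubmodClosed.Build R[i] (X -> R[i]) schwartz schwartz_submod_closed.

Record testFun := TestFun {
  testFun_val :> X -> R[i] ;
  testFunP : testFun_val \in schwartz
}.

HB.instance Definition _ := [isSub for testFun_val].
HB.instance Definition _ := [Choice of testFun by <:].
HB.instance Definition _ := [SubChoice_isSubLmodule of testFun by <:].


Definition distribution := {linear testFun -> R[i] | *%R}.

Definition vanishes_on (xi : distribution) (U : set X) : Prop :=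
  forall Phi : testFun, fsupport Phi `<=` U -> xi Phi = 0.

(* Complement of the union of all open sets on which [xi] vanishes.  On a
   locally compact totally disconnected Hausdorff space, test functions admit
   locally constant partitions of unity, so this union is itself the largest
   such open set. *)
Definition dsupport (xi : distribution) : set X :=
  ~` \bigcup_(U in [set U | open U /\ vanishes_on xi U]) U.

End TestFunctions.

Section Pullback.
Variables (R : realType) (X Y : topologicalType) (f : X -> Y) (g : Y -> X).
Hypotheses (fc : continuous f) (gc : continuous g) (gK : cancel f g).

Lemma schwartz_comp (Phi : testFun R Y) : Phi \o f \in @schwartz R X.
Proof.
have /set_mem[lPhi cPhi] := testFunP Phi.
rewrite inE; split=> [x|]; first exact: fc (lPhi (f x)).
apply: (subclosed_compact _
  (continuous_compact (continuous_subspaceT gc) cPhi)); first exact: closed_closure.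
move=> x xS; exists (f x); last exact: gK.
move=> B /fc/xS[y [/= Phiy By]]; by exists (f y).
Qed.

End Pullback.

Section MatrixContinuity.
Variable K : topologicalFieldType.

Lemma continuous_mx (T : topologicalType) (m n : nat) (F : T -> 'M[K]_(m, n)) :
  (forall i j, continuous (fun t => F t i j)) -> continuous F.
Proof.
move=> Fc t B [P PF PB].
have : \forall s \near t, forall ij : 'I_m * 'I_n, P ij.1 ij.2 (F s ij.1 ij.2).
  by apply: filter_forall => -[i j] /=; exact: Fc (PF i j).
by apply: filterS => s Ps; apply: PB => i j; exact: (Ps (i, j)).
Qed.

Lemma continuous_coord (T : topologicalType) (m n : nat)
    (F : T -> 'M[K]_(m, n)) i j :
  continuous F -> continuous (fun t => F t i j).
Proof.
move=> Fc t B nB.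
suff: nbhs (F t) [set M : 'M[K]_(m, n) | B (M i j)] by move=> /(Fc t).
exists (fun i' j' => if (i' == i) && (j' == j) then B else setT).
  by move=> i' j'; case: ifP => [/andP[/eqP-> /eqP->]//|_]; exact: filterT.
by move=> M /(_ i j); rewrite !eqxx.
Qed.

Lemma continuous_mulmx (T : topologicalType) (m n p : nat)
    (F : T -> 'M[K]_(m, n)) (G : T -> 'M[K]_(n, p)) :
  continuous F -> continuous G -> continuous (fun t => F t *m G t).
Proof.
move=> Fc Gc; apply: continuous_mx => i j.
rewrite (_ : (fun t => _) = fun t => \sum_k F t i k * G t k j); last first.
  by apply/funext => t; rewrite mxE.
apply: (continuous_big (@add_continuous K)) => k _ t.
apply: (@continuous_comp _ _ _ (fun t => (F t i k, G t k j))
  (fun x : K * K => x.1 * x.2)); last exact: mulf_continuous.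
by apply: cvg_pair; exact: continuous_coord.
Qed.

Lemma continuous_trmx (T : topologicalType) (m n : nat) (F : T -> 'M[K]_(m, n)) :
  continuous F -> continuous (fun t => (F t)^T).
Proof.
move=> Fc; apply: continuous_mx => i j.
rewrite (_ : (fun t => _) = fun t => F t j i); first exact: continuous_coord.
by apply/funext => t; rewrite mxE.
Qed.

End MatrixContinuity.

(* gl(W) x W x W^* for W = K^m, with vectors as columns and covectors as rows. *)
Notation triple K m := ('M[K]_m * 'cV[K]_m * 'rV[K]_m)%type.

Definition pairing (K : fieldType) m (v : 'cV[K]_m) (phi : 'rV[K]_m) : K :=
  (phi *m v) ord0 ord0.

Section ExtendedLinearGroup.
Variables (K : fieldType) (m : nat).

Record GLinear := GLin { GLval :> 'M[K]_m ; GLvalP : GLval \in unitmx }.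

HB.instance Definition _ := [isSub for GLval].
HB.instance Definition _ := [Choice of GLinear by <:].

Definition GLone : GLinear := GLin (unitmx1 K m).

Lemma GLmul_subproof (g h : GLinear) : g *m h \in unitmx.
Proof. by rewrite unitmx_mul !GLvalP. Qed.
Definition GLmul (g h : GLinear) : GLinear := GLin (GLmul_subproof g h).

Lemma GLinv_subproof (g : GLinear) : invmx g \in unitmx.
Proof. by rewrite unitmx_inv GLvalP. Qed.
Definition GLinv (g : GLinear) : GLinear := GLin (GLinv_subproof g).

Fact GLmulA : associative GLmul.
Proof. by move=> g h k; apply/val_inj; rewrite /= mulmxA. Qed.
Fact GLmul1g : left_id GLone GLmul.
Proof. by move=> g; apply/val_inj; rewrite /= mul1mx. Qed.
Fact GLmulg1 : right_id GLone GLmul.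
Proof. by move=> g; apply/val_inj; rewrite /= mulmx1. Qed.
Fact GLmulVg : left_inverse GLone GLinv GLmul.
Proof. by move=> g; apply/val_inj; rewrite /= mulVmx ?GLvalP. Qed.
Fact GLmulgV : right_inverse GLone GLinv GLmul.
Proof. by move=> g; apply/val_inj; rewrite /= mulmxV ?GLvalP. Qed.

HB.instance Definition _ :=
  isGroup.Build GLinear GLmulA GLmul1g GLmulg1 GLmulVg GLmulgV.

Lemma GLtrV_subproof (g : GLinear) : invmx g^T \in unitmx.
Proof. by rewrite unitmx_inv unitmx_tr GLvalP. Qed.
Definition GLtrV (g : GLinear) : GLinear := GLin (GLtrV_subproof g).

(* In the semidirect product of GL(K^m) and {1, -1}, the group {1, -1} is
   represented by [bool] under [addb], with [true] standing for -1, as in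
   [(-1) ^+ b]. *)
Definition sign_act (d : bool) (g : GLinear) : GLinear :=
  if d then GLtrV g else g.

Record GLtilde := GLt { GLt_lin : GLinear ; GLt_sign : bool }.

Definition pair_of_GLtilde (h : GLtilde) := (GLt_lin h, GLt_sign h).
Definition GLtilde_of_pair (p : GLinear * bool) := GLt p.1 p.2.
Lemma pair_of_GLtildeK : cancel pair_of_GLtilde GLtilde_of_pair.
Proof. by case. Qed.
HB.instance Definition _ := Choice.copy GLtilde (can_type pair_of_GLtildeK).

Definition GLtmul (x y : GLtilde) : GLtilde :=
  GLt (GLt_lin x * sign_act (GLt_sign x) (GLt_lin y))%g
      (GLt_sign x (+) GLt_sign y).
Definition GLtone : GLtilde := GLt 1%g false.
Definition GLtinv (x : GLtilde) : GLtilde :=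
  GLt (sign_act (GLt_sign x) (GLt_lin x)^-1)%g (GLt_sign x).

Lemma sign_actM d : {morph sign_act d : g h / (g * h)%g}.
Proof.
case: d => // g h; apply/val_inj => /=.
rewrite -!trmx_inv -trmx_mul; congr trmx.
apply: (can_inj (mulKmx (GLmul_subproof g h))).
rewrite mulmxV ?GLmul_subproof // mulmxA -[_ *m h *m _]mulmxA.
by rewrite mulmxV ?GLvalP // mulmx1 mulmxV ?GLvalP.
Qed.

Lemma sign_act_addb d e g : sign_act (d (+) e) g = sign_act d (sign_act e g).
Proof.
case: d e => -[] //=; apply/val_inj => /=.
by rewrite trmx_inv trmxK invmxK.
Qed.

Lemma sign_act1 d : sign_act d 1%g = 1%g.
Proof. by case: d => //; apply/val_inj; rewrite /= trmx1 invmx1. Qed.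

Fact GLtmulA : associative GLtmul.
Proof.
move=> [g d] [h e] [k c]; rewrite /GLtmul /=.
by rewrite sign_actM mulgA sign_act_addb addbA.
Qed.
Fact GLtmul1g : left_id GLtone GLtmul.
Proof. by move=> [g d]; rewrite /GLtmul /= mul1g. Qed.
Fact GLtmulg1 : right_id GLtone GLtmul.
Proof. by move=> [g d]; rewrite /GLtmul /= sign_act1 mulg1 addbF. Qed.
Fact GLtmulVg : left_inverse GLtone GLtinv GLtmul.
Proof.
by move=> [g d]; rewrite /GLtmul /GLtinv/= -sign_actM mulVg sign_act1 addbb.
Qed.
Fact GLtmulgV : right_inverse GLtone GLtinv GLtmul.
Proof.
move=> [g d]; rewrite /GLtmul /GLtinv/= -sign_act_addb addbb /=.
by rewrite mulgV.
Qed.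

HB.instance Definition _ :=
  isGroup.Build GLtilde GLtmulA GLtmul1g GLtmulg1 GLtmulVg GLtmulgV.

(* The dual action (g^* )^-1 phi is phi g^-1 on row vectors. *)
Definition act (h : GLtilde) (x : triple K m) : triple K m :=
  let g : 'M[K]_m := GLt_lin h in
  let: (A, v, phi) := x in
  if GLt_sign h
  then (g *m A^T *m invmx g, g *m phi^T, v^T *m invmx g)
  else (g *m A *m invmx g, g *m v, phi *m invmx g).

Lemma invmxM (g h : GLinear) : invmx (g *m h) = invmx h *m invmx g.
Proof. by have := congr1 val (invgM g h). Qed.

Lemma act1 x : act 1%g x = x.
Proof.
by case: x => [[A v] phi]; rewrite /act /= invmx1 !mulmx1 !mul1mx.
Qed.

Lemma actM h k x : act (h * k)%g x = act h (act k x).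
Proof.
case: x => [[A v] phi]; case: h => g [] ; case: k => k [];
  rewrite /act /= ?invmxM ?(invmxM g (GLtrV k)) /= ?trmx_inv ?invmxK;
  by rewrite ?trmx_mul ?trmxK ?trmx_inv ?mulmxA.
Qed.

Lemma actK h : cancel (act h) (act h^-1%g).
Proof. by move=> x; rewrite -actM mulVg act1. Qed.

Definition chi (R : realType) (h : GLtilde) : R[i] := (-1) ^+ GLt_sign h.

Lemma chiM (R : realType) h k : chi R (h * k)%g = chi R h * chi R k.
Proof. by rewrite /chi /= signr_addb. Qed.

End ExtendedLinearGroup.

Section Equivariance.
Variables (R : realType) (K : topologicalFieldType) (m : nat).

Lemma act_continuous (h : GLtilde K m) : continuous (act h).
Proof.
have cc p q (M : 'M[K]_(p, q)) : continuous (fun _ : triple K m => M).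
  by move=> x; exact: cvg_cst.
have cp (T U V : topologicalType) (f : T -> U) (g : T -> V) :
    continuous f -> continuous g -> continuous (fun x => (f x, g x)).
  by move=> fc gc x; apply: cvg_pair; [exact: fc | exact: gc].
have c1 : continuous (fun x : triple K m => x.1.1).
  by move=> x; apply: (@continuous_comp _ _ _ fst fst); exact: cvg_fst.
have c2 : continuous (fun x : triple K m => x.1.2).
  by move=> x; apply: (@continuous_comp _ _ _ fst snd);
    [exact: cvg_fst | exact: cvg_snd].
have c3 : continuous (fun x : triple K m => x.2) by move=> x; exact: cvg_snd.
have cM p q r (M : 'M[K]_(q, p)) (N : triple K m -> 'M[K]_(p, r)) :
    continuous N -> continuous (fun x => M *m N x).
  exact: continuous_mulmx (cc _ _ M).
have Mc p q r (M : 'M[K]_(q, p)) (N : triple K m -> 'M[K]_(r, q)) :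
    continuous N -> continuous (fun x => N x *m M).
  by move=> /continuous_mulmx /(_ (cc _ _ M)).
case: h => g [].
- rewrite (_ : act _ = fun x => (g *m x.1.1^T *m invmx g, g *m x.2^T,
      x.1.2^T *m invmx g)); last by apply/funext => -[[]].
  exact: (cp _ _ _ _ _ (cp _ _ _ _ _
    (Mc _ _ _ _ _ (cM _ _ _ _ _ (continuous_trmx c1)))
    (cM _ _ _ _ _ (continuous_trmx c3))) (Mc _ _ _ _ _ (continuous_trmx c2))).
- rewrite (_ : act _ = fun x => (g *m x.1.1 *m invmx g, g *m x.1.2,
      x.2 *m invmx g)); last by apply/funext => -[[]].
  exact: (cp _ _ _ _ _ (cp _ _ _ _ _
    (Mc _ _ _ _ _ (cM _ _ _ _ _ c1)) (cM _ _ _ _ _ c2)) (Mc _ _ _ _ _ c3)).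
Qed.

(* The test function x |-> Phi (h.x). *)
Definition translate (h : GLtilde K m) (Phi : testFun R (triple K m)) :
    testFun R (triple K m) :=
  TestFun (schwartz_comp (@act_continuous h) (@act_continuous h^-1%g)
             (actK h) Phi).

Definition equivariant (xi : distribution R (triple K m)) : Prop :=
  forall (h : GLtilde K m) (Phi : testFun R (triple K m)),
    xi (translate h Phi) = chi R h * xi Phi.

End Equivariance.

(* Main.v *)
(* Let (A, v, phi) be in the support of xi.  If some idempotent E = p(A)
   differs from 0 and 1, then near A every matrix is conjugate, by a matrix
   close to 1, to a block diagonal one (in characteristic 2 the powers
   p(A')^(2^k) accumulate at an idempotent close to E).  So xi is governed near
   (A, v, phi) by a functional on a product of two smaller spaces.  That
   functional is equivariant under the block diagonal group up to a positive
   character; the character is invariant under inverse transposition, hence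
   trivial.  By the hypothesis it is then invariant under transposing either
   factor, so under transposing both, while it changes sign: it vanishes.
   Therefore A - x is nilpotent for every eigenvalue x of A in F.

   The shears A -> A + l v phi commute with the group, so the same holds for
   all A + l v phi.  If some <A^k v, phi> is nonzero, two different x occur as
   eigenvalues of such matrices, and comparing them on the quotient by the span
   of the A^j v shows that v is cyclic; dually, phi is.  On the open set of such
   triples there is a symmetric S(x), depending continuously on x, with
   (S(x), -1) x = x.  Averaging a test function supported near x0 over a
   compact open subgroup stable under (S(x0), -1) makes it invariant under
   (S(x0), -1), so xi kills it: a contradiction. *)
From HB Require Import structures.
Require Import Defs.
From mathcomp Require Import all_boot all_order all_algebra.
From mathcomp Require Import all_classical all_reals topology normedtype.
From mathcomp Require Import complex.
From mathcomp Require Import perm.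

Set Implicit Arguments.
Unset Strict Implicit.
Unset Printing Implicit Defensive.

Import Order.TTheory GRing.Theory Num.Theory.

Local Open Scope classical_set_scope.
Local Open Scope ring_scope.

(** * The ring of integers of a local field of characteristic 2 *)

(** A [localFieldType] carries neither an absolute value nor a Haar measure, and replacing both
    shapes the proof. Balls come from a compact open subring: the elements whose 2^k-th powers stay
    bounded, a set closed under addition because Frobenius is additive. Integrals over compact
    groups become finite sums over translates or cosets. In the descent, a function on block
    diagonal triples is spread to one invariant under a congruence subgroup of level r; this is well
    defined because an element carrying one such triple to another is itself block diagonal. The
    value of [xi] then depends on r, but values at two levels differ by a positive integer, a number
    of cosets common to all functions. Dividing by the value at one fixed function removes r, and
    the block diagonal group acts on the quotient by a ratio of two such integers, whence
    positivity. This character is 1 on integral matrices with integral inverse. On diagonal matrices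
    inverse transposition is inversion, so there the character equals its own inverse. The two kinds
    of matrices generate. *)

Lemma compact_near (X : topologicalType) (I : Type) (G : set_system I)
    (C : set X) (P : I -> X -> Prop) :
  Filter G -> compact C ->
  (forall x, C x -> \forall x' \near x & i \near G, P i x') ->
  \forall i \near G, forall x, C x -> P i x.
Proof. by move=> FG /compact_near_coveringP /(_ I G P FG). Qed.

Lemma cvg_mulf (K : topologicalFieldType) (T : Type) (G : set_system T)
    (f g : T -> K) (a b : K) : Filter G ->
  f @ G --> a -> g @ G --> b -> (fun t => f t * g t) @ G --> a * b.
Proof.
move=> FG fa gb.
apply: (@cvg_comp _ _ _ (fun t => (f t, g t)) (fun x : K * K => x.1 * x.2)
  G (nbhs (a, b))); first exact: cvg_pair.
exact: (@mulf_continuous K (a, b)).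
Qed.

Lemma cvg_addf (K : topologicalFieldType) (T : Type) (G : set_system T)
    (f g : T -> K) (a b : K) : Filter G ->
  f @ G --> a -> g @ G --> b -> (fun t => f t + g t) @ G --> a + b.
Proof.
move=> FG fa gb.
apply: (@cvg_comp _ _ _ (fun t => (f t, g t)) (fun x : K * K => x.1 + x.2)
  G (nbhs (a, b))); first exact: cvg_pair.
exact: (@add_continuous K (a, b)).
Qed.

Lemma continuous_mulfl (K : topologicalFieldType) (a : K) :
  continuous (fun x : K => a * x).
Proof. by move=> x; apply: cvg_mulf; [exact: cvg_cst | exact: cvg_id]. Qed.

Lemma nbhs_mulfl (K : topologicalFieldType) (a x : K) (U : set K) : a != 0 ->
  nbhs x U -> nbhs (a * x) [set a * y | y in U].
Proof.
move=> a0 xU.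
have : nbhs (a * x) [set y | U (a^-1 * y)].
  by apply: (@continuous_mulfl K a^-1 (a * x)); rewrite mulKf.
by apply: filterS => y Uy; exists (a^-1 * y) => //; rewrite mulVKf.
Qed.

Lemma compact_mulfl (K : topologicalFieldType) (a : K) (C : set K) :
  compact C -> compact [set a * x | x in C].
Proof.
by move=> cC; apply: continuous_compact cC; apply/continuous_subspaceT/continuous_mulfl.
Qed.

Lemma compact_imageM (K : topologicalFieldType) (C D : set K) :
  compact C -> compact D -> compact [set p.1 * p.2 | p in C `*` D].
Proof.
move=> cC cD; apply: continuous_compact; last exact: compact_setX.
exact/continuous_subspaceT/mulf_continuous.
Qed.

Lemma compact_imageD (K : topologicalFieldType) (C D : set K) :
  compact C -> compact D -> compact [set p.1 + p.2 | p in C `*` D].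
Proof.
move=> cC cD; apply: continuous_compact; last exact: compact_setX.
exact/continuous_subspaceT/add_continuous.
Qed.

(* A compact open subring [O] together with an element [pi] whose powers
   shrink [O] to 0; the sets [pi ^+ r * O] play the role of the balls of an
   absolute value, which a [localFieldType] does not carry. *)
Record integer_ring (F : localFieldType) (O : set F) (pi : F) : Prop := {
  int_one : O 1 ;
  int_opp : forall x, O x -> O (- x) ;
  int_add : forall x y, O x -> O y -> O (x + y) ;
  int_mul : forall x y, O x -> O y -> O (x * y) ;
  int_open : open O ;
  int_compact : compact O ;
  int_pi_neq0 : pi != 0 ;
  int_pi : O pi ;
  int_small : forall U, nbhs (0 : F) U -> exists r, forall x, O x -> U (pi ^+ r * x)
}.

Section IntegerRing.
Variable F : localFieldType.
Hypothesis char2 : 2%N \in [pchar F].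

Lemma F_addxx (x : F) : x + x = 0.
Proof. by rewrite -mulr2n -mulr_natr (pcharf0 char2) mulr0. Qed.

Lemma expr2nD (x y : F) k : (x + y) ^+ (2 ^ k) = x ^+ (2 ^ k) + y ^+ (2 ^ k).
Proof.
elim: k => [|k IH]; first by rewrite !expr1.
by rewrite expnSr !exprM IH sqrrD mulr2n F_addxx addr0.
Qed.

Lemma nbhs0_neq0 (U : set F) : nbhs (0 : F) U -> exists2 a, U a & a != 0.
Proof.
move=> U0; apply: contrapT => nU; apply: (@localf_not_discrete F) => A.
rewrite openE => x Ax; rewrite /interior.
have sU : U `<=` [set 0].
  by move=> a Ua /=; apply/eqP; apply: contrapT => /negP a0; apply: nU; exists a.
have : nbhs x [set y | U (y - x)].
  have /(_ U) : (fun y => y - x) @ x --> (0 : F).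
    rewrite -[X in _ --> X](subrr x).
    by apply: cvg_addf; [exact: cvg_id | exact: cvg_cst].
  exact.
by apply: filterS => y /sU /= /subr0_eq ->.
Qed.

Lemma nbhs0_compact : exists2 W : set F, nbhs (0 : F) W & compact W.
Proof.
have [W W0 [cW _]] := @localf_locally_compact F 0 I.
have {}W0 : nbhs (0 : F) [set x | [set: F] x -> W x] := W0.
by exists W => //; apply: filterS W0 => x /(_ I).
Qed.

Lemma compact_mul_near0 (C U : set F) : compact C -> nbhs (0 : F) U ->
  \forall a \near (0 : F), forall x, C x -> U (a * x).
Proof.
move=> cC U0; apply: (compact_near (P := fun a x => U (a * x))) => // x Cx.
have /(_ U) : (fun z : F * F => z.2 * z.1) @ (x, 0) --> (0 : F).
  rewrite -[X in _ --> X](mul0r x).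
  by apply: cvg_mulf; [exact: cvg_snd | exact: cvg_fst].
by move=> /(_ U0).
Qed.

(** A cluster point c of the powers is nonzero: otherwise some a^k would be so small that a^k C
    avoids 1, although C contains a^-k. Two powers near c then have a quotient near 1. *)
Lemma powers_cluster1 (C : set F) (a : F) : compact C -> a != 0 ->
  (forall k, C (a ^+ k)) -> (forall k, C (a ^- k)) ->
  forall N, nbhs (1 : F) N -> exists k, N (a ^+ k.+1).
Proof.
move=> cC a0 Ca CaV N N1.
have [c [Cc clc]] : C `&` cluster ((fun k => a ^+ k) @ \oo) !=set0.
  apply: cC; exists 0%N => // k _; exact: Ca.
have c0 : c != 0.
  apply/eqP => c0; rewrite {}c0 in clc.
  have [V1 V1P V1n] : exists2 V, nbhs (0 : F) V & ~ V 1.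
    exists (~` [set 1]); last by apply; exact: erefl.
    apply: open_nbhs_nbhs; split; last by move=> /eqP; rewrite eq_sym oner_eq0.
    exact/closed_openC/accessible_closed_set1/hausdorff_accessible/localf_hausdorff.
  have [x [[k ->] /= /(_ _ (CaV k))]] := clc [set x | exists k, x = a ^+ k] _
    (ex_intro2 _ _ 0%N I (fun k _ => ex_intro _ k erefl))
    (compact_mul_near0 cC V1P).
  by rewrite mulfV ?expf_neq0.
have : (fun z : F * F => z.1 * z.2^-1) @ (c, c) --> (1 : F).
  rewrite -[X in _ --> X](mulfV c0).
  apply: cvg_mulf; first exact: cvg_fst.
  apply: (@cvg_comp _ _ _ snd GRing.inv _ (nbhs c)); first exact: cvg_snd.
  exact: invf_continuous.
move=> /(_ N N1) [[Q1 Q2] /= [Q1c Q2c] QN].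
have [x [[l ->]] Q2l] := clc [set x | exists l, x = a ^+ l] Q2
  (ex_intro2 _ _ 0%N I (fun k _ => ex_intro _ k erefl)) Q2c.
have [x' [[k lk ->]] Q1k] := clc [set x | exists2 k, (l < k)%N & x = a ^+ k] Q1
  (ex_intro2 _ _ l.+1 I (fun k lk => ex_intro2 _ _ k lk erefl)) Q1c.
exists (k - l.+1)%N; rewrite -subSn // subSS.
have := QN (a ^+ k, a ^+ l) (conj Q1k Q2l).
by rewrite /= -expfB ?(ltnW lk).
Qed.

(** The multipliers [M] of a compact neighbourhood of 0 form a compact monoid, with no reason to be
    closed under addition. [O] enlarges [M] to the elements with bounded 2^k-th powers, which form a
    ring; the main work is to show that [O] is still compact. *)
Lemma exists_integer_ring : exists (O : set F) (pi : F), integer_ring O pi.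
Proof.
have [W W0 cW] := nbhs0_compact.
have clW : closed W := compact_closed (@localf_hausdorff F) cW.
have [w Ww w0] := nbhs0_neq0 W0.
pose M := [set a : F | forall x, W x -> W (a * x)].
have M1 : M 1 by move=> x; rewrite mul1r.
have Mm a b : M a -> M b -> M (a * b).
  by move=> Ma Mb x Wx; rewrite -mulrA; apply: Ma; exact: Mb.
have MX a k : M a -> M (a ^+ k).
  by move=> Ma; elim: k => // k IH; rewrite exprS; exact: Mm.
have M0 : nbhs (0 : F) M by exact: compact_mul_near0.
have clM : closed M.
  rewrite (_ : M = \bigcap_(x in W) ((fun a => x * a) @^-1` W)).
    by apply: closed_bigI => x _; apply: preimage_closed => // y _; exact: continuous_mulfl.
  by apply/seteqP; split=> a Ma x /= Wx; have := Ma x Wx; rewrite /= mulrC.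
have cM : compact M.
  apply: (subclosed_compact clM (compact_mulfl (a := w^-1) cW)) => a Ma.
  by exists (a * w); [exact: Ma | rewrite mulrC mulfK].
have n1 : nbhs (0 : F) (~` [set 1]).
  apply: open_nbhs_nbhs; split; last by move=> /eqP; rewrite eq_sym oner_eq0.
  exact/closed_openC/accessible_closed_set1/hausdorff_accessible/localf_hausdorff.
(* If every nonzero element of [M] had its inverse in [M], a nonzero a so small that a M avoids 1
   would be contradictory. *)
have [pi [Mpi pi0 nMpi]] : exists pi, [/\ M pi, pi != 0 & ~ M pi^-1].
  apply: contrapT => nex.
  have [a [Ma Ha] a0] := nbhs0_neq0 (filterI M0 (compact_mul_near0 cM n1)).
  apply: nex; exists a; split => // MaV.
  by apply: (Ha _ MaV); rewrite /= mulfV.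
(* Otherwise some nonzero y lies in every pi^k M. All powers of pi, of either sign, then lie in the
   compact union of M and y^-1 M, so some pi^(k+1) comes close to 1. But pi^k is in M, whereas pi^-1
   x is outside the closed set M for x near 1. *)
have small U : nbhs (0 : F) U -> exists k, forall x, M x -> U (pi ^+ k * x).
  move=> U0; apply: contrapT => nex.
  have /choice[f Hf] : forall k, exists x, M x /\ ~ U (pi ^+ k * x).
    move=> k; apply: contrapT => nk; apply: nex; exists k => x Mx.
    by apply: contrapT => nU; apply: nk; exists x.
  have [y [My cly]] : M `&` cluster ((fun k => pi ^+ k * f k) @ \oo) !=set0.
    by apply: cM; exists 0%N => // k _; apply: Mm; [exact: MX | exact: (Hf k).1].
  have y0 : y != 0.
    apply/eqP => y0; rewrite {}y0 in cly.
    have [x [[k ->] /(Hf k).2]] := cly [set x | exists k, x = pi ^+ k * f k] U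
      (ex_intro2 _ _ 0%N I (fun k _ => ex_intro _ k erefl)) U0.
    by [].
  have Mpiy k : M (pi ^- k * y).
    have clk : closed [set pi ^+ k * x | x in M].
      exact: (compact_closed (@localf_hausdorff F) (compact_mulfl cM)).
    have /clk [x Mx <-] : closure [set pi ^+ k * x | x in M] y.
      move=> B By; have := cly [set x | exists2 l, (k <= l)%N & x = pi ^+ l * f l] B
        (ex_intro2 _ _ k I (fun l kl => ex_intro2 _ _ l kl erefl)) By.
      case=> z [[l kl ->] Bz]; exists (pi ^+ l * f l); split=> //.
      exists (pi ^+ (l - k) * f l).
        by apply: Mm; [exact: MX | exact: (Hf l).1].
      by rewrite mulrA -exprD subnKC.
    by rewrite mulKf ?expf_neq0.
  have nN : nbhs (1 : F) [set x | ~ M (pi^-1 * x)].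
    apply: open_nbhs_nbhs; split; last by rewrite /= mulr1.
    rewrite -[X in open X]/((fun x => pi^-1 * x) @^-1` (~` M)).
    apply: open_comp; last exact: closed_openC.
    by move=> x _; exact: continuous_mulfl.
  have [] := @powers_cluster1 (M `|` [set y^-1 * x | x in M]) pi _ pi0 _ _ _ nN.
  - exact/compactU/compact_mulfl.
  - by move=> k; left; exact: MX.
  - by move=> k; right; exists (pi ^- k * y); rewrite // mulrC mulfK.
  - by move=> k; apply; rewrite exprS mulKf//; exact: MX.
pose O := [set x : F | exists2 C, compact C & forall k, C (x ^+ (2 ^ k))].
have MO : M `<=` O by move=> x Mx; exists M => // k; exact: MX.
have O_add x y : O x -> O y -> O (x + y).
  move=> [C cC Cx] [D cD Dy]; exists [set p.1 + p.2 | p in C `*` D].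
    exact: compact_imageD.
  move=> k; rewrite expr2nD; exists (x ^+ (2 ^ k), y ^+ (2 ^ k)) => //.
  by split; [exact: Cx | exact: Dy].
have O_mul x y : O x -> O y -> O (x * y).
  move=> [C cC Cx] [D cD Dy]; exists [set p.1 * p.2 | p in C `*` D].
    exact: compact_imageM.
  move=> k; rewrite exprMn; exists (x ^+ (2 ^ k), y ^+ (2 ^ k)) => //.
  by split; [exact: Cx | exact: Dy].
have oppF (x : F) : - x = x by apply: oppr_inj; apply/eqP; rewrite opprK -addr_eq0 F_addxx.
have O_opp x : O x -> O (- x) by rewrite oppF.
have O_open : open O.
  rewrite openE => x Ox; rewrite /interior.
  have : nbhs x [set y | M (y - x)].
    have /(_ M) : (fun y => y - x) @ x --> (0 : F).
      rewrite -[X in _ --> X](subrr x).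
      by apply: cvg_addf; [exact: cvg_id | exact: cvg_cst].
    exact.
  by apply: filterS => y /MO Oyx; rewrite -(subrK x y); exact: O_add.
have O_closed : closed O.
  rewrite -openC openE => x nOx; rewrite /interior.
  have : nbhs x [set y | M (y - x)].
    have /(_ M) : (fun y => y - x) @ x --> (0 : F).
      rewrite -[X in _ --> X](subrr x).
      by apply: cvg_addf; [exact: cvg_id | exact: cvg_cst].
    exact.
  apply: filterS => y /MO Oyx Oy; apply: nOx.
  by rewrite -(subKr y x); apply: O_add => //; exact: O_opp.
(* The powers (pi m)^(2^k) tend to 0 while their inverses stay in a compact set, so the products
   cannot remain equal to 1. *)
have O_inv m : M m -> O (pi * m)^-1 -> pi * m = 0.
  move=> Mm' [C cC Cx]; apply/eqP; apply: contrapT => /negP y0.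
  have [k0 Hk0] := small _ (compact_mul_near0 cC n1).
  have kk0 : (k0 <= 2 ^ k0)%N by exact/ltnW/ltn_expl.
  have := Hk0 (pi ^+ (2 ^ k0 - k0) * m ^+ (2 ^ k0)) (Mm _ _ (MX _ _ Mpi) (MX _ _ Mm')).
  rewrite mulrA -exprD subnKC// -exprMn => /(_ _ (Cx k0)); apply.
  by rewrite /= exprVn mulfV ?expf_neq0.
pose piM := [set pi * x | x in M].
have piM0 : nbhs (0 : F) piM by have := nbhs_mulfl pi0 M0; rewrite mulr0.
(* [D] is a compact annulus around 0; the inverses of its elements are bounded, and this bound
   provides the exponent [l]. *)
pose D := M `&` ~` piM°.
have cD : compact D.
  apply: compact_closedI => //; exact/open_closedC/open_interior.
have D0 d : D d -> d != 0.
  by move=> [_ nd]; apply: contra_notN nd => /eqP ->; exact: piM0.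
have cDV : compact [set d^-1 | d in D].
  apply: continuous_compact => //; apply: continuous_in_subspaceT => x.
  by rewrite inE => /D0; exact: invf_continuous.
have [l Hl] : exists l, forall d, D d -> piM (pi ^+ l * d^-1).
  have [l Hl] := small _ (compact_mul_near0 cDV piM0).
  by exists l => d Dd; have := Hl 1 M1; rewrite mulr1; apply; exists d.
(* Factors of pi are stripped until pi^(j+1) x falls into [D]. If then l <= j+1, the choice of l
   makes x^-1 an element of pi M, which [O_inv] excludes. As l does not depend on x, all of [O] lies
   in pi^-l M. *)
have bound j x : O x -> M (pi ^+ j * x) -> M (pi ^+ l * x).
  elim: j x => [|j IH] x Ox.
    by rewrite expr0 mul1r => Mx; apply: Mm => //; exact: MX.
  have [[m Mm' e] _|nu Mu] := pselect (piM (pi ^+ j.+1 * x)).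
    apply: IH => //; rewrite exprS -mulrA in e.
    by rewrite -(mulfI pi0 e).
  have Du : D (pi ^+ j.+1 * x) by split=> // /interior_subset.
  have x0 : x != 0 by apply: contraNneq (D0 _ Du) => ->; rewrite mulr0.
  have [lj|jl] := leqP l j.+1; last first.
    rewrite -(subnK (ltnW jl)) exprD -mulrA; apply: Mm => //; exact: MX.
  have [m Mm' e] := Hl _ Du.
  have : pi * (pi ^+ (j.+1 - l) * m) = x^-1.
    rewrite mulrCA e mulrA -exprD subnK// invfM mulrA mulfV ?mul1r//.
    exact: expf_neq0.
  move=> e'; have := O_inv (pi ^+ (j.+1 - l) * m).
  rewrite e' invrK => /(_ (Mm _ _ (MX _ _ Mpi) Mm') Ox) /eqP.
  by rewrite invr_eq0 (negPf x0).
have Osub : O `<=` [set pi ^- l * y | y in M].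
  move=> x Ox; exists (pi ^+ l * x); last by rewrite mulKf ?expf_neq0.
  have [j Hj] := small _ (compact_mul_near0 (@compact_set1 F x) M0).
  by apply: (bound j) => //; have := Hj 1 M1; rewrite mulr1; exact.
have cO : compact O := subclosed_compact O_closed (compact_mulfl cM) Osub.
exists O, pi; split=> //; [exact: MO|exact: MO|move=> U U0].
have [k Hk] := small _ (compact_mul_near0 cO U0).
by exists k => x Ox; have := Hk 1 M1; rewrite mulr1; exact.
Qed.

End IntegerRing.

(** * Balls of matrices *)

Section Balls.
Variables (F : localFieldType) (O : set F) (pi : F).
Hypothesis OP : integer_ring O pi.

Let pi0 : pi != 0. Proof. by case: OP. Qed.
Let piX0 r : pi ^+ r != 0. Proof. exact: expf_neq0. Qed.

(** The ball pi^r O, larger r meaning a smaller ball. *)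
Definition fball r : set F := [set x | O (pi ^- r * x)].

Lemma fball0E x : fball 0 x = O x.
Proof. by rewrite /fball /= expr0 invr1 mul1r. Qed.

Lemma fball_zero r : fball r 0.
Proof.
rewrite /fball /= mulr0 -(subrr 1).
by apply: (int_add OP); [exact: (int_one OP) | exact/(int_opp OP)/(int_one OP)].
Qed.

Lemma fballD r x y : fball r x -> fball r y -> fball r (x + y).
Proof. by rewrite /fball /= mulrDr; exact: (int_add OP). Qed.

Lemma fballN r x : fball r x -> fball r (- x).
Proof. by rewrite /fball /= mulrN; exact: (int_opp OP). Qed.

Lemma fballM r s x y : fball r x -> fball s y -> fball (r + s) (x * y).
Proof.
rewrite /fball /= exprD invfM => Ox Oy.
by rewrite mulrACA; exact: (int_mul OP).
Qed.

Lemma O_pi r : O (pi ^+ r).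
Proof.
elim: r => [|r IH]; first exact: (int_one OP).
by rewrite exprS; apply: (int_mul OP) => //; exact: int_pi OP.
Qed.

Lemma fball_le r s x : (r <= s)%N -> fball s x -> fball r x.
Proof.
move=> rs; rewrite /fball /= => Ox.
rewrite (_ : pi ^- r * x = pi ^+ (s - r) * (pi ^- s * x)).
  by apply: (int_mul OP) => //; exact: O_pi.
rewrite mulrA; congr (_ * _); apply: (mulIf (piX0 s)).
by rewrite mulfVK// -{1}(subnKC rs) exprD mulKf.
Qed.

Lemma fball_sum r (I : Type) (s : seq I) (P : pred I) (f : I -> F) :
  (forall i, P i -> fball r (f i)) -> fball r (\sum_(i <- s | P i) f i).
Proof. by move=> h; elim/big_ind: _ => //; [exact: fball_zero | exact: fballD]. Qed.

Lemma fball_pi a r x : fball (a + r) (pi ^+ a * x) <-> fball r x.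
Proof. by rewrite /fball /= exprD invfM mulrACA mulVf ?piX0 // mul1r. Qed.

Lemma nbhs_fball r : nbhs (0 : F) (fball r).
Proof.
have : nbhs (0 : F) O.
  apply: open_nbhs_nbhs; split; first exact: int_open OP.
  by have := fball_zero 0; rewrite fball0E.
have /(_ O) : (fun x => pi ^- r * x) @ (0 : F) --> (0 : F).
  by rewrite -[X in _ --> X](mulr0 (pi ^- r)); exact: continuous_mulfl.
exact.
Qed.

Lemma fball_small U : nbhs (0 : F) U -> exists r, fball r `<=` U.
Proof.
move=> /(int_small OP)[r Hr]; exists r => x Ox.
by rewrite -(mulVKf (piX0 r) x); exact: Hr.
Qed.

Lemma fball_eq0 x : (forall r, fball r x) -> x = 0.
Proof.
move=> bx; apply: (@localf_hausdorff F) => A B Ax /fball_small[r rB].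
by exists x; split; [exact: nbhs_singleton | exact: rB].
Qed.

Lemma fball_bound x : exists a, fball 0 (pi ^+ a * x).
Proof.
have /(_ O) : (fun y => y * x) @ (0 : F) --> (0 : F).
  rewrite -[X in _ --> X](mul0r x).
  by apply: cvg_mulf; [exact: cvg_id | exact: cvg_cst].
have O0 : nbhs (0 : F) O by have := nbhs_fball 0; rewrite (funext fball0E).
move=> /(_ O0) /(int_small OP)[a Ha]; exists a; rewrite fball0E.
by have := Ha 1 (int_one OP); rewrite mulr1.
Qed.

Lemma nbhs_fballP x U : nbhs x U <-> exists r, forall y, fball r (y - x) -> U y.
Proof.
split=> [xU|[r rU]].
  have /(_ U) : (fun y => y + x) @ (0 : F) --> x.
    rewrite -[X in _ --> X](add0r x).
    by apply: cvg_addf; [exact: cvg_id | exact: cvg_cst].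
  move=> /(_ xU) /fball_small[r rU]; exists r => y /rU /=.
  by rewrite subrK.
suff : nbhs x [set y | fball r (y - x)] by apply: filterS => y; exact: rU.
have /(_ (fball r) (nbhs_fball r)) : (fun y => y - x) @ x --> (0 : F).
  rewrite -[X in _ --> X](subrr x).
  by apply: cvg_addf; [exact: cvg_id | exact: cvg_cst].
exact.
Qed.

Lemma compact_fball r : compact (fball r).
Proof.
apply: (subclosed_compact _ (compact_mulfl (a := pi ^+ r) (int_compact OP))).
  rewrite -openC openE => x nx; apply/nbhs_fballP; exists r => y yx.
  apply: contra_not nx => ry.
  by rewrite -(subKr y x); apply: fballD => //; exact: fballN.
by move=> x bx; exists (pi ^- r * x); rewrite // mulVKf.
Qed.

Definition mxball r m n (M : 'M[F]_(m, n)) := forall i j, fball r (M i j).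

Section MxBall.
Variables m n : nat.
Implicit Types M N : 'M[F]_(m, n).

Lemma mxball0 r : @mxball r m n 0.
Proof. by move=> i j; rewrite mxE; exact: fball_zero. Qed.

Lemma mxballD r M N : mxball r M -> mxball r N -> mxball r (M + N).
Proof. by move=> rM rN i j; rewrite mxE; exact: fballD. Qed.

Lemma mxballN r M : mxball r M -> mxball r (- M).
Proof. by move=> rM i j; rewrite mxE; exact: fballN. Qed.

Lemma mxballB r M N : mxball r M -> mxball r N -> mxball r (M - N).
Proof. by move=> rM rN; apply: mxballD => //; exact: mxballN. Qed.

Lemma mxballC r M N : mxball r (M - N) -> mxball r (N - M).
Proof. by move=> /mxballN; rewrite opprB. Qed.

Lemma mxball_sum r (I : Type) (s : seq I) (P : pred I) (f : I -> 'M_(m, n)) :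
  (forall i, P i -> mxball r (f i)) -> mxball r (\sum_(i <- s | P i) f i).
Proof. by move=> h; elim/big_ind: _ => //; [exact: mxball0 | exact: mxballD]. Qed.

Lemma mxball_le r s M : (r <= s)%N -> mxball s M -> mxball r M.
Proof. by move=> rs sM i j; exact: fball_le (sM i j). Qed.

Lemma mxball_pi a r M : mxball (a + r) (pi ^+ a *: M) <-> mxball r M.
Proof.
split=> h i j; first by apply/(fball_pi a); have := h i j; rewrite mxE.
by rewrite mxE; apply/fball_pi/h.
Qed.

Lemma mxballZ r s x M : fball r x -> mxball s M -> mxball (r + s) (x *: M).
Proof. by move=> rx sM i j; rewrite mxE; exact: fballM. Qed.

Lemma mxball_eq0 M : (forall r, mxball r M) -> M = 0.
Proof. by move=> h; apply/matrixP => i j; rewrite mxE; apply: fball_eq0 => r; exact: h. Qed.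

Lemma mxball_bound M : exists a, mxball 0 (pi ^+ a *: M).
Proof.
have /choice[f Hf] : forall ij : 'I_m * 'I_n, exists a, fball 0 (pi ^+ a * M ij.1 ij.2).
  by move=> ij; exact: fball_bound.
exists (\sum_ij f ij)%N => i j; rewrite mxE (bigD1 (i, j))//= addnC exprD -mulrA.
rewrite fball0E; apply: (int_mul OP); first exact: O_pi.
by rewrite -fball0E; exact: (Hf (i, j)).
Qed.

Lemma nbhs_mxballP M U : nbhs M U <-> exists r, forall N, mxball r (N - M) -> U N.
Proof.
split=> [[P PM PU]|[r rU]].
  have /choice[f Hf] : forall ij : 'I_m * 'I_n,
      exists r, forall y, fball r (y - M ij.1 ij.2) -> P ij.1 ij.2 y.
    by move=> ij; exact/nbhs_fballP/PM.
  exists (\sum_ij f ij)%N => N rN; apply: PU => i j; apply: (Hf (i, j)) => /=.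
  have := rN i j; rewrite !mxE; apply: fball_le.
  by rewrite (bigD1 (i, j))//= leq_addr.
exists (fun i j => [set y | fball r (y - M i j)]).
  by move=> i j; apply/nbhs_fballP; exists r.
by move=> N rN; apply: rU => i j; rewrite !mxE; exact: rN.
Qed.

Lemma compact_mxball r : compact [set M : 'M[F]_(m, n) | mxball r M].
Proof.
pose X := prod_topology (fun _ : 'I_m * 'I_n => F).
pose f (g : X) : 'M[F]_(m, n) := \matrix_(i, j) g (i, j).
have cX : @compact X [set g | forall ij, fball r (g ij)].
  exact: (@tychonoff ('I_m * 'I_n)%type (fun=> F) (fun=> fball r)
    (fun=> @compact_fball r)).
rewrite (_ : [set M | _] = [set f g | g in [set g | forall ij, fball r (g ij)]]).
  apply: continuous_compact cX; apply: continuous_subspaceT.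
  apply: continuous_mx => i j.
  rewrite (_ : (fun g => _) = fun g : X => g (i, j)).
    exact: (@proj_continuous _ (fun=> F : topologicalType) (i, j)).
  by apply/funext => g; rewrite mxE.
apply/seteqP; split=> [M rM|_ [g rg <-] i j]; last by rewrite mxE; exact: rg.
exists (fun ij => M ij.1 ij.2); first by move=> ij; exact: rM.
by apply/matrixP => i j; rewrite mxE.
Qed.

End MxBall.

Lemma mxball1 n : @mxball 0 n n 1%:M.
Proof.
move=> i j; rewrite mxE fball0E; case: (i == j); first exact: (int_one OP).
by rewrite -fball0E; exact: fball_zero.
Qed.

Lemma mxballM r s m n p (M : 'M[F]_(m, n)) (N : 'M[F]_(n, p)) :
  mxball r M -> mxball s N -> mxball (r + s) (M *m N).
Proof.
by move=> rM sN i j; rewrite mxE; apply: fball_sum => k _; exact: fballM.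
Qed.

Lemma mxballMr r m n p (M : 'M[F]_(m, n)) (N : 'M[F]_(n, p)) :
  mxball r M -> mxball 0 N -> mxball r (M *m N).
Proof. by rewrite -[in X in _ -> _ -> X](addn0 r); exact: mxballM. Qed.

Lemma mxballMl r m n p (M : 'M[F]_(m, n)) (N : 'M[F]_(n, p)) :
  mxball 0 M -> mxball r N -> mxball r (M *m N).
Proof. exact: mxballM. Qed.

Lemma mxball_block r m1 m2 n1 n2 (A : 'M[F]_(m1, n1)) (B : 'M[F]_(m1, n2))
    (C : 'M[F]_(m2, n1)) (D : 'M[F]_(m2, n2)) :
  mxball r A -> mxball r B -> mxball r C -> mxball r D ->
  mxball r (block_mx A B C D).
Proof.
move=> hA hB hC hD i j.
by rewrite mxE; case: splitP => k _; rewrite mxE; case: splitP => l _.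
Qed.

Lemma mxball_tr r m n (M : 'M[F]_(m, n)) : mxball r M -> mxball r M^T.
Proof. by move=> rM i j; rewrite mxE. Qed.

Lemma mxballX r n (M : 'M[F]_n) k : mxball r M -> mxball (k * r) (M ^+ k).
Proof.
move=> rM; elim: k => [|k IH]; first exact: mxball1.
by rewrite exprS mulSn; exact: mxballM.
Qed.

(** A row killed by M is fixed by 1 - M, whose powers tend to 0 because s > 0, so it is 0. The
    inverse has some denominator pi^a, and the identity M^-1 - 1 = (1 - M) M^-1 lowers a one step at
    a time. *)
Lemma mxball_invmx s n (M : 'M[F]_n) : (0 < s)%N -> mxball s (M - 1%:M) ->
  M \in unitmx /\ mxball s (invmx M - 1%:M).
Proof.
move=> s0 sM; have sM' := mxballC sM.
have Mu : M \in unitmx.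
  rewrite -row_free_unit -kermx_eq0; apply/eqP.
  have [a Ha] := mxball_bound (kermx M).
  have KX k : pi ^+ a *: kermx M = pi ^+ a *: kermx M *m (1%:M - M) ^+ k.
    elim: k => [|k IH]; first by rewrite mulmx1.
    rewrite exprSr [_ ^+ k * _]/(_ *m _) mulmxA -IH mulmxBr mulmx1.
    by rewrite -[in X in _ - X]scalemxAl mulmx_ker scaler0 subr0.
  have /eqP : pi ^+ a *: kermx M = 0.
    apply: mxball_eq0 => r; rewrite (KX r).
    apply: mxball_le (mxballMl Ha (mxballX r sM')).
    by rewrite leq_pmulr.
  by rewrite scaler_eq0 (negPf (piX0 a)) => /eqP.
split=> //.
have E : invmx M - 1%:M = (1%:M - M) *m invmx M.
  by rewrite mulmxBl mul1mx mulmxV.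
suff i0 : mxball 0 (invmx M) by rewrite E; exact: mxballMr.
have [a] := mxball_bound (invmx M); elim: a => [|a IH]; first by rewrite expr0 scale1r.
move=> Ha; apply: IH; rewrite -[invmx M](subrK 1%:M) scalerDr; apply: mxballD.
  apply/(mxball_pi 1); rewrite scalerA -exprD add1n E scalemxAr.
  by apply: mxballMr => //; exact: mxball_le sM'.
by apply: (mxballZ (r := 0)); [rewrite fball0E; exact: O_pi | exact: mxball1].
Qed.

End Balls.

(** * Test functions on spaces with clopen balls *)

Lemma continuous_pair (S T U : topologicalType) (f : S -> T) (g : S -> U) :
  continuous f -> continuous g -> continuous (fun x => (f x, g x)).
Proof. by move=> fc gc x; apply: cvg_pair; [exact: fc | exact: gc]. Qed.

Lemma continuous_fst_comp (S T U : topologicalType) (f : S -> T * U) :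
  continuous f -> continuous (fun x => (f x).1).
Proof. by move=> fc x; apply: continuous_comp (fc x) _; exact: cvg_fst. Qed.

Lemma continuous_snd_comp (S T U : topologicalType) (f : S -> T * U) :
  continuous f -> continuous (fun x => (f x).2).
Proof. by move=> fc x; apply: continuous_comp (fc x) _; exact: cvg_snd. Qed.

Lemma continuous_fun_comp (S T U : topologicalType) (f : S -> T) (g : T -> U) :
  continuous f -> continuous g -> continuous (fun x => g (f x)).
Proof. by move=> fc gc x; apply: continuous_comp (fc x) _; exact: gc. Qed.

Lemma continuous_idfun (S : topologicalType) : continuous (fun x : S => x).
Proof. by move=> x; exact: cvg_id. Qed.

Lemma continuous_const (S T : topologicalType) (c : T) : continuous (fun _ : S => c).
Proof. by move=> x; exact: cvg_cst. Qed.

Section TestFunctionLemmas.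
Variable R : realType.

Lemma schwartz_near (X : topologicalType) (f : X -> R[i]) (C : set X) :
  hausdorff_space X -> compact C -> (forall x, f x != 0 -> C x) ->
  locally_constant f -> f \in @schwartz R X.
Proof.
move=> hX cC fC lf; rewrite inE; split=> //.
apply: (subclosed_compact _ cC); first exact: closed_closure.
have /closure_id -> : closed C by exact: compact_closed.
by apply: closureS => x /=; exact: fC.
Qed.

Lemma schwartz_lc (X : topologicalType) (f : X -> R[i]) : f \in @schwartz R X ->
  locally_constant f.
Proof. by rewrite inE => -[]. Qed.

Lemma schwartz_compact (X : topologicalType) (f : X -> R[i]) : f \in @schwartz R X ->
  compact (fsupport f).
Proof. by rewrite inE => -[]. Qed.

Lemma fsupport_neq0 (X : topologicalType) (f : X -> R[i]) x : f x != 0 -> fsupport f x.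
Proof. by move=> fx; exact: subset_closure. Qed.

(** Compactness gives uniformity in p on the support only. For group actions the points where f
    vanishes are recovered later by applying the result to the inverse element. *)
Lemma schwartz_action (P X : topologicalType) (a : P * X -> X) (p0 : P)
    (f : X -> R[i]) : f \in @schwartz R X -> continuous a ->
  (forall x, a (p0, x) = x) ->
  \forall p \near p0, forall x, f x != 0 -> f (a (p, x)) = f x.
Proof.
move=> fS ac a0.
have : \forall p \near p0, forall x, fsupport f x -> f (a (p, x)) = f x.
  apply: (compact_near (P := fun p x => f (a (p, x)) = f x)).
    exact: schwartz_compact.
  move=> x _.
  have ac' : continuous (fun z : X * P => a (z.2, z.1)).
    apply: continuous_fun_comp ac; apply: continuous_pair.
      exact/continuous_snd_comp/continuous_idfun.
    exact/continuous_fst_comp/continuous_idfun.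
  have h1 : nbhs (x, p0) [set z : X * P | f (a (z.2, z.1)) = f x].
    have /(_ [set y | f y = f x]) : (fun z : X * P => a (z.2, z.1)) @ (x, p0) --> x.
      by rewrite -[X in _ --> X]a0; exact: (ac' (x, p0)).
    by apply; exact: schwartz_lc fS x.
  have h2 : nbhs (x, p0) [set z : X * P | f z.1 = f x].
    have /(_ [set y | f y = f x]) : (fun z : X * P => z.1) @ (x, p0) --> x.
      exact: cvg_fst.
    by apply; exact: schwartz_lc fS x.
  by apply: filterS2 h1 h2 => z /= -> ->.
by apply: filterS => p Hp x /fsupport_neq0; exact: Hp.
Qed.

End TestFunctionLemmas.

(** An ultrametric uniformity without a distance: nested equivalence relations whose classes are the
    basic neighbourhoods. It serves as common interface for matrices, triples and pairs of
    triples. *)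
Record ball_structure (T : topologicalType) (E : nat -> T -> T -> Prop) : Prop := {
  bs_refl : forall r x, E r x x ;
  bs_sym : forall r x y, E r x y -> E r y x ;
  bs_trans : forall r x y z, E r x y -> E r y z -> E r x z ;
  bs_le : forall r s x y, (r <= s)%N -> E s x y -> E r x y ;
  bs_nbhs : forall x U, nbhs x U <-> exists r, forall y, E r x y -> U y ;
  bs_eq : forall x y, (forall r, E r x y) -> x = y
}.

Definition prod_ball (T U : Type) (E : nat -> T -> T -> Prop)
  (E' : nat -> U -> U -> Prop) r (x y : T * U) := E r x.1 y.1 /\ E' r x.2 y.2.

Lemma ball_structure_prod (T U : topologicalType) (E : nat -> T -> T -> Prop)
    (E' : nat -> U -> U -> Prop) :
  ball_structure E -> ball_structure E' -> ball_structure (prod_ball E E').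
Proof.
move=> BE BE'; split.
- by move=> r x; split; [exact: bs_refl BE _ _ | exact: bs_refl BE' _ _].
- by move=> r x y [h h']; split; [exact: bs_sym BE _ _ _ h | exact: bs_sym BE' _ _ _ h'].
- move=> r x y z [h1 h1'] [h2 h2'].
  by split; [exact: bs_trans BE _ _ _ _ h1 h2 | exact: bs_trans BE' _ _ _ _ h1' h2'].
- move=> r s x y rs [h h'].
  by split; [exact: bs_le BE _ _ _ _ rs h | exact: bs_le BE' _ _ _ _ rs h'].
- move=> [x x'] V; split=> [[[A A'] /= [/(bs_nbhs BE)[r rA] /(bs_nbhs BE')[r' rA']] AV]|].
    exists (maxn r r') => -[y y'] [/= h h']; apply: AV; split=> /=.
      by apply: rA; apply: bs_le BE _ _ _ _ (leq_maxl _ _) h.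
    by apply: rA'; apply: bs_le BE' _ _ _ _ (leq_maxr _ _) h'.
  move=> [r rV]; exists ([set y | E r x y], [set y | E' r x' y]) => /=.
    by split; [apply/(bs_nbhs BE) | apply/(bs_nbhs BE')]; exists r.
  by move=> [y y'] [/= h h']; apply: rV.
- move=> [x x'] [y y'] h; congr (_, _).
    by apply: (bs_eq BE) => r; have [] := h r.
  by apply: (bs_eq BE') => r; have [] := h r.
Qed.

Section BallStructure.
Variables (T : topologicalType) (E : nat -> T -> T -> Prop).
Hypothesis BE : ball_structure E.

Lemma bs_nbhs_ball r x : nbhs x [set y | E r x y].
Proof. by apply/(bs_nbhs BE); exists r. Qed.

Lemma bs_hausdorff : hausdorff_space T.
Proof.
move=> x y; rewrite /cluster => cxy; apply: (bs_eq BE) => r.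
have [z [/= xz yz]] := cxy _ _ (bs_nbhs_ball r x) (bs_nbhs_ball r y).
exact: bs_trans BE _ _ _ _ xz (bs_sym BE yz).
Qed.

Lemma bs_closed (A : set T) r : (forall x y, E r x y -> A x -> A y) -> closed A.
Proof.
move=> hA; rewrite -openC openE => x nAx; apply/(bs_nbhs BE); exists r => y xy Ay.
by apply: nAx; exact: hA (bs_sym BE xy) Ay.
Qed.

Lemma bs_open (A : set T) r : (forall x y, E r x y -> A x -> A y) -> open A.
Proof.
by move=> hA; rewrite openE => x Ax; apply/(bs_nbhs BE); exists r => y /hA; exact.
Qed.

Lemma bs_closed_fiber (S : topologicalType) (f : S -> T) (c : T) :
  continuous f -> closed [set z | f z = c].
Proof.
move=> fc; rewrite -[X in closed X]/(f @^-1` [set c]).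
apply: preimage_closed => [x _|]; first exact: fc.
exact/accessible_closed_set1/hausdorff_accessible/bs_hausdorff.
Qed.

Lemma schwartz_unif (R : realType) (f : T -> R[i]) : f \in @schwartz R T ->
  exists r, forall x y, E r x y -> f x = f y.
Proof.
move=> fS.
have [r0 _ Hr] : \forall r \near \oo, forall x, fsupport f x ->
    forall y, E r x y -> f x = f y.
  apply: (compact_near (P := fun r x => forall y, E r x y -> f x = f y)).
    exact: schwartz_compact.
  move=> x _; have /(bs_nbhs BE)[s Hs] := schwartz_lc fS x.
  exists ([set y | E s x y], [set r | (s <= r)%N]) => /=.
    by split; [exact: bs_nbhs_ball | exists s].
  move=> [x' r] [/= xx' sr] y x'y; rewrite (Hs x')// (Hs y)//.
  exact: bs_trans BE _ _ _ _ xx' (bs_le BE sr x'y).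
have {}Hr := Hr r0 (leqnn r0).
exists r0 => x y xy.
have [fx0|/fsupport_neq0 fx] := eqVneq (f x) 0; last exact: Hr.
have [fy0|/fsupport_neq0 fy] := eqVneq (f y) 0; last first.
  by apply/esym/Hr => //; exact: bs_sym BE _ _ _ xy.
by rewrite fx0 fy0.
Qed.

Lemma bs_cover (C : set T) r : compact C ->
  exists s : seq T, forall x, C x -> exists2 c, c \in s & E r c x.
Proof.
move=> cC.
(* Finite lists ordered by inclusion form a filter, so a finite subcover appears as a property of
   all large lists. *)
pose G := filter_from [set: seq T] (fun s0 => [set s : seq T | {subset s0 <= s}]).
have FG : Filter G.
  apply: filter_from_filter; first by exists [::].
  move=> s1 s2 _ _; exists (s1 ++ s2) => // s hs.
  by split=> x xs; apply: hs; rewrite mem_cat xs ?orbT.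
have [s _ Hs] : \forall s \near G, forall x, C x -> exists2 c, c \in s & E r c x.
  apply: (compact_near (P := fun (s : seq T) x => exists2 c, c \in s & E r c x)) => // x _.
  exists ([set y | E r x y], [set s : seq T | {subset [:: x] <= s}]) => /=.
    by split; [exact: bs_nbhs_ball | exists [:: x]].
  by move=> [y s] [/= xy xs]; exists x => //; apply: xs; rewrite inE.
by exists s; exact: Hs.
Qed.

Lemma bs_indic (R : realType) r c : compact [set x | E r c x] ->
  (fun x => (`[< E r c x >])%:R) \in @schwartz R T.
Proof.
move=> cC; apply: (schwartz_near bs_hausdorff cC).
  by move=> x; case: asboolP => // _; rewrite eqxx.
move=> x; apply/(bs_nbhs BE); exists r => y xy.
congr (_%:R); congr nat_of_bool; apply/asbool_equiv_eq; split => h.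
  exact: bs_trans BE _ _ _ _ h (bs_sym BE xy).
exact: bs_trans BE _ _ _ _ h xy.
Qed.

End BallStructure.

(** * Congruence subgroups *)

Section CongruenceSubgroups.
Variables (F : localFieldType) (O : set F) (pi : F).
Hypothesis OP : integer_ring O pi.
Local Notation mxb := (mxball O pi).

Definition mxE_ball m n r (M N : 'M[F]_(m, n)) := mxb r (N - M).

Lemma ball_structure_mx m n : ball_structure (@mxE_ball m n).
Proof.
split.
- by move=> r M; rewrite /mxE_ball subrr; exact: (mxball0 OP).
- by move=> r M N; exact: (mxballC OP).
- move=> r M N P MN NP; rewrite /mxE_ball -(subrK N P) -addrA.
  exact: (mxballD OP).
- by move=> r s M N; exact: (mxball_le OP).
- by move=> M U; exact: (nbhs_mxballP OP).
- by move=> M N MN; apply/eqP; rewrite eq_sym -subr_eq0; apply/eqP/(mxball_eq0 OP).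
Qed.

Lemma compact_mxE_ball m n r (M : 'M[F]_(m, n)) : compact [set N | mxE_ball r M N].
Proof.
rewrite (_ : [set N | _] = [set M + N | N in [set N | mxb r N]]).
  apply: continuous_compact; last exact: (compact_mxball OP).
  apply: continuous_subspaceT; apply: continuous_mx => i j.
  rewrite (_ : (fun _ => _) = fun N : 'M[F]_(m, n) => M i j + N i j); last first.
    by apply/funext => N'; rewrite mxE.
  move=> N'; apply: (@cvg_addf F _ (nbhs N') (fun=> M i j) (fun N => N i j)).
    exact: cvg_cst.
  exact: (@continuous_coord F _ m n id i j (@continuous_idfun _)).
apply/seteqP; split=> [N MN|_ [N rN <-]]; last by rewrite /mxE_ball /= addrC addKr.
by exists (N - M); rewrite // addrC subrK.
Qed.

Definition triple_ball m : nat -> triple F m -> triple F m -> Prop :=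
  prod_ball (prod_ball (@mxE_ball m m) (@mxE_ball m 1)) (@mxE_ball 1 m).

Lemma ball_structure_triple m : ball_structure (@triple_ball m).
Proof.
apply: ball_structure_prod; last exact: ball_structure_mx.
by apply: ball_structure_prod; exact: ball_structure_mx.
Qed.

Lemma compact_triple_ball m r (x : triple F m) : compact [set y | triple_ball r x y].
Proof.
have := compact_setX (compact_setX (@compact_mxE_ball _ _ r x.1.1)
  (@compact_mxE_ball _ _ r x.1.2)) (@compact_mxE_ball _ _ r x.2).
by congr compact; apply/seteqP; split=> y [].
Qed.

Section OneSize.
Variable n : nat.
Implicit Types g h k : GLinear F n.

(* [KO 0] is GL_n over the integer ring. *)
Definition KO r : set (GLinear F n) :=
  [set g | mxb r (Defs.GLval g - 1%:M) /\ mxb r (invmx g - 1%:M)].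

Lemma GLmulE g h : Defs.GLval (g * h)%g = g *m h. Proof. by []. Qed.
Lemma GLinvE g : Defs.GLval g^-1%g = invmx g. Proof. by []. Qed.
Lemma GLmulV g : g *m invmx g = 1%:M. Proof. by rewrite mulmxV ?Defs.GLvalP. Qed.
Lemma GLmulVl g : invmx g *m g = 1%:M. Proof. by rewrite mulVmx ?Defs.GLvalP. Qed.

Lemma KO1 r : KO r 1%g.
Proof.
by rewrite /KO /= invmx1 subrr; split; exact: (mxball0 OP).
Qed.

Lemma KOV r g : KO r g -> KO r g^-1%g.
Proof. by move=> [h h']; rewrite /KO /= invmxK. Qed.

Lemma KO_le r s g : (r <= s)%N -> KO s g -> KO r g.
Proof. by move=> rs [h h']; split; exact: (mxball_le OP rs). Qed.

Lemma KO_mx r g : KO r g -> mxb 0 g.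
Proof.
move=> [/(mxball_le OP (leq0n r)) h _]; rewrite -(subrK 1%:M (Defs.GLval g)).
by apply: (mxballD OP) => //; exact: (mxball1 OP).
Qed.

Lemma KO_mxV r g : KO r g -> mxb 0 (invmx g).
Proof. by move=> /KOV /KO_mx. Qed.

Lemma KO0P g : mxb 0 g -> mxb 0 (invmx g) -> KO 0 g.
Proof.
by move=> h h'; split; apply: (mxballB OP) => //; exact: (mxball1 OP).
Qed.

Lemma KO_suff r g : mxb 0 g -> mxb 0 (invmx g) -> mxb r (Defs.GLval g - 1%:M) -> KO r g.
Proof.
move=> h h' hg; split=> //.
rewrite (_ : invmx g - 1%:M = invmx g *m (1%:M - Defs.GLval g)).
  by apply: (mxballMl OP) => //; exact: (mxballC OP).
by rewrite mulmxBr mulmx1 GLmulVl.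
Qed.

Lemma KO_near s g : (0 < s)%N -> mxb s (Defs.GLval g - 1%:M) -> KO s g.
Proof. by move=> s0 sg; split=> //; have [] := mxball_invmx OP s0 sg. Qed.

Lemma KOM r g h : KO r g -> KO r h -> KO r (g * h)%g.
Proof.
move=> gK hK; apply: KO_suff.
- by apply: (mxballMl OP (KO_mx gK)); exact: KO_mx hK.
- by rewrite -GLinvE invgM; apply: (mxballMl OP (KO_mxV hK)); exact: KO_mxV gK.
- rewrite GLmulE (_ : _ - _ = (Defs.GLval g - 1%:M) *m h + (Defs.GLval h - 1%:M)).
    apply: (mxballD OP); last by case: hK.
    by apply: (mxballMr OP); [case: gK | exact: KO_mx hK].
  by rewrite mulmxBl mul1mx addrA subrK.
Qed.

Lemma KO_norm r k g : KO 0 k -> KO r g -> KO r (k * g * k^-1)%g.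
Proof.
move=> kK gK; have gK0 := KO_le (leq0n r) gK.
have kgk : KO 0 (k * g * k^-1)%g by do 2?apply: KOM => //; exact: KOV.
apply: KO_suff; [exact: KO_mx kgk | exact: KO_mxV kgk |].
rewrite !GLmulE GLinvE (_ : _ - _ = k *m (Defs.GLval g - 1%:M) *m invmx k).
  apply: (mxballMr OP); last exact: KO_mxV kK.
  by apply: (mxballMl OP); [exact: KO_mx kK | case: gK].
by rewrite mulmxBr mulmx1 mulmxBl GLmulV.
Qed.

Lemma KO_trV r g : KO r g -> KO r (GLtrV g).
Proof.
move=> [h h']; split=> /=.
  by rewrite -trmx_inv -(trmx1 F n) -linearB; exact: (mxball_tr h').
by rewrite invmxK -(trmx1 F n) -linearB; exact: (mxball_tr h).
Qed.

Lemma KO_conj h : exists a, forall r g, KO (a + r) g -> KO r (h * g * h^-1)%g.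
Proof.
have [b Hb] := mxball_bound OP (Defs.GLval h).
have [c Hc] := mxball_bound OP (invmx h).
(* b and c bound the denominators of h and of its inverse. *)
exists (b + c)%N.
have aux r g : mxb (b + c + r) (Defs.GLval g - 1%:M) ->
    mxb r (Defs.GLval (h * g * h^-1)%g - 1%:M).
  move=> gr; apply/(mxball_pi OP (b + c)).
  rewrite !GLmulE GLinvE exprD -scalerA.
  rewrite (_ : _ - _ = h *m (Defs.GLval g - 1%:M) *m invmx h); last first.
    by rewrite mulmxBr mulmx1 mulmxBl GLmulV.
  rewrite [X in _ *: X]scalemxAr scalemxAl scalemxAl.
  apply: (mxballMr OP) Hc; exact: (mxballMl OP).
move=> r g [g1 g2]; split; first exact: aux.
have := aux r g^-1%g g2.
by rewrite (_ : (h * g^-1 * h^-1 = (h * g * h^-1)^-1)%g) // !invgM invgK mulgA.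
Qed.

(** Finitely many balls of level r cover the integral matrices, and one element of [J] is picked in
    each ball that meets [J]. Two elements of [KO 0] in a common ball lie in the same left coset of
    [KO r]. *)
Lemma KO_reps (J : set (GLinear F n)) r : J `<=` KO 0 ->
  exists s : seq (GLinear F n), (forall k, k \in s -> J k) /\
    forall j, J j -> exists2 k, k \in s & KO r (k^-1 * j)%g.
Proof.
move=> JK.
have [l Hl] := bs_cover (ball_structure_mx n n) r (@compact_mxE_ball n n 0 0).
suff [s [sJ Hs]] : exists s : seq (GLinear F n), (forall k, k \in s -> J k) /\
    forall j, J j -> (exists2 c, c \in l & mxE_ball r c (Defs.GLval j)) ->
      exists2 k, k \in s & mxE_ball r (Defs.GLval k) (Defs.GLval j).
  exists s; split=> // j Jj.
  have [|k ks kj] := Hs j Jj.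
    by apply: Hl; rewrite /mxE_ball /= subr0; exact: KO_mx (JK _ Jj).
  have kK := JK _ (sJ k ks); have jK := JK _ Jj.
  have kjK : KO 0 (k^-1 * j)%g by apply: KOM => //; exact: KOV.
  exists k => //; apply: KO_suff; [exact: KO_mx kjK | exact: KO_mxV kjK |].
  rewrite GLmulE GLinvE -(GLmulVl k) -mulmxBr.
  by apply: (mxballMl OP) => //; exact: KO_mxV kK.
elim: l {Hl} => [|c l [s [sJ Hs]]]; first by exists [::]; split=> // j _ [].
have [[k [Jk ck]]|nk] := pselect (exists k, J k /\ mxE_ball r c (Defs.GLval k)); last first.
  exists s; split=> // j Jj [c']; rewrite inE => /orP[/eqP -> cj|cl cj].
    by case: nk; exists j.
  by apply: Hs => //; exists c'.
exists (k :: s); split=> [k'|j Jj [c']]; rewrite inE => /orP[/eqP ->|].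
- exact: Jk.
- exact: sJ.
- move=> cj; exists k; first by rewrite inE eqxx.
  exact: bs_trans (ball_structure_mx n n) _ _ _ _ (bs_sym (ball_structure_mx n n) ck) cj.
- move=> cl cj; have [|k' ks kj] := Hs j Jj; first by exists c'.
  by exists k' => //; rewrite inE ks orbT.
Qed.

(** [GLinear] is given no topology, so the action is extended to arbitrary pairs of matrices, the
    second standing for the inverse of the first. Neighbourhoods of (1, 1) replace those of the
    identity of the group. *)
Definition pact (z : ('M[F]_n * 'M[F]_n) * triple F n) : triple F n :=
  (z.1.1 *m z.2.1.1 *m z.1.2, z.1.1 *m z.2.1.2, z.2.2 *m z.1.2).

Lemma pact_continuous : continuous pact.
Proof.
have c1 : continuous (fun z : ('M[F]_n * 'M[F]_n) * triple F n => z.1.1).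
  exact/continuous_fst_comp/continuous_fst_comp/continuous_idfun.
have c2 : continuous (fun z : ('M[F]_n * 'M[F]_n) * triple F n => z.1.2).
  exact/continuous_snd_comp/continuous_fst_comp/continuous_idfun.
apply: continuous_pair; last first.
  by apply: continuous_mulmx c2; exact/continuous_snd_comp/continuous_snd_comp/continuous_idfun.
apply: continuous_pair.
  apply: continuous_mulmx c2; apply: continuous_mulmx c1 _.
  exact/continuous_fst_comp/continuous_fst_comp/continuous_snd_comp/continuous_idfun.
apply: continuous_mulmx c1 _.
exact/continuous_snd_comp/continuous_fst_comp/continuous_snd_comp/continuous_idfun.
Qed.

Lemma pactE g (x : triple F n) : pact (Defs.GLval g, invmx g, x) = act (GLt g false) x.
Proof. by case: x => [[A v] phi]. Qed.

Lemma nbhs1_KO (U : set ('M[F]_n * 'M[F]_n)) : nbhs (1%:M, 1%:M) U ->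
  exists r, forall g, KO r g -> U (Defs.GLval g, invmx g).
Proof.
move=> /(bs_nbhs (ball_structure_prod (ball_structure_mx n n) (ball_structure_mx n n))).
by move=> [r rU]; exists r => g [g1 g2]; apply: rU.
Qed.

Lemma act_inv g (x : triple F n) : act (GLt g^-1%g false) (act (GLt g false) x) = x.
Proof.
rewrite -actM (_ : (GLt g^-1 false * GLt g false)%g = 1%g) ?act1 //.
by congr GLt; exact: mulVg.
Qed.

Lemma schwartz_KO (R : realType) (f : triple F n -> R[i]) : f \in @schwartz R _ ->
  exists r, forall k x, KO r k -> f (act (GLt k false) x) = f x.
Proof.
move=> fS.
have p1 x : pact (1%:M, 1%:M, x) = x.
  by case: x => [[A v] phi]; rewrite /pact /= !mul1mx !mulmx1.
have U := schwartz_action (p0 := (1%:M, 1%:M)) fS pact_continuous p1.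
have [r rU] := nbhs1_KO U; exists r => k x kK.
have Hr h y : KO r h -> f y != 0 -> f (act (GLt h false) y) = f y.
  by move=> hK; rewrite -pactE; apply: rU.
have [fx|/Hr] := eqVneq (f x) 0; last exact.
have [fkx|] := eqVneq (f (act (GLt k false) x)) 0; first by rewrite fx fkx.
by move=> /(Hr _ _ (KOV kK)); rewrite act_inv.
Qed.

End OneSize.
End CongruenceSubgroups.

(** * Triples with cyclic vector and covector *)

Section TestFunSums.
Variables (R : realType) (X : topologicalType).

Lemma testFunDE (f g : testFun R X) x : (f + g) x = f x + g x.
Proof. by []. Qed.

Lemma testFun_sumE (L : seq (testFun R X)) x :
  (\sum_(f <- L) f) x = \sum_(f <- L) f x.
Proof. by elim: L => [|f L IH]; rewrite ?big_nil // !big_cons testFunDE IH. Qed.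

Lemma testFun_inj (f g : testFun R X) : (forall x, f x = g x) -> f = g.
Proof. by move=> fg; apply/val_inj/funext. Qed.

End TestFunSums.

Section CyclicLocus.
Variables (F : fieldType) (n : nat).
Implicit Types (A : 'M[F]_n) (v : 'cV[F]_n) (phi : 'rV[F]_n).

(** Invertible exactly when v is a cyclic vector of A; with [A^T] and [phi^T] it expresses cyclicity
    of the covector. *)
Definition krylov A v : 'M[F]_n := \matrix_(i, j) (A ^+ j *m v) i ord0.

Lemma trmx_exp A k : (A ^+ k)^T = A^T ^+ k.
Proof.
elim: k => [|k IH]; first by rewrite !expr0 trmx1.
by rewrite exprS exprSr -IH; exact: trmx_mul.
Qed.

Lemma col_mulmx m p q (A : 'M[F]_(m, p)) (B : 'M[F]_(p, q)) j :
  col j (A *m B) = A *m col j B.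
Proof.
by apply/matrixP => i k; rewrite !mxE; apply: eq_bigr => l _; rewrite mxE.
Qed.

Lemma col_krylov A v j : col j (krylov A v) = A ^+ j *m v.
Proof. by apply/matrixP => i k; rewrite [k]ord1 mxE mxE. Qed.

Lemma row_krylov A phi i : row i (krylov A^T phi^T)^T = phi *m A ^+ i.
Proof. by rewrite -tr_col col_krylov -trmx_exp -trmx_mul trmxK. Qed.

(** The rows phi A^i against the columns A^j v form a Hankel matrix of moments. It depends on i + j
    only, hence is symmetric; this gives the symmetry of [symmetrizer] for e = 0 and its commutation
    with A for e = 1. *)
Lemma krylov_hankel A v phi e i j :
  ((krylov A^T phi^T)^T *m A ^+ e *m krylov A v) i j =
  (phi *m A ^+ (i + e + j) *m v) ord0 ord0.
Proof.
transitivity (col j (row i ((krylov A^T phi^T)^T *m A ^+ e *m krylov A v)) ord0 ord0).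
  by rewrite [RHS]mxE [RHS]mxE.
have -> : A ^+ (i + e + j) = A ^+ i *m A ^+ e *m A ^+ j by rewrite !exprD.
by rewrite !row_mul row_krylov col_mulmx col_krylov !mulmxA.
Qed.

Lemma krylov_hankel_sym A v phi e :
  ((krylov A^T phi^T)^T *m A ^+ e *m krylov A v)^T =
  (krylov A^T phi^T)^T *m A ^+ e *m krylov A v.
Proof.
by apply/matrixP => i j; rewrite mxE !krylov_hankel [in LHS]addnC (addnC (j : nat)) addnA.
Qed.

Section Symmetrizer.
Variables (A : 'M[F]_n) (v : 'cV[F]_n) (phi : 'rV[F]_n).
Let C := krylov A v.
Let Q := krylov A^T phi^T.
Hypotheses (Cu : C \in unitmx) (Qu : Q \in unitmx).

(** The change of basis taking the vectors (A^T)^j phi^T to the vectors A^j v. *)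
Definition symmetrizer := C *m invmx Q.

Lemma symmetrizer_unit : symmetrizer \in unitmx.
Proof. by rewrite unitmx_mul Cu unitmx_inv. Qed.

Lemma krylov_QC : Q^T *m C = C^T *m Q.
Proof.
have := krylov_hankel_sym A v phi 0; rewrite expr0 mulmx1 -/C -/Q.
by rewrite trmx_mul trmxK => ->.
Qed.

Lemma symmetrizerE : symmetrizer = invmx Q^T *m C^T.
Proof.
apply: (can_inj (mulmxK Qu)); rewrite mulmxKV// -mulmxA -krylov_QC mulKmx//.
by rewrite unitmx_tr.
Qed.

Lemma symmetrizer_sym : symmetrizer^T = symmetrizer.
Proof. by rewrite [RHS]symmetrizerE trmx_mul trmx_inv. Qed.

Lemma symmetrizer_A : symmetrizer *m A^T = A *m symmetrizer.
Proof.
have QTu : Q^T \in unitmx by rewrite unitmx_tr.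
apply: (can_inj (mulKmx QTu)); apply: (can_inj (mulmxK Qu)).
rewrite /= !mulmxA [RHS]mulmxKV// krylov_QC mulmxK//.
have := krylov_hankel_sym A v phi 1; rewrite expr1 -/C -/Q => <-.
by rewrite !trmx_mul trmxK mulmxA.
Qed.

Lemma symmetrizer_v : symmetrizer *m phi^T = v.
Proof.
have QTu : Q^T \in unitmx by rewrite unitmx_tr.
apply: (can_inj (mulKmx QTu)); rewrite /= !mulmxA krylov_QC mulmxK//.
apply/matrixP => i j; rewrite ord1.
rewrite -trmx_mul mxE.
transitivity ((col i (phi *m C)) ord0 ord0); first by rewrite [RHS]mxE.
transitivity ((row i (Q^T *m v)) ord0 ord0); last by rewrite [LHS]mxE.
by rewrite row_mul row_krylov col_mulmx col_krylov mulmxA.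
Qed.

End Symmetrizer.
End CyclicLocus.

Lemma continuous_exp (K : topologicalFieldType) (T : topologicalType) n
    (f : T -> 'M[K]_n) k : continuous f -> continuous (fun t => f t ^+ k).
Proof.
move=> fc; elim: k => [|k IH]; first exact: continuous_const.
rewrite (_ : (fun t => _) = (fun t => f t *m f t ^+ k)).
  exact: continuous_mulmx.
by apply/funext => t; rewrite exprS.
Qed.

Lemma continuous_krylov (K : topologicalFieldType) (T : topologicalType) n
    (f : T -> 'M[K]_n) (g : T -> 'cV[K]_n) :
  continuous f -> continuous g -> continuous (fun t => krylov (f t) (g t)).
Proof.
move=> fc gc; apply: continuous_mx => i j.
rewrite (_ : (fun t => _) = (fun t => (f t ^+ j *m g t) i ord0)).
  by apply/continuous_coord/continuous_mulmx => //; exact: continuous_exp.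
by apply/funext => t; rewrite mxE.
Qed.

Definition vanishes_at (R : realType) (X : topologicalType) (xi : distribution R X)
  (x : X) := exists2 U, open U /\ vanishes_on xi U & U x.

Lemma vanishes_atP (R : realType) (X : topologicalType) (xi : distribution R X) x :
  (exists2 W, nbhs x W & forall Phi : testFun R X,
    (forall y, Phi y != 0 -> W y) -> xi Phi = 0) -> vanishes_at xi x.
Proof.
move=> [W xW HW]; exists (W°) => //; split; first exact: open_interior.
move=> Phi sPhi; apply: HW => y /fsupport_neq0 /sPhi; exact: interior_subset.
Qed.

Lemma GLtM (F : fieldType) n (g h : GLinear F n) d e :
  (GLt g d * GLt h e)%g = GLt (g * sign_act d h)%g (d (+) e).
Proof. by []. Qed.

Lemma symmetrizer_act (F : fieldType) n (A : 'M[F]_n) v phi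
    (Cu : krylov A v \in unitmx) (Qu : krylov A^T phi^T \in unitmx) :
  act (GLt (GLin (symmetrizer_unit Cu Qu)) true) (A, v, phi) = (A, v, phi).
Proof.
have Su := symmetrizer_unit Cu Qu; rewrite /act /=; congr (_, _, _).
- by rewrite symmetrizer_A// mulmxK.
- exact: symmetrizer_v.
- apply: (can_inj (mulmxK Su)).
  by rewrite mulmxKV// -{1}(symmetrizer_v v Qu) trmx_mul trmxK symmetrizer_sym.
Qed.

Section CyclicVanishing.
Variables (F : localFieldType) (O : set F) (pi : F).
Hypothesis OP : integer_ring O pi.
Variables (R : realType) (n : nat) (xi : distribution R (triple F n)).
Hypothesis xi_eq : equivariant xi.
Local Notation mxb := (mxball O pi).
Local Notation KO := (@KO F O pi n).
Implicit Types (g h k : GLinear F n) (x y : triple F n).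

(** Averaging without a measure: f' is the sum of the distinct translates of f by K, finitely many
    since some [KO r] fixes f. K permutes them, and xi f' is xi f times their positive number. *)
Lemma schwartz_orbit (f : testFun R (triple F n)) (K : set (GLinear F n)) :
  K `<=` KO 0 -> K 1%g -> (forall g, K g -> K g^-1%g) ->
  (forall g h, K g -> K h -> K (g * h)%g) ->
  exists f' : testFun R (triple F n),
    [/\ forall k x, K k -> f' (act (GLt k false) x) = f' x,
        forall x, f' x != 0 -> exists2 k, K k & f (act (GLt k false) x) != 0 &
        xi f' = 0 -> xi f = 0].
Proof.
move=> KK K1 KV KM.
have [r Hr] := schwartz_KO OP (testFunP f).
have [s [sK Hs]] := KO_reps OP r KK.
pose tr k := translate (GLt k false) f.
(* A translate of f by k depends only on the right coset of k, while [s] represents left cosets;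
   hence the inverses. *)
pose L := undup [seq tr k^-1%g | k <- s].
have LP f' : f' \in L -> exists2 k, K k & f' = tr k.
  rewrite mem_undup => /mapP[k /sK kK ->]; exists k^-1%g => //; exact: KV.
have trL k : K k -> tr k \in L.
  move=> kK; have [j js jk] := Hs _ (KV _ kK).
  rewrite mem_undup; apply/mapP; exists j => //; apply: testFun_inj => x /=.
  have /Hr E : KO r ((j^-1 * k^-1)^-1)%g by exact: KOV.
  rewrite -[RHS]E -actM GLtM /=; congr (f (act (GLt _ false) x)).
  by rewrite invgM !invgK mulgK.
have LU : uniq L := undup_uniq _.
exists (\sum_(f' <- L) f'); split.
- move=> k x kK; rewrite !testFun_sumE.
  rewrite -(big_map (translate (GLt k false)) xpredT (fun f' : testFun R _ => f' x)).
  apply: perm_big; apply: uniq_perm => //.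
    rewrite map_inj_uniq// => f1 f2 e; apply: testFun_inj => y.
    have := congr1 (fun f : testFun R _ => f (act (GLt k^-1%g false) y)) e.
    by rewrite /= -!actM !GLtM /= mulgV act1.
  have subL : {subset [seq translate (GLt k false) f' | f' <- L] <= L}.
    move=> _ /mapP[f' /LP[j jK ->] ->].
    rewrite (_ : translate _ _ = tr (j * k)%g); first by apply/trL/KM.
    by apply: testFun_inj => y /=; rewrite -actM.
  apply: (uniq_min_size _ subL _).2; last by rewrite size_map.
  rewrite map_inj_uniq// => f1 f2 e; apply: testFun_inj => y.
  have := congr1 (fun f : testFun R _ => f (act (GLt k^-1%g false) y)) e.
  by rewrite /= -!actM !GLtM /= mulgV act1.
- move=> x; rewrite testFun_sumE => nz; apply: contrapT => nex; move/eqP: nz; apply.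
  rewrite big_seq big1// => f' /LP[k kK ->] /=; apply: contrapT => /eqP nz.
  by apply: nex; exists k.
- rewrite linear_sum big_seq (eq_bigr (fun=> xi f)); last first.
    move=> f' /LP[k kK ->]; rewrite xi_eq /chi /= expr0 mul1r //.
  rewrite -big_seq big_const_seq iter_addr_0 count_predT => /eqP.
  rewrite mulrn_eq0 => /orP[|/eqP //]; rewrite size_eq0 => /eqP L0.
  by have := trL _ K1; rewrite L0.
Qed.

Lemma cyclic_vanishes A v phi : krylov A v \in unitmx ->
  krylov A^T phi^T \in unitmx -> vanishes_at xi (A, v, phi).
Proof.
move=> Cu Qu.
pose S := GLin (symmetrizer_unit Cu Qu).
have SS : (Defs.GLval S)^T = S by exact: symmetrizer_sym.
have trVS : GLtrV S = S^-1%g by apply/val_inj; rewrite /= symmetrizer_sym.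
pose h0 : GLtilde F n := GLt S true.
have h02 : (h0 * h0)%g = 1%g by rewrite GLtM /= trVS mulgV.
(* Conjugation by [h0], as [h0tau] records; it is an involution because S is symmetric. *)
pose tau g := (S * GLtrV g * S^-1)%g.
have trVM : {morph (@GLtrV F n) : g h / (g * h)%g} by exact: (sign_actM true).
have trVK g : GLtrV (GLtrV g) = g.
  by have := sign_act_addb true true g; rewrite /= => <-.
have trVV g : GLtrV g^-1%g = (GLtrV g)^-1%g.
  apply/(mulgI (GLtrV g)); rewrite -trVM !mulgV; exact: (@sign_act1 F n true).
have tauM : {morph tau : g h / (g * h)%g}.
  by move=> g h; rewrite /tau trVM !mulgA mulgVK.
have tauV g : tau g^-1%g = (tau g)^-1%g.
  by rewrite /tau trVV !invgM invgK mulgA.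
have tauK g : tau (tau g) = g.
  by rewrite /tau !trVM trVK trVV trVS invgK !mulgA mulgV mul1g mulgK.
have tau1 : tau 1%g = 1%g.
  by apply/(mulgI (tau 1%g)); rewrite -tauM !mulg1.
have h0tau g : (h0 * GLt g false)%g = (GLt (tau g) false * h0)%g.
  by rewrite !GLtM /= /tau mulgVK.
(* The intersection of [KO 0] with its image under [tau], hence stable under [tau]. *)
pose K : set (GLinear F n) := [set g | KO 0 g /\ KO 0 (tau g)].
have KM g h : K g -> K h -> K (g * h)%g.
  by move=> [g1 g2] [h1 h2]; split; rewrite ?tauM; exact: (KOM OP).
have KV g : K g -> K g^-1%g.
  by move=> [g1 g2]; split; rewrite ?tauV; exact: KOV.
have K1 : K 1%g by split; rewrite ?tau1; exact: (KO1 OP).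
have Ktau g : K g -> K (tau g) by move=> [g1 g2]; split; rewrite // tauK.
have [a Ka] := KO_conj OP S.
have {Ka} KOK r g : (a <= r)%N -> KO r g -> K g.
  move=> ar gK; split; first exact: (KO_le OP (leq0n r)) gK.
  by apply: Ka; rewrite addn0; apply: (KO_le OP ar); exact: KO_trV.
pose Cx x := krylov x.1.1 x.1.2; pose Qx x := krylov x.1.1^T x.2^T.
have cA : continuous (fun x : triple F n => x.1.1).
  exact/continuous_fst_comp/continuous_fst_comp/continuous_idfun.
have cv : continuous (fun x : triple F n => x.1.2).
  exact/continuous_snd_comp/continuous_fst_comp/continuous_idfun.
have cphi : continuous (fun x : triple F n => x.2).
  exact/continuous_snd_comp/continuous_idfun.
have Cc : continuous Cx by exact: continuous_krylov.
have Qc : continuous Qx by apply: continuous_krylov; exact: continuous_trmx.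
pose c0 := GLin Cu; pose q0 := GLin Qu.
have [b Hb] := KO_conj OP c0.
(* Level a suffices for membership in [K], and conjugation by [c0] costs b further levels; the
   successor provides the positivity that [mxball_invmx] demands. *)
pose s := (maxn a b + a).+1.
pose W : set (triple F n) := [set x |
  mxb s (Cx x *m invmx c0 - 1%:M) /\ mxb s (invmx q0 *m Qx x - 1%:M)].
have nW : nbhs (A, v, phi) W.
  apply: filterI.
    have /(_ [set M | mxb s (M - 1%:M)]) :
        (fun x => Cx x *m invmx c0) @ (A, v, phi) --> (1%:M : 'M[F]_n).
      rewrite -[X in _ --> X](mulmxV Cu).
      have := @continuous_mulmx F _ _ _ _ _ (fun=> invmx c0) Cc
        (@continuous_const _ _ (invmx c0)).
      by move=> /(_ (A, v, phi)).
    by apply; apply/(nbhs_mxballP OP); exists s.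
  have /(_ [set M | mxb s (M - 1%:M)]) :
      (fun x => invmx q0 *m Qx x) @ (A, v, phi) --> (1%:M : 'M[F]_n).
    rewrite -[X in _ --> X](mulVmx Qu).
    have := @continuous_mulmx F _ _ _ _ (fun=> invmx q0) _
      (@continuous_const _ _ (invmx q0)) Qc.
    by move=> /(_ (A, v, phi)).
  by apply; apply/(nbhs_mxballP OP); exists s.
(* Since (S(x), -1) fixes x, [h0] moves x as S S(x)^-1 does. This quotient is split into a conjugate
   by [c0] of q0^-1 q and the inverse of c c0^-1, both close to 1. *)
have HW x : W x -> exists2 k, K k & act h0 x = act (GLt k false) x.
  case: x => [[A' v'] phi']; set x := (A', v', phi') => -[xC xQ].
  have [Cxu' _] := mxball_invmx OP (ltn0Sn _) xC.
  have [Qxu' _] := mxball_invmx OP (ltn0Sn _) xQ.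
  have Cxu : Cx x \in unitmx.
    by move: Cxu'; rewrite unitmx_mul => /andP[].
  have Qxu : Qx x \in unitmx.
    by move: Qxu'; rewrite unitmx_mul => /andP[].
  pose c := GLin Cxu; pose q := GLin Qxu.
  pose Sx := GLin (symmetrizer_unit Cxu Qxu).
  have Sxx : act (GLt Sx true) x = x by exact: symmetrizer_act.
  exists (S * Sx^-1)%g; last first.
    by rewrite -[in RHS]Sxx -actM GLtM [sign_act _ _]/= mulgVK.
  rewrite (_ : (S * Sx^-1)%g =
    ((c0 * (q0^-1 * q) * c0^-1) * (c * c0^-1)^-1)%g); last first.
    have -> : S = (c0 * q0^-1)%g by apply/val_inj.
    have -> : Sx = (c * q^-1)%g by apply/val_inj.
    by rewrite !invgM !invgK !mulgA mulgVK.
  apply: KM.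
    apply: (KOK a) => //; apply: Hb; apply: (KO_le OP (s := s)).
      by rewrite /s leqW// leq_add2r leq_maxr.
    by apply: (KO_near OP).
  apply/KV/(KOK s); last exact: (KO_near OP).
  by rewrite /s leqW// leq_addl.
apply: vanishes_atP; exists W => // f fW.
have [f' [f'K f'f]] := schwartz_orbit (K := K) f (fun g => @proj1 _ _) K1 KV KM.
apply.
(* Here k x is in [W] for some k in [K], and [h0] = tau(k)^-1 h0 k reduces the claim to the point k
   x. *)
have f'h0_aux x : f' x != 0 -> f' (act h0 x) = f' x.
  move=> /f'f[k kK /fW /HW[k1 k1K e]].
  have {}e : act h0 x = act (GLt ((tau k)^-1 * (k1 * k))%g false) x.
    have := congr1 (act (GLt (tau k)^-1%g false)) e.
    by rewrite -!actM -!mulgA h0tau !GLtM /= mulKg.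
  by rewrite e; apply: f'K; apply: (KM); [exact/KV/Ktau | exact: KM].
have f'h0 : translate h0 f' = f'.
  apply: testFun_inj => x /=.
  have [fx|/f'h0_aux //] := eqVneq (f' x) 0.
  have [->//|fh] := eqVneq (f' (act h0 x)) 0.
  by rewrite -(f'h0_aux _ fh) -actM h02 act1.
have := xi_eq h0 f'; rewrite f'h0 /chi /= expr1 mulN1r => /eqP.
by rewrite -addr_eq0 -mulr2n mulrn_eq0 => /eqP.
Qed.

End CyclicVanishing.

(** * Polynomials in a matrix *)

Section PolyEval.
Variable F : fieldType.

(* [horner_mx] is only available in dimension [n.+1]. *)
Definition peval n (p : {poly F}) (A : 'M[F]_n) : 'M[F]_n :=
  \sum_(i < size p) p`_i *: A ^+ i.

Lemma horner_mxE n (p : {poly F}) (A : 'M[F]_n.+1) : horner_mx A p = peval p A.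
Proof.
rewrite -{1}[p]coefK poly_def linear_sum; apply: eq_bigr => i _.
by rewrite linearZ /= rmorphXn /= horner_mx_X.
Qed.

Lemma expmxS n (A : 'M[F]_n) k : A ^+ k.+1 = A *m A ^+ k.
Proof. exact: exprS. Qed.

Lemma peval_comm n (p : {poly F}) (A B : 'M[F]_n) :
  A *m B = B *m A -> peval p A *m B = B *m peval p A.
Proof.
move=> AB; rewrite mulmx_suml mulmx_sumr; apply: eq_bigr => i _.
rewrite -scalemxAl -scalemxAr; congr (_ *: _).
elim: (i : nat) => [|k IH]; first by rewrite mul1mx mulmx1.
by rewrite expmxS -mulmxA IH mulmxA AB mulmxA.
Qed.

Lemma peval_tr n (p : {poly F}) (A : 'M[F]_n) : (peval p A)^T = peval p A^T.
Proof.
by rewrite raddf_sum; apply: eq_bigr => i _ /=; rewrite linearZ /= trmx_exp.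
Qed.

Lemma peval_conj n (p : {poly F}) (A g : 'M[F]_n) : g \in unitmx ->
  peval p (g *m A *m invmx g) = g *m peval p A *m invmx g.
Proof.
move=> gu; rewrite mulmx_sumr mulmx_suml; apply: eq_bigr => i _.
rewrite -scalemxAr -scalemxAl; congr (_ *: _).
elim: (i : nat) => [|k IH]; first by rewrite mulmx1 mulmxV.
by rewrite !expmxS IH !mulmxA mulmxKV.
Qed.

Lemma exp_block_diag n1 n2 (A : 'M[F]_n1) (B : 'M[F]_n2) k :
  (block_mx A 0 0 B) ^+ k = block_mx (A ^+ k) 0 0 (B ^+ k).
Proof.
elim: k => [|k IH]; first by rewrite !expr0 -[RHS]scalar_mx_block.
rewrite !expmxS IH mulmx_block.
by rewrite !mul0mx !mulmx0 !addr0 add0r.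
Qed.

Lemma peval_block n1 n2 (p : {poly F}) (A : 'M[F]_n1) (B : 'M[F]_n2) :
  peval p (block_mx A 0 0 B) = block_mx (peval p A) 0 0 (peval p B).
Proof.
rewrite /peval; elim/big_rec3: _ => [|i x y z _ ->]; first by rewrite block_mx0.
by rewrite exp_block_diag scale_block_mx add_block_mx !scaler0 !add0r.
Qed.

(** The Fitting projection. Write the characteristic polynomial as (X - x)^m r with r prime to X -
    x, and u (X - x)^m + v r = 1. The first summand is idempotent at A by Cayley-Hamilton. It kills
    the eigenvector w because m > 0, so it is not 1; were it 0, then (A - x)^m would be 0. *)
Lemma fitting_idempotent n (A : 'M[F]_n) (x : F) (w : 'cV[F]_n) :
  w != 0 -> A *m w = x *: w -> (forall N, (A - x%:M) ^+ N != 0) ->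
  exists p, [/\ peval p A *m peval p A = peval p A, peval p A != 0 &
               peval p A != 1%:M].
Proof.
case: n A w => [A w|n A w w0 Aw nil].
  by rewrite (_ : w = 0) ?eqxx //; apply/matrixP => -[].
have hw (p : {poly F}) : horner_mx A p *m w = p.[x] *: w.
  elim/poly_ind: p => [|p c IH]; first by rewrite rmorph0 mul0mx horner0 scale0r.
  rewrite rmorphD rmorphM /= horner_mx_X horner_mx_C mulmxDl -[_ * _ *m w]mulmxA.
  rewrite Aw -scalemxAr IH mul_scalar_mx hornerD hornerM hornerX hornerC.
  by rewrite scalerA mulrC -scalerDl.
have [m [r rx qE]] := multiplicity_XsubC (char_poly A) x.
have {}rx : ~~ root r x.
  by move: rx; rewrite (monic_neq0 (char_poly_monic A)).
have m0 : (0 < m)%N.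
  case: m qE => // qE; have := hw (char_poly A).
  rewrite Cayley_Hamilton mul0mx qE expr0 mulr1 => /esym/eqP.
  by rewrite scaler_eq0 (negPf w0) orbF (negPf (rx : r.[x] != 0)).
have cop : coprimep (('X - x%:P) ^+ m) r.
  by apply: coprimep_expl; rewrite coprimep_sym coprimep_XsubC.
have /Bezout_eq1_coprimepP[[u v] /= uv] := cop.
pose p := u * ('X - x%:P) ^+ m.
have pE : p = 1 - v * r by rewrite -uv addrK.
exists p; rewrite -!horner_mxE; split.
- apply/eqP; rewrite -subr_eq0 -[X in _ - X]mulr1 -mulrBr -(rmorph1 (horner_mx A)).
  rewrite -rmorphB -rmorphM /=.
  rewrite (_ : p * (p - 1) = - (u * v * char_poly A)).
    by rewrite rmorphN rmorphM /= Cayley_Hamilton mulr0 oppr0.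
  rewrite {2}pE addrAC subrr add0r mulrN qE /p mulrACA.
  by rewrite [r * _]mulrC.
- apply/eqP => p0; have := nil m; apply/negP; rewrite negbK.
  have vr : horner_mx A (v * r) = 1.
    by rewrite -[v * r](subKr 1) -pE rmorphB /= p0 subr0 rmorph1.
  have -> : (A - x%:M) ^+ m = horner_mx A (('X - x%:P) ^+ m).
    by rewrite rmorphXn rmorphB /= horner_mx_X horner_mx_C.
  rewrite -[X in X == 0]mul1r -vr -rmorphM -mulrA -qE rmorphM /=.
  by rewrite Cayley_Hamilton mulr0.
- apply/eqP => p1; have := hw p; rewrite p1 mul1mx /p hornerM horner_exp.
  rewrite hornerXsubC subrr expr0n eqn0Ngt m0 mulr0 scale0r => w0'.
  by rewrite w0' eqxx in w0.
Qed.

(** In the rank normal form E = L D U, idempotency forces the upper left block of W = U L to be 1.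
    Conjugation by U then gives W D, whose only defect is the lower left block c, and T clears
    it. *)
Lemma idempotent_conj n1 n2 (E : 'M[F]_(n1 + n2)) : E *m E = E -> \rank E = n1 ->
  exists2 g, g \in unitmx & g *m E *m invmx g = block_mx 1%:M 0 0 0.
Proof.
move=> EE rE; pose L := col_ebase E; pose U := row_ebase E.
have Lu : L \in unitmx := col_ebase_unit E.
have Uu : U \in unitmx := row_ebase_unit E.
pose D : 'M[F]_(n1 + n2) := block_mx 1%:M 0 0 0.
have ED : E = L *m D *m U.
  by rewrite -[LHS]mulmx_ebase rE /D -pid_mx_block.
pose W := U *m L.
have DWD : D *m W *m D = D.
  apply: (can_inj (mulKmx Lu)); apply: (can_inj (mulmxK Uu)).
  by rewrite /W /= !mulmxA -ED -[RHS]EE [X in _ = _ *m X]ED !mulmxA.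
have W11 : ulsubmx W = 1%:M.
  have := congr1 (@ulsubmx _ _ _ _ _) DWD.
  rewrite -[W]submxK /D !mulmx_block !mul0mx !mulmx0 !mul1mx !mulmx1 !addr0.
  by rewrite !block_mxKul.
pose c := dlsubmx W.
pose T : 'M[F]_(n1 + n2) := block_mx 1%:M 0 (- c) 1%:M.
pose T' : 'M[F]_(n1 + n2) := block_mx 1%:M 0 c 1%:M.
have TT' : T *m T' = 1%:M.
  rewrite mulmx_block !mul0mx !mulmx0 !mul1mx !mulmx1 !addr0 !add0r addNr.
  by rewrite -scalar_mx_block.
have [Tu T'u] := mulmx1_unit TT'.
have T'E : T' = invmx T by rewrite -[T']mul1mx -(mulVmx Tu) -mulmxA TT' mulmx1.
exists (T *m U); first by rewrite unitmx_mul Tu.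
rewrite (_ : invmx (T *m U) = invmx U *m T'); last first.
  have TUu : T *m U \in unitmx by rewrite unitmx_mul Tu.
  apply: (can_inj (mulmxK TUu)).
  by rewrite mulVmx // !mulmxA T'E mulmxKV // mulVmx.
rewrite {1}ED !mulmxA mulmxK// -[T *m U *m L]mulmxA -/W -[W]submxK W11 -/c.
rewrite /D /T /T' !mulmx_block !mul0mx !mulmx0 !mul1mx !mulmx1 !addr0 ?add0r.
by rewrite addNr !mul0mx !addr0.
Qed.


Section CyclicCriterion.
Variables (n : nat) (A : 'M[F]_n) (v : 'cV[F]_n) (phi : 'rV[F]_n).

(** Cayley-Hamilton reduces A^j to exponents below n, which are those of the columns of [krylov]. *)
Lemma krylov_annihilator (w : 'rV[F]_n) : w *m krylov A v = 0 ->
  forall j, w *m A ^+ j *m v = 0.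
Proof.
case: n A v w => [|m] B u w wK j; first by rewrite [w]thinmx0 !mul0mx.
have low k : (k <= m)%N -> w *m B ^+ k *m u = 0.
  move=> km; have := congr1 (col (inord k)) wK.
  by rewrite col_mulmx col_krylov inordK// mulmxA col0.
rewrite -(horner_mx_X B) -rmorphXn (divp_eq 'X^j (char_poly B)).
rewrite rmorphD rmorphM /= Cayley_Hamilton mulr0 add0r horner_mxE.
rewrite mulmx_sumr mulmx_suml big1 // => i _.
rewrite -scalemxAr -scalemxAl low ?scaler0 // -ltnS.
apply: leq_trans (ltn_ord i) _; rewrite -ltnS -(size_char_poly B).
by rewrite ltn_modp monic_neq0 ?char_poly_monic.
Qed.

(* If the columns [A ^+ j *m v] do not span, [A] and [A + l *: (v *m phi)]
   agree on a nonzero quotient, whatever [l]; they cannot be nilpotent up to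
   two different scalars there. *)
Lemma krylov_unit (x1 x2 l1 l2 : F) N1 N2 : x1 != x2 ->
  (A + l1 *: (v *m phi) - x1%:M) ^+ N1 = 0 ->
  (A + l2 *: (v *m phi) - x2%:M) ^+ N2 = 0 -> krylov A v \in unitmx.
Proof.
move=> x12 nil1 nil2; rewrite -row_free_unit -kermx_eq0; apply/rowV0P => w.
move=> /sub_kermxP /krylov_annihilator wA.
pose good (u : 'rV[F]_n) := forall j, u *m A ^+ j *m v = 0.
have goodA x u : good u -> good (u *m (A - x%:M)).
  move=> gu j; rewrite mulmxBr mul_mx_scalar !mulmxBl -scalemxAl -scalemxAl gu.
  by rewrite scaler0 subr0 -(mulmxA u) -expmxS gu.
have goodB x l u : good u ->
    u *m (A + l *: (v *m phi) - x%:M) = u *m (A - x%:M).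
  move=> gu; rewrite addrAC mulmxDr -scalemxAr mulmxA.
  by have := gu 0%N; rewrite mulmx1 => ->; rewrite mul0mx scaler0 addr0.
have goodX x l u k : good u -> u *m (A + l *: (v *m phi) - x%:M) ^+ k =
    u *m (A - x%:M) ^+ k /\ good (u *m (A - x%:M) ^+ k).
  move=> gu; elim: k => [|k [IH gk]]; first by rewrite !mulmx1.
  rewrite !exprSr -![_ ^+ k * _]/(_ *m _) !mulmxA IH goodB//; split=> //.
  exact: goodA.
apply/eqP; apply: contraT => w0.
have ex : exists k, w *m (A - x1%:M) ^+ k == 0.
  by exists N1; rewrite -(goodX x1 l1 w N1 wA).1 nil1 mulmx0.
case: (ex_minnP ex) => -[|k] /eqP wk kmin.
  by rewrite mulmx1 in wk; rewrite wk eqxx in w0.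
(* By minimality of the exponent, u is a nonzero left eigenvector of A for x1. On it A - x2 is
   multiplication by x1 - x2, which is not nilpotent. *)
pose u := w *m (A - x1%:M) ^+ k.
have u0 : u != 0 by apply: contraT; rewrite negbK => /kmin; rewrite ltnn.
have gu : good u := (goodX x1 l1 w k wA).2.
have uA : u *m (A - x1%:M) = 0 by rewrite -mulmxA -[_ ^+ k *m _]exprSr.
have uA2 : u *m (A - x2%:M) = (x1 - x2) *: u.
  rewrite (_ : A - x2%:M = (A - x1%:M) + (x1 - x2)%:M); last first.
    by rewrite raddfB /= addrA subrK.
  by rewrite mulmxDr uA add0r mul_mx_scalar.
have uX j : u *m (A - x2%:M) ^+ j = (x1 - x2) ^+ j *: u.
  elim: j => [|j IH]; first by rewrite mulmx1 scale1r.
  by rewrite expmxS mulmxA uA2 -scalemxAl IH scalerA -exprS.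
have /eqP := (goodX x2 l2 u N2 gu).1.
rewrite nil2 mulmx0 uX eq_sym scaler_eq0 (negPf u0) orbF.
by rewrite expf_eq0 subr_eq0 (negPf x12) andbF.
Qed.

End CyclicCriterion.
End PolyEval.

(** * Rank one perturbations *)

Section RankOneEigenvalues.
Variables (F : localFieldType) (O : set F) (pi : F).
Hypothesis OP : integer_ring O pi.
Local Notation mxb := (mxball O pi).

Lemma pi_exp_inj a : pi ^+ a != pi ^+ a.+1.
Proof.
have pi0 := int_pi_neq0 OP; apply/eqP => e.
have p1 : pi = 1 by apply: (mulfI (expf_neq0 a pi0)); rewrite mulr1 -exprSr.
have /eqP : (1 : F) = 0.
  apply: (fball_eq0 OP) => r; rewrite /fball /= p1 expr1n invr1 mulr1.
  exact: int_one OP.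
by rewrite oner_eq0.
Qed.

Lemma mxball_scale m n (M : 'M[F]_(m, n)) b t a : mxb 0 (pi ^+ b *: M) ->
  (b + t <= a)%N -> mxb t (pi ^+ a *: M).
Proof.
move=> bM bta; have ba : (b <= a)%N := leq_trans (leq_addr _ _) bta.
rewrite -(subnK ba) exprD -scalerA -[t]addn0; apply: (mxballZ OP) => //.
apply: (fball_le OP (s := a - b)); first by rewrite leq_subRL.
rewrite -[X in fball _ _ X]addn0 -[X in fball _ _ _ X]mulr1; apply/(fball_pi OP).
by rewrite fball0E; exact: int_one OP.
Qed.

(* The resolvent [phi (1 - s A)^-1 v] is asymptotic to [s ^+ k <A^k v, phi>]
   for the first nonzero moment, hence nonzero for small [s]. *)
Lemma rank_one_eigenvalue n (A : 'M[F]_n) (v : 'cV[F]_n) (phi : 'rV[F]_n) k :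
  pairing (A ^+ k *m v) phi != 0 ->
  exists a0, forall a, (a0 <= a)%N -> exists l (w : 'cV[F]_n),
    w != 0 /\ (A + l *: (v *m phi)) *m w = (pi ^- a) *: w.
Proof.
move=> nz.
have ex : exists k, pairing (A ^+ k *m v) phi != 0 by exists k.
case: (ex_minnP ex) => {nz} k' nz kmin.
have mE i : pairing (A ^+ i *m v) phi = (phi *m A ^+ i *m v) ord0 ord0.
  by rewrite /pairing mulmxA.
pose mu := pairing (A ^+ k' *m v) phi.
have [r Hr] : exists r, ~ fball O pi r mu.
  apply: contrapT => nr; move/eqP: nz; apply; apply: (fball_eq0 OP) => r.
  by apply: contrapT => nb; apply: nr; exists r.
have [b Hb] := mxball_bound OP A.
have [c Hc] := mxball_bound OP (phi *m A ^+ k'.+1).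
have [d Hd] := mxball_bound OP v.
(* b makes s A divisible by pi; c, d and r push the error term s phi A^(k'+1) P v into pi^r O, which
   does not contain [mu]. *)
exists (b + c + d + r).+1 => a a0.
pose s := pi ^+ a; have s0 : s != 0 by rewrite expf_neq0 ?(int_pi_neq0 OP).
have sA : mxb 1 (s *: A).
  apply: mxball_scale Hb _; apply: leq_trans a0; rewrite addn1 ltnS -!addnA.
  exact: leq_addr.
have [Mu Pb] : (1%:M - s *: A) \in unitmx /\
    mxb 1 (invmx (1%:M - s *: A) - 1%:M).
  apply: (mxball_invmx OP) => //; rewrite addrAC subrr add0r.
  exact: (mxballN OP).
set P := invmx _ in Pb.
have P0 : mxb 0 P.
  rewrite -(subrK 1%:M P); apply: (mxballD OP); last exact: (mxball1 OP).
  exact: (mxball_le OP (leq0n 1)).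
have PE : P = 1%:M + s *: (A *m P).
  have := mulmxV Mu; rewrite -/P mulmxBl mul1mx -scalemxAl => /eqP.
  by rewrite subr_eq => /eqP.
have rec i : (phi *m A ^+ i *m P *m v) ord0 ord0 =
    pairing (A ^+ i *m v) phi + s * (phi *m A ^+ i.+1 *m P *m v) ord0 ord0.
  rewrite {1}PE mulmxDr mulmx1 mulmxDl mxE -mE; congr (_ + _).
  rewrite -scalemxAr -scalemxAl mxE; congr (_ * _).
  by rewrite exprSr -[A ^+ i * A]/(_ *m _) !mulmxA.
have low i : (i <= k')%N -> (phi *m P *m v) ord0 ord0 =
    s ^+ i * (phi *m A ^+ i *m P *m v) ord0 ord0.
  elim: i => [|i IH] ik; first by rewrite mul1r mulmx1.
  rewrite (IH (ltnW ik)) (rec i) [X in X + _](_ : _ = 0); last first.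
    by apply/eqP; apply: contraT => /kmin; rewrite leqNgt ik.
  by rewrite add0r mulrA -exprSr.
have nz' : (phi *m P *m v) ord0 ord0 != 0.
  rewrite (low k')//; apply: mulf_neq0; first exact: expf_neq0.
  rewrite (rec k'); apply/eqP => e0; apply: Hr.
  have -> : mu = - (s * (phi *m A ^+ k'.+1 *m P *m v) ord0 ord0).
    by apply/eqP; rewrite -addr_eq0; apply/eqP.
  apply: (fballN OP).
  have -> : s * (phi *m A ^+ k'.+1 *m P *m v) ord0 ord0 =
      ((pi ^+ (a - d) *: (phi *m A ^+ k'.+1)) *m P *m (pi ^+ d *: v)) ord0 ord0.
    rewrite -scalemxAr -!scalemxAl scalerA [RHS]mxE -exprD addnC subnK//.
    apply: leq_trans (ltnW a0).
    by rewrite -addnA addnCA; exact: leq_addr.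
  apply: (mxballMr OP) => //; apply: (mxballMr OP) => //.
  apply: mxball_scale Hc _; rewrite leq_subRL; last first.
    apply: leq_trans (ltnW a0).
    by rewrite -addnA addnCA; exact: leq_addr.
  apply: leq_trans (ltnW a0); rewrite addnA (addnC d) -!addnA.
  exact: leq_addl.
have yE := mx11_scalar (phi *m P *m v).
(* A P v = s^-1 (P v - v), and l is the scalar for which the rank one term restores the missing s^-1
   v. *)
exists (s^-1 / (phi *m P *m v) ord0 ord0), (P *m v); split.
  by apply: contraNneq nz' => Pv0; rewrite -mulmxA Pv0 mulmx0 mxE.
have AP : A *m (P *m v) = s^-1 *: (P *m v - v).
  rewrite mulmxA; apply: (scalerI s0); rewrite scalerA mulfV// scale1r scalemxAl.
  by rewrite {2}PE mulmxDl mul1mx addrAC subrr add0r.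
move: ((phi *m P *m v) ord0 ord0) nz' yE => y y0 yE.
rewrite mulmxDl AP -scalemxAl -(mulmxA v phi) (mulmxA phi P v).
rewrite yE mul_mx_scalar scalerA mulfVK//.
by rewrite -scalerDr subrK.
Qed.

End RankOneEigenvalues.

(** * Generators of the general linear group *)

Section Generation.
Variables (F : localFieldType) (O : set F) (pi : F).
Hypothesis OP : integer_ring O pi.
Local Notation mxb := (mxball O pi).

Lemma fball_det n (M : 'M[F]_n) : mxb 0 M -> fball O pi 0 (\det M).
Proof.
move=> M0; have b1 : fball O pi 0 1 by rewrite fball0E; exact: int_one OP.
apply: (fball_sum OP) => s _; rewrite -[0%N]addn0; apply: (fballM OP).
  by case: (odd_perm _); rewrite ?expr1 ?expr0 //; exact: (fballN OP).
elim/big_ind: _ => // x y hx hy; rewrite -[0%N]addn0; exact: (fballM OP).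
Qed.

(** With determinant 1 the inverse is the adjugate, whose entries are integral. *)
Lemma KO0_det n (g : GLinear F n) : mxb 0 (Defs.GLval g) -> \det g = 1 ->
  KO O pi 0 g.
Proof.
move=> g0 d1; apply: (KO0P OP) => //.
have -> : invmx g = \adj g by rewrite /invmx Defs.GLvalP d1 invr1 scale1r.
move=> i j; rewrite mxE /cofactor -[0%N]addn0; apply: (fballM OP); last first.
  by apply: fball_det => k l; rewrite !mxE.
rewrite -signr_odd; case: (odd _); rewrite ?expr1 ?expr0.
  by apply: (fballN OP); rewrite fball0E; exact: int_one OP.
by rewrite fball0E; exact: int_one OP.
Qed.

Variable n : nat.
Variable P : set (GLinear F n).
Hypotheses (PK : KO O pi 0 `<=` P) (PM : forall g h, P g -> P h -> P (g * h)%g).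
Hypothesis Pdiag : forall g, is_diag_mx (Defs.GLval g) -> P g.

Lemma diag_unit (d : 'I_n -> F) : (forall i, d i != 0) ->
  diag_mx (\row_i d i) \in unitmx.
Proof.
move=> d0; rewrite unitmxE det_diag unitfE; apply/prodf_neq0 => i _.
by rewrite mxE.
Qed.

(* Conjugation by a diagonal matrix of powers of [pi] makes a unitriangular
   matrix integral. *)
Lemma unitriangular_gen (g : GLinear F n) (f : 'I_n -> nat) : \det (g : 'M_n) = 1 ->
  (forall i, (g : 'M_n) i i = 1) ->
  (forall i j, i != j -> (g : 'M_n) i j != 0 -> (f j < f i)%N) -> P g.
Proof.
move=> detg gd gf; have [a Ha] := mxball_bound OP (Defs.GLval g).
have pi0 := int_pi_neq0 OP.
pose d i := pi ^+ (a * f i); have d0 i : d i != 0 by rewrite expf_neq0.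
have dV0 i : (d i)^-1 != 0 by rewrite invr_eq0.
pose D := GLin (diag_unit d0); pose D' := GLin (diag_unit dV0).
have DD' : (D' * D = 1)%g.
  apply/val_inj => /=; apply/matrixP => i j; rewrite mul_diag_mx !mxE.
  by case: eqP => [->|_]; rewrite ?mulr0n ?mulr0 // !mulr1n mulVf.
have -> : g = (D' * (D * g * D') * D)%g.
  have D'E : D' = D^-1%g by rewrite -[RHS]mul1g -DD' mulgK.
  by rewrite D'E !mulgA mulVg mul1g mulgVK.
have Dd : is_diag_mx (Defs.GLval D) by exact: diag_mx_is_diag.
have D'd : is_diag_mx (Defs.GLval D') by exact: diag_mx_is_diag.
apply: PM; last exact: Pdiag; apply: PM; first exact: Pdiag.
apply/PK/KO0_det; last first.
  rewrite !GLmulE !det_mulmx detg mulr1 mulrC -det_mulmx.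
  by have /(congr1 (@Defs.GLval F n)) := DD'; rewrite GLmulE => ->; rewrite det1.
move=> i j; rewrite !GLmulE mul_mx_diag mxE mul_diag_mx !mxE.
have [->|ij] := eqVneq i j; first by rewrite gd mulr1 mulfV // fball0E; exact: int_one OP.
have [->|nz] := eqVneq ((g : 'M_n) i j) 0.
  by rewrite mulr0 mul0r; exact: (fball_zero OP).
have fij := gf i j ij nz.
rewrite mulrAC /d -(subnK (ltnW fij)) mulnDr exprD mulfK ?expf_neq0//.
rewrite (_ : (a * (f i - f j) = a * (f i - f j).-1 + a)%N); last first.
  by rewrite -[in LHS](prednK (n := f i - f j)) ?subn_gt0// mulnS addnC.
rewrite exprD -mulrA -[0%N]addn0; apply: (fballM OP).
  by rewrite fball0E; exact: (O_pi OP).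
by have := Ha i j; rewrite mxE.
Qed.

Lemma unitmx_diag_neq0 (M : 'M[F]_n) : M \in unitmx -> is_trig_mx M ->
  forall i, M i i != 0.
Proof.
move=> Mu Mt; move: Mu; rewrite unitmxE det_trig// unitfE => /prodf_neq0 h i.
exact: h.
Qed.

End Generation.

(** An LUP decomposition: permutation matrices lie in [KO 0], and both unitriangular factors fall
    under [unitriangular_gen]. It serves to show that a character is trivial by testing it on [KO 0]
    and on diagonal matrices. *)
Lemma GL_generated (F : localFieldType) (O : set F) (pi : F) (n : nat)
    (P : set (GLinear F n)) : integer_ring O pi ->
  KO O pi 0 `<=` P -> (forall g h, P g -> P h -> P (g * h)%g) ->
  (forall g, is_diag_mx (Defs.GLval g) -> P g) -> forall g, P g.
Proof.
case: n P => [|n] P OP PK PM Pd g.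
  by apply/PK/(KO0P OP); rewrite flatmx0; exact: (mxball0 OP).
have := cormen_lup_correct (Defs.GLval g).
have := cormen_lup_perm (Defs.GLval g).
have := cormen_lup_detL (Defs.GLval g).
have := @cormen_lup_lower _ _ (Defs.GLval g).
have := @cormen_lup_upper _ _ (Defs.GLval g).
case: cormen_lup => -[Q L] U /= Uu Ll Ld /is_perm_mxP[s Qs] QA.
have O0 : O 0 by rewrite -(fball0E O pi); exact: (fball_zero OP).
have Lu : L \in unitmx by rewrite unitmxE Ld unitr1.
have Qu : Q \in unitmx by rewrite Qs unitmx_perm.
have Uun : U \in unitmx.
  have : L *m U \in unitmx by rewrite -[L *m U]QA unitmx_mul Qu Defs.GLvalP.
  by rewrite unitmx_mul => /andP[].
pose d i := U i i.
have d0 i : d i != 0.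
  have := @unitmx_diag_neq0 F n.+1 U^T; rewrite unitmx_tr => /(_ Uun) h.
  have := h _ i; rewrite mxE; apply; apply/is_trig_mxP => k l kl.
  by rewrite mxE Uu.
pose D := GLin (diag_unit d0).
pose U1 := (D^-1 * GLin Uun)%g.
have dV0 i : (d i)^-1 != 0 by rewrite invr_eq0.
have DVE : D^-1%g = GLin (diag_unit dV0).
  apply/(mulgI D); rewrite mulgV; apply/val_inj => /=.
  apply/matrixP => i j; rewrite mul_diag_mx !mxE.
  by case: eqP => [->|_]; rewrite ?mulr0n ?mulr0 // !mulr1n mulfV.
have U1E i j : (U1 : 'M_ _) i j = (d i)^-1 * U i j.
  by rewrite /U1 DVE GLmulE mul_diag_mx !mxE.
have -> : g = ((GLin Qu)^-1 * (GLin Lu * (D * U1)))%g.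
  apply/(mulgI (GLin Qu)); rewrite mulVKg /U1 mulVKg; apply/val_inj.
  exact: QA.
apply: (PM).
  apply/PK/(KOV)/(KO0P OP) => /=.
    by rewrite Qs => i j; rewrite !mxE fball0E; case: eqP => _;
      [exact: int_one OP | exact: O0].
  have -> : invmx Q = perm_mx s^-1%g.
    apply: (can_inj (mulKmx Qu)).
    by rewrite mulmxV// Qs -perm_mxM mulgV perm_mx1.
  by move=> i j; rewrite !mxE fball0E; case: eqP => _;
      [exact: int_one OP | exact: O0].
apply: (PM).
  apply: (unitriangular_gen OP PK PM Pd (f := fun i => i)) => //=.
    by move=> i; rewrite Ll // eqxx.
  move=> i j ij; apply: contraNltn => ji; first by rewrite Ll // (negPf ij).
apply: (PM); first exact/Pd/diag_mx_is_diag.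
(* Reversing the indices turns the upper triangular shape into the one required. *)
apply: (unitriangular_gen OP PK PM Pd (f := fun i => (n - i)%N)).
- rewrite /U1 GLmulE det_mulmx DVE /= det_diag -det_tr det_trig; last first.
    by apply/is_trig_mxP => k l kl; rewrite mxE Uu.
  by rewrite -big_split /= big1 // => i _; rewrite !mxE mulVf.
- by move=> i; rewrite U1E mulVf.
- move=> i j ij; rewrite U1E; apply: contraNltn => nij.
  have [ij'|ji|e] := ltngtP i j; last by rewrite (ord_inj e) eqxx in ij.
    move: nij; rewrite leqNgt ltn_sub2l //; exact: leq_trans ij' (leq_ord j).
  by rewrite Uu ?mulr0.
Qed.

(** * Topologically nilpotent matrices *)

Lemma char_poly_conj (F : fieldType) n (A g : 'M[F]_n) : g \in unitmx ->
  char_poly (g *m A *m invmx g) = char_poly A.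
Proof.
move=> gu; rewrite /char_poly.
have -> : char_poly_mx (g *m A *m invmx g) =
    map_mx polyC g *m char_poly_mx A *m map_mx polyC (invmx g).
  rewrite /char_poly_mx mulmxBr mulmxBl -!map_mxM; congr (_ - _).
  by rewrite mul_mx_scalar -scalemxAl -map_mxM mulmxV// map_scalar_mx /= scalemx1.
rewrite !det_mulmx mulrAC -det_mulmx -map_mxM mulmxV//.
by rewrite map_scalar_mx /= det1 mul1r.
Qed.

Lemma char_poly_tr (F : fieldType) n (A : 'M[F]_n) : char_poly A^T = char_poly A.
Proof.
rewrite /char_poly -[RHS]det_tr; congr (\det _).
by rewrite /char_poly_mx linearB /= tr_scalar_mx map_trmx.
Qed.

Section ContinuousCharPoly.
Variables (K : topologicalFieldType) (T : topologicalType).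

Definition coef_continuous (f : T -> {poly K}) := forall i, continuous (fun t => (f t)`_i).

Lemma continuous_mulf (f g : T -> K) : continuous f -> continuous g ->
  continuous (fun t => f t * g t).
Proof. by move=> fc gc t; apply: cvg_mulf; [exact: fc | exact: gc]. Qed.

Lemma continuous_sumf (I : Type) (s : seq I) (P : pred I) (f : I -> T -> K) :
  (forall i, continuous (f i)) -> continuous (fun t => \sum_(i <- s | P i) f i t).
Proof.
move=> fc; apply: (continuous_big (@add_continuous K)) => i _; exact: fc.
Qed.

Lemma coef_continuousM f g : coef_continuous f -> coef_continuous g ->
  coef_continuous (fun t => f t * g t).
Proof.
move=> fc gc i; rewrite (_ : (fun t => _) =
    fun t => \sum_(j < i.+1) (f t)`_j * (g t)`_(i - j)).
  by apply: continuous_sumf => j; exact: continuous_mulf.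
by apply/funext => t; rewrite coefM.
Qed.

Lemma coef_continuousC (c : {poly K}) : coef_continuous (fun=> c).
Proof. by move=> i; exact: continuous_const. Qed.

Lemma coef_continuous_prod (I : Type) (s : seq I) (f : I -> T -> {poly K}) :
  (forall i, coef_continuous (f i)) ->
  coef_continuous (fun t => \prod_(i <- s) f i t).
Proof.
move=> fc; elim: s => [|i s IH].
  rewrite (_ : (fun t => _) = fun=> 1); first exact: coef_continuousC.
  by apply/funext => t; rewrite big_nil.
rewrite (_ : (fun t => _) = fun t => f i t * \prod_(i <- s) f i t).
  exact: coef_continuousM.
by apply/funext => t; rewrite big_cons.
Qed.

Lemma char_poly_coef_continuous n (f : T -> 'M[K]_n) : continuous f ->
  coef_continuous (fun t => char_poly (f t)).
Proof.
move=> fc i; rewrite (_ : (fun t => _) = fun t => \sum_(s : 'S_n)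
   ((-1) ^+ s * \prod_j char_poly_mx (f t) j (s j))`_i); last first.
  by apply/funext => t; rewrite -coef_sum.
apply: continuous_sumf => s; apply: coef_continuousM; first exact: coef_continuousC.
apply: coef_continuous_prod => j k.
  rewrite (_ : (fun t => _) = fun t => ('X *+ (j == s j))`_k -
      f t j (s j) * (k == 0%N)%:R); last first.
    apply/funext => t; rewrite !mxE coefB coefC; congr (_ - _).
    by case: eqP; rewrite ?mulr1 ?mulr0.
  move=> t; apply: (@cvg_addf K _ (nbhs t) (fun=> _)); first exact: cvg_cst.
  apply: (@cvg_comp _ _ _ _ -%R); last exact: opp_continuous.
  apply: (@cvg_mulf K _ (nbhs t) _ (fun=> _)); last exact: cvg_cst.
  exact: (continuous_coord fc).
Qed.

Lemma continuous_peval n p (f : T -> 'M[K]_n) : continuous f ->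
  continuous (fun t => peval p (f t)).
Proof.
move=> fc; apply: continuous_mx => i j.
rewrite (_ : (fun t => _) = fun t => \sum_(k < size p) p`_k * (f t ^+ k) i j).
  apply: continuous_sumf => k; apply: continuous_mulf; first exact: continuous_const.
  exact/continuous_coord/continuous_exp.
by apply/funext => t; rewrite summxE; apply: eq_bigr => k _; rewrite mxE.
Qed.

Lemma continuous_submx n (c : 'M[K]_n) (f : T -> 'M[K]_n) : continuous f ->
  continuous (fun t => f t - c).
Proof.
move=> fc; apply: continuous_mx => i j.
rewrite (_ : (fun t => _) = fun t => f t i j + (- c i j)); last first.
  by apply/funext => t; rewrite !mxE.
move=> t; apply: (@cvg_addf K _ (nbhs t) _ (fun=> _)); last exact: cvg_cst.
exact: continuous_coord.
Qed.

End ContinuousCharPoly.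

Section Descent.
Variables (F : localFieldType) (O : set F) (pi : F).
Hypothesis char2 : 2%N \in [pchar F].
Hypothesis OP : integer_ring O pi.
Local Notation mxb := (mxball O pi).

Lemma mx_addxx m n (M : 'M[F]_(m, n)) : M + M = 0.
Proof. by apply/matrixP => i j; rewrite !mxE F_addxx. Qed.

Lemma exp2n_add1 n (M : 'M[F]_n) k : (1%:M + M) ^+ (2 ^ k) = 1%:M + M ^+ (2 ^ k).
Proof.
elim: k => [|k IH]; first by rewrite !expr1.
rewrite expnSr !exprM IH !expr2 -![_ * _]/(_ *m _).
by rewrite mulmxDl mul1mx mulmxDr mulmx1 addrA -[1%:M + _ + _]addrA mx_addxx addr0.
Qed.

(* Forces [M] to be topologically nilpotent by Cayley-Hamilton, and is visibly
   open and closed. *)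
Definition cpball n (M : 'M[F]_n) := forall i, (i < n)%N -> fball O pi 1 (char_poly M)`_i.

Definition top_nilp n (M : 'M[F]_n) :=
  forall s, exists k0, forall k, (k0 <= k)%N -> mxb s (M ^+ k).

(** The lower coefficients of the characteristic polynomial are divisible by pi, so a bound on n+1
    consecutive powers improves by a factor pi at the next power. The common denominator pi^a of the
    first n+1 powers is carried along. *)
Lemma cpball_top_nilp n (M : 'M[F]_n) : cpball M -> top_nilp M.
Proof.
case: n M => [|n] M cM s.
  by exists 0%N => k _; rewrite flatmx0; exact: (mxball0 OP).
have CH : M ^+ n.+1 = - \sum_(i < n.+1) (char_poly M)`_i *: M ^+ i.
  have := Cayley_Hamilton M; rewrite horner_mxE /peval size_char_poly big_ord_recr /=.
  have := char_poly_monic M; rewrite monicE /lead_coef size_char_poly /= => /eqP ->.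
  by rewrite scale1r addrC => /eqP; rewrite addr_eq0 => /eqP.
have CHk k : M ^+ (k + n.+1) = - \sum_(i < n.+1) (char_poly M)`_i *: M ^+ (k + i).
  rewrite exprD CH mulrN mulr_sumr; congr (- _); apply: eq_bigr => i _.
  by rewrite -scalerAr -exprD.
have /choice[b Hb] : forall i : 'I_n.+1, exists a, mxb 0 (pi ^+ a *: M ^+ i).
  by move=> i; exact: (mxball_bound OP).
pose a := (\sum_i b i)%N.
have Ha (i : 'I_n.+1) : mxb 0 (pi ^+ a *: M ^+ i).
  by apply: (mxball_scale OP (Hb i)); rewrite addn0 /a (bigD1 i)//= leq_addr.
have step t k : (forall i : 'I_n.+1, mxb t (pi ^+ a *: M ^+ (k + i))) ->
    mxb t.+1 (pi ^+ a *: M ^+ (k + n.+1)).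
  move=> ht; rewrite CHk scalerN scaler_sumr; apply/(mxballN OP)/(mxball_sum OP) => i _.
  rewrite scalerA mulrC -scalerA -add1n; apply: (mxballZ OP) => //.
  exact: cM.
have all0 k : mxb 0 (pi ^+ a *: M ^+ k).
  have [m] := ubnP k; elim: m k => // m IH k km.
  have [kn|nk] := ltnP k n.+1; first exact: (Ha (Ordinal kn)).
  rewrite -(subnK nk); apply: (mxball_le OP (leqnSn 0)); apply: step => i.
  apply: IH; rewrite -ltnS; apply: leq_trans km.
  by rewrite ltnS -[X in (_ < X)%N](subnK nk) ltn_add2l; exact: ltn_ord.
have allt t : forall k, (t * n.+1 <= k)%N -> mxb t (pi ^+ a *: M ^+ k).
  elim: t => [|t IH] k; first by move=> _; exact: all0.
  rewrite mulSn => tk; rewrite -(subnK (leq_trans (leq_addr _ _) tk)).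
  apply: step => i; apply: IH; apply: leq_trans (leq_addr _ _).
  by rewrite leq_subRL // (leq_trans (leq_addr _ _) tk).
exists ((a + s) * n.+1)%N => k ak; apply/(mxball_pi OP a); exact: allt.
Qed.

(* In characteristic 2, [Q ^+ (2 ^ k) = 1 + (Q - 1) ^+ (2 ^ k)] tends to 1
   while [P ^+ (2 ^ k)] tends to 0. *)
Lemma top_nilp_intertwine m n (X : 'M[F]_(m, n)) (P : 'M[F]_n) (Q : 'M[F]_m) :
  X *m P = Q *m X -> top_nilp P -> top_nilp (Q - 1%:M) -> X = 0.
Proof.
move=> XP nP nQ.
have XPk k : X *m P ^+ k = Q ^+ k *m X.
  elim: k => [|k IH]; first by rewrite mulmx1 mul1mx.
  by rewrite expmxS mulmxA XP -mulmxA IH mulmxA -expmxS.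
have [a Ha] := mxball_bound OP X.
have : pi ^+ a *: X = 0.
  apply: (mxball_eq0 OP) => s.
  have [k1 H1] := nP s; have [k2 H2] := nQ s.
  pose k := maxn k1 k2.
  have k1k : (k1 <= 2 ^ k)%N.
    exact: leq_trans (leq_maxl k1 k2) (ltnW (ltn_expl _ _)).
  have k2k : (k2 <= 2 ^ k)%N.
    exact: leq_trans (leq_maxr k1 k2) (ltnW (ltn_expl _ _)).
  have E : X = X *m P ^+ (2 ^ k) - (Q - 1%:M) ^+ (2 ^ k) *m X.
    rewrite XPk -{1}(subrKC 1%:M Q) exp2n_add1 mulmxDl mul1mx addrK //.
  rewrite E scalerBr scalemxAl scalemxAr; apply: (mxballB OP).
    by apply: (mxballMl OP) => //; exact: H1.
  by apply: (mxballMr OP) => //; exact: H2.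
by move=> /eqP; rewrite scaler_eq0 expf_eq0 (negPf (int_pi_neq0 OP)) andbF => /eqP.
Qed.

End Descent.

(** * Descent to block diagonal matrices *)

Section BlockEmbedding.
Variables (F : fieldType) (n1 n2 : nat).
Local Notation X12 := (triple F n1 * triple F n2)%type.
Implicit Types (y : X12) (x : triple F (n1 + n2)).

Definition emb y : triple F (n1 + n2) :=
  (block_mx y.1.1.1 0 0 y.2.1.1, col_mx y.1.1.2 y.2.1.2, row_mx y.1.2 y.2.2).

Definition unemb x : X12 :=
  ((ulsubmx x.1.1, usubmx x.1.2, lsubmx x.2), (drsubmx x.1.1, dsubmx x.1.2, rsubmx x.2)).

Lemma embK : cancel emb unemb.
Proof.
move=> [[[A1 v1] f1] [[A2 v2] f2]]; rewrite /emb /unemb /=.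
by rewrite block_mxKul block_mxKdr col_mxKu col_mxKd row_mxKl row_mxKr.
Qed.

Lemma unembK x : ursubmx x.1.1 = 0 -> dlsubmx x.1.1 = 0 -> emb (unemb x) = x.
Proof.
case: x => [[A v] f] /= A12 A21; rewrite /emb /unemb /=.
by rewrite -[in LHS]A12 -[in X in block_mx _ _ X _]A21 submxK vsubmxK hsubmxK.
Qed.

Lemma block_diag_mul (A A' : 'M[F]_n1) (B B' : 'M[F]_n2) :
  block_mx A 0 0 B *m block_mx A' 0 0 B' = block_mx (A *m A') 0 0 (B *m B').
Proof. by rewrite mulmx_block !mulmx0 !mul0mx !addr0 add0r. Qed.

Lemma blk_subproof (h1 : GLinear F n1) (h2 : GLinear F n2) :
  block_mx (h1 : 'M[F]_n1) 0 0 (h2 : 'M[F]_n2) \in unitmx.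
Proof.
have h : block_mx (h1 : 'M[F]_n1) 0 0 (h2 : 'M[F]_n2) *m
    block_mx (invmx h1) 0 0 (invmx h2) = 1%:M.
  by rewrite block_diag_mul !mulmxV ?Defs.GLvalP // -scalar_mx_block.
by have [] := mulmx1_unit h.
Qed.

Definition blk h1 h2 : GLinear F (n1 + n2) := GLin (blk_subproof h1 h2).

Lemma blkM h1 h2 k1 k2 : (blk h1 h2 * blk k1 k2 = blk (h1 * k1) (h2 * k2))%g.
Proof. by apply/val_inj; exact: block_diag_mul. Qed.

Lemma blk1 : blk 1%g 1%g = 1%g.
Proof. by apply/val_inj; rewrite /= -scalar_mx_block. Qed.

Lemma blkV h1 h2 : ((blk h1 h2)^-1 = blk h1^-1 h2^-1)%g.
Proof. by apply/(mulgI (blk h1 h2)); rewrite mulgV blkM !mulgV blk1. Qed.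

Lemma blkVE (h1 : GLinear F n1) (h2 : GLinear F n2) :
  invmx (block_mx (h1 : 'M[F]_n1) 0 0 (h2 : 'M[F]_n2)) =
  block_mx (invmx h1) 0 0 (invmx h2).
Proof. by have := congr1 (@Defs.GLval _ _) (blkV h1 h2). Qed.

Definition act2 (h1 : GLinear F n1) (h2 : GLinear F n2) y : X12 :=
  (act (GLt h1 false) y.1, act (GLt h2 false) y.2).

Definition tau n : GLtilde F n := GLt 1%g true.

Definition tau2 y : X12 := (act (tau n1) y.1, act (tau n2) y.2).

Lemma emb_act2 h1 h2 y : emb (act2 h1 h2 y) = act (GLt (blk h1 h2) false) (emb y).
Proof.
case: y => [[[A1 v1] f1] [[A2 v2] f2]]; rewrite /emb /act /=.
rewrite blkVE !block_diag_mul mul_block_col mul_row_block.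
by rewrite !mul0mx !mulmx0 !addr0 !add0r.
Qed.

Lemma emb_tau2 y : emb (tau2 y) = act (tau (n1 + n2)) (emb y).
Proof.
case: y => [[[A1 v1] f1] [[A2 v2] f2]]; rewrite /emb /act /=.
rewrite !invmx1 !mulmx1 !mul1mx tr_block_mx tr_row_mx tr_col_mx.
by rewrite !trmx0.
Qed.

Lemma GLtE (m : nat) (h : GLtilde F m) :
  h = (GLt (GLt_lin h) false * (if GLt_sign h then tau m else 1))%g.
Proof. by case: h => g [] /=; rewrite ?mulg1 // /tau GLtM /= mulg1. Qed.

Lemma tau_mul (m : nat) (g : GLinear F m) :
  (tau m * GLt g false = GLt (GLtrV g) false * tau m)%g.
Proof. by rewrite /tau !GLtM /= mul1g mulg1. Qed.

Lemma tau_tau (m : nat) : (tau m * tau m = 1)%g.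
Proof. by rewrite /tau GLtM /= mul1g; congr GLt; exact: (@sign_act1 F m true). Qed.

Lemma GLtrV_blk h1 h2 : GLtrV (blk h1 h2) = blk (GLtrV h1) (GLtrV h2).
Proof.
apply/val_inj => /=; rewrite tr_block_mx !trmx0.
have hu m (h : GLinear F m) : ((h : 'M[F]_m)^T \in unitmx) by rewrite unitmx_tr Defs.GLvalP.
exact: (blkVE (GLin (hu _ h1)) (GLin (hu _ h2))).
Qed.

End BlockEmbedding.

(** * The slice in the block diagonal triples and its transporter *)

Section Slice.
Variables (F : localFieldType) (O : set F) (pi : F).
Hypothesis char2 : 2%N \in [pchar F].
Hypothesis OP : integer_ring O pi.
Variables (n1 n2 : nat) (p : {poly F}).
Local Notation mxb := (mxball O pi).
Local Notation X12 := (triple F n1 * triple F n2)%type.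
Local Notation KO := (KO O pi).
Implicit Types (y : X12) (x : triple F (n1 + n2)).

Lemma KO_blk r h1 h2 : KO r h1 -> KO r h2 -> KO r (@blk F n1 n2 h1 h2).
Proof.
have aux m m' (M : 'M[F]_m) (N : 'M[F]_m') : mxb r (M - 1%:M) -> mxb r (N - 1%:M) ->
    mxb r (block_mx M 0 0 N - 1%:M).
  move=> hM hN; rewrite [X in _ - X]scalar_mx_block opp_block_mx add_block_mx.
  by rewrite !oppr0 !addr0; apply: mxball_block => //; exact: (mxball0 OP).
move=> [a1 a2] [b1 b2]; split; first exact: aux.
by rewrite blkVE; exact: aux.
Qed.

Lemma KO_blkP r h1 h2 : KO r (@blk F n1 n2 h1 h2) -> KO r h1 /\ KO r h2.
Proof.
have aux m m' (M : 'M[F]_m) (N : 'M[F]_m') : mxb r (block_mx M 0 0 N - 1%:M) ->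
    mxb r (M - 1%:M) /\ mxb r (N - 1%:M).
  rewrite [X in _ - X]scalar_mx_block opp_block_mx add_block_mx => h; split=> i j.
    by have := h (lshift _ i) (lshift _ j); rewrite block_mxEul.
  by have := h (rshift _ i) (rshift _ j); rewrite block_mxEdr.
move=> [/aux[a1 b1]]; rewrite blkVE => /aux[a2 b2]; by split; split.
Qed.

(* [peval p] is close to 1 on the first block and to 0 on the second one. *)
Definition slice : set X12 := [set y |
  cpball O pi (peval p y.1.1.1 - 1%:M) /\ cpball O pi (peval p y.2.1.1)].

Lemma cpball_preimage (T : topologicalType) m (f : T -> 'M[F]_m) : continuous f ->
  open [set t | cpball O pi (f t)] /\ closed [set t | cpball O pi (f t)].
Proof.
move=> fc; have cc := char_poly_coef_continuous fc.
have B : ball_structure (fun r (u w : F) => fball O pi r (w - u)).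
  split.
  - by move=> r z; rewrite subrr; exact: (fball_zero OP).
  - by move=> r z w h; rewrite -opprB; exact: (fballN OP).
  - by move=> r z w u h1 h2; rewrite -(subrK w u) -addrA; exact: (fballD OP).
  - by move=> r s z w rs; exact: (fball_le OP).
  - by move=> z U; exact: (nbhs_fballP OP).
  - move=> z w h; apply/eqP; rewrite eq_sym -subr_eq0; apply/eqP.
    exact: (fball_eq0 OP).
have oc : open (fball O pi 1) /\ closed (fball O pi 1).
  have h (u w : F) : fball O pi 1 (w - u) -> fball O pi 1 u -> fball O pi 1 w.
    by move=> h1 h2; rewrite -(subrK u w); exact: (fballD OP).
  by split; [exact: (bs_open B h) | exact: (bs_closed B h)].
have E : [set t | cpball O pi (f t)] =
    \bigcap_(i in [set i | (i < m)%N]) [set t | fball O pi 1 (char_poly (f t))`_i].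
  by apply/seteqP; split.
split; rewrite E.
  rewrite openE => t ht; rewrite /interior.
  have : \forall s \near t, forall i : 'I_m, fball O pi 1 (char_poly (f s))`_i.
    apply: filter_forall => i.
    apply: (cc i t); apply: open_nbhs_nbhs; split; [exact: oc.1|exact: (ht i (ltn_ord i))].
  by apply: filterS => s hs i im; exact: (hs (Ordinal im)).
apply: closed_bigI => i _.
rewrite -[X in closed X]/((fun t => (char_poly (f t))`_i) @^-1` fball O pi 1).
by apply: preimage_closed oc.2 => t _; exact: cc.
Qed.

Lemma slice_clopen : open slice /\ closed slice.
Proof.
have c1 : continuous (fun y : X12 => peval p y.1.1.1 - 1%:M).
  apply/continuous_submx/continuous_peval.
  exact/continuous_fst_comp/continuous_fst_comp/continuous_fst_comp/continuous_idfun.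
have c2 : continuous (fun y : X12 => peval p y.2.1.1).
  apply/continuous_peval.
  exact/continuous_fst_comp/continuous_fst_comp/continuous_snd_comp/continuous_idfun.
have [o1 k1] := cpball_preimage c1; have [o2 k2] := cpball_preimage c2.
by split; [exact: openI | exact: closedI].
Qed.

Lemma slice_act2 h1 h2 y : slice (act2 h1 h2 y) <-> slice y.
Proof.
have aux g1 g2 z : slice z -> slice (act2 g1 g2 z).
  case: z => [[[A1 v1] f1] [[A2 v2] f2]]; rewrite /slice /act2 /act /= => -[s1 s2].
  split; last by rewrite peval_conj ?Defs.GLvalP // /cpball char_poly_conj ?Defs.GLvalP.
  rewrite peval_conj ?Defs.GLvalP // (_ : _ - 1%:M =
     g1 *m (peval p A1 - 1%:M) *m invmx g1).
    by rewrite /cpball char_poly_conj ?Defs.GLvalP.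
  by rewrite mulmxBr mulmx1 mulmxBl mulmxV ?Defs.GLvalP.
split; last exact: aux.
move=> /(aux h1^-1%g h2^-1%g); congr slice.
by case: y => y1 y2; rewrite /act2 /= !act_inv.
Qed.

Lemma slice_tau2 y : slice (tau2 y) <-> slice y.
Proof.
have aux z : slice z -> slice (tau2 z).
  case: z => [[[A1 v1] f1] [[A2 v2] f2]]; rewrite /slice /tau2 /act /= => -[s1 s2].
  rewrite !invmx1 !mulmx1 !mul1mx -!peval_tr -[X in _ - X]trmx1 -linearB /=.
  by rewrite /cpball !char_poly_tr.
split; last exact: aux.
by move=> /aux; congr slice; case: y => y1 y2; rewrite /tau2 /= -!actM !tau_tau !act1.
Qed.

Lemma slice_top_nilp1 y : slice y -> top_nilp O pi (peval p y.1.1.1 - 1%:M).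
Proof. by move=> [h _]; exact: (cpball_top_nilp OP). Qed.

Lemma slice_top_nilp2 y : slice y -> top_nilp O pi (peval p y.2.1.1).
Proof. by move=> [_ h]; exact: (cpball_top_nilp OP). Qed.

(** The off-diagonal blocks of g intertwine values of p on opposite blocks, one topologically
    nilpotent and the other so after subtracting 1; [top_nilp_intertwine] kills them. *)
Lemma slice_transporter g y y' : slice y -> slice y' ->
  act (GLt g false) (emb y) = emb y' -> exists h1 h2, g = blk h1 h2 /\ y' = act2 h1 h2 y.
Proof.
move=> sy sy' gy.
pose A1 := peval p y.1.1.1; pose A2 := peval p y.2.1.1.
pose B1 := peval p y'.1.1.1; pose B2 := peval p y'.2.1.1.
have E : g *m block_mx A1 0 0 A2 = block_mx B1 0 0 B2 *m g.
  have := congr1 (fun x => peval p x.1.1) gy.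
  rewrite /= !peval_block peval_conj ?Defs.GLvalP // peval_block => <-.
  by rewrite mulmxKV ?Defs.GLvalP.
have [g11 [g12 [g21 [g22 gE]]]] : exists g11 g12 g21 g22,
    Defs.GLval g = block_mx g11 g12 g21 g22.
  have := submxK (Defs.GLval g).
  by exists (ulsubmx (Defs.GLval g)), (ursubmx (Defs.GLval g)),
    (dlsubmx (Defs.GLval g)), (drsubmx (Defs.GLval g)).
have {}E : g12 *m A2 = B1 *m g12 /\ g21 *m A1 = B2 *m g21.
  move: E; rewrite gE !mulmx_block !mulmx0 !mul0mx !addr0 !add0r => /eq_block_mx.
  by case.
have g12_0 : g12 = 0.
  apply: (top_nilp_intertwine char2 OP E.1); first exact: slice_top_nilp2.
  exact: slice_top_nilp1.
have g21_0 : g21 = 0.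
  (* For the other corner 0 and 1 are exchanged. Both matrices are shifted by 1, and B2 - 1 - 1 is
     B2 in characteristic 2. *)
  apply: (@top_nilp_intertwine _ _ _ char2 OP _ _ g21 (A1 - 1%:M) (B2 - 1%:M)).
  - by rewrite mulmxBr mulmxBl E.2 mulmx1 mul1mx.
  - exact: slice_top_nilp1.
  - rewrite -addrA -opprD mx_addxx// subr0; exact: slice_top_nilp2.
have gu := Defs.GLvalP g; rewrite gE g12_0 g21_0 unitmxE det_ublock unitrM in gu.
have /andP[u1 u2] := gu; rewrite -!unitmxE in u1 u2.
have gblk : g = blk (GLin u1) (GLin u2).
  by apply/val_inj; rewrite /= gE g12_0 g21_0.
exists (GLin u1), (GLin u2); split=> //.
by apply: (can_inj (@embK F n1 n2)); rewrite -gy emb_act2 gblk.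
Qed.

End Slice.

(** * Openness of the orbits through the slice *)

Section SliceOpenness.
Variables (F : localFieldType) (O : set F) (pi : F).
Hypothesis char2 : 2%N \in [pchar F].
Hypothesis OP : integer_ring O pi.
Variables (n1 n2 : nat) (p : {poly F}).
Local Notation mxb := (mxball O pi).
Local Notation X12 := (triple F n1 * triple F n2)%type.
Local Notation KO := (KO O pi).
Local Notation E0 := (block_mx 1%:M 0 0 0 : 'M[F]_(n1 + n2)).
Implicit Types (y : X12) (x : triple F (n1 + n2)).

Lemma mx_oppE (m n : nat) (M : 'M[F]_(m, n)) : - M = M.
Proof. by apply/eqP; rewrite -subr_eq0 -opprD mx_addxx // oppr0. Qed.

Lemma E0_idem : E0 *m E0 = E0.
Proof. by rewrite block_diag_mul mulmx1 mulmx0. Qed.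

Lemma E0_int : mxb 0 E0.
Proof.
by apply: mxball_block; [exact: (mxball1 OP) | exact: (mxball0 OP)..].
Qed.

Lemma sqr_near_idem s (M : 'M[F]_(n1 + n2)) : mxb s (M - E0) -> mxb s (M *m M - E0).
Proof.
move=> h; have hM : mxb 0 M.
  rewrite -(subrK E0 M); apply: (mxballD OP); last exact: E0_int.
  exact: (mxball_le OP (leq0n s)).
rewrite (_ : _ - E0 = M *m (M - E0) + (M - E0) *m E0).
  apply: (mxballD OP); first exact: (mxballMl OP).
  by apply: (mxballMr OP) => //; exact: E0_int.
by rewrite mulmxBr mulmxBl E0_idem addrA subrK.
Qed.

(* In characteristic 2 the successive differences of [M ^+ (2 ^ k)] are the
   powers [(M ^+ 2 - M) ^+ (2 ^ k)], so these powers accumulate only at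
   idempotents. *)
Lemma near_idempotent s (A M : 'M[F]_(n1 + n2)) : (0 < s)%N ->
  mxb s (M - E0) -> A *m M = M *m A ->
  exists e, [/\ e *m e = e, A *m e = e *m A & mxb s (e - E0)].
Proof.
move=> s0 hM AM.
pose u k := M ^+ (2 ^ k).
have uS k : u k.+1 = u k *m u k by rewrite /u expnSr exprM expr2.
have u_near k : mxb s (u k - E0).
  by elim: k => [|k IH]; [rewrite /u expr1 | rewrite uS; exact: sqr_near_idem].
have uA k : A *m u k = u k *m A.
  by elim: k => [|k IH]; [rewrite /u expr1 | rewrite uS mulmxA IH -mulmxA IH mulmxA].
have usub k : mxb k (u k *m u k - u k).
  have E : u k *m u k - u k = (M *m M - M) ^+ (2 ^ k).
    elim: k => [|k IH]; first by rewrite /u !expr1.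
    rewrite expnSr exprM -IH expr2 !uS -[RHS]/(_ *m _).
    rewrite mulmxBl !mulmxBr !mulmxA !mx_oppE.
    by rewrite addrA -[in RHS](addrA (u k *m u k *m u k *m u k)) mx_addxx // addr0.
  rewrite E; apply: (mxball_le OP (s := 2 ^ k * s)).
    by apply: leq_trans (ltnW (ltn_expl k (ltnSn 1))) _; rewrite leq_pmulr.
  apply: (mxballX OP); rewrite (_ : _ - M = (M *m M - E0) - (M - E0)).
    by apply: (mxballB OP) => //; exact: sqr_near_idem.
  by rewrite opprB addrA subrK.
have BM := ball_structure_mx OP (n1 + n2) (n1 + n2).
have [e [he cle]] : [set e | mxE_ball O pi s E0 e] `&` cluster (u @ \oo) !=set0.
  by apply: compact_mxE_ball OP _ _ _ _ _ _ _; exists 0%N => // k _; exact: u_near.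
exists e; split=> //; apply/eqP; rewrite -subr_eq0; apply/eqP.
- apply: (mxball_eq0 OP) => r.
  have cs : continuous (fun z : 'M[F]_(n1 + n2) => z *m z - z).
    apply: continuous_mx => i j.
    rewrite (_ : (fun t => _) = fun t : 'M[F]_(n1 + n2) => (t *m t) i j - t i j).
      move=> t; apply: (@cvg_addf F _ (nbhs t)).
        apply: (@continuous_coord F _ _ _ (fun t => t *m t)).
        by apply: continuous_mulmx; exact: continuous_idfun.
      apply: (@cvg_comp _ _ _ _ -%R); last exact: opp_continuous.
      exact: (@continuous_coord F _ _ _ id i j (@continuous_idfun _)).
    by apply/funext => t; rewrite !mxE.
  have nb : nbhs (e *m e - e) [set z | mxb r (z - (e *m e - e))].
    by apply/(nbhs_mxballP OP); exists r.
  have [z [[k rk ->] /= hz]] := cle [set z | exists2 k, (r <= k)%N & z = u k] _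
    (ex_intro2 _ _ r I (fun k rk => ex_intro2 _ _ k rk erefl)) (cs e _ nb).
  rewrite -(subKr (u k *m u k - u k) (e *m e - e)); apply: (mxballB OP) => //.
  exact: (mxball_le OP rk).
- have cl : closed [set z : 'M[F]_(n1 + n2) | A *m z - z *m A = 0].
    apply: (bs_closed_fiber BM); apply: continuous_mx => i j.
    rewrite (_ : (fun t => _) =
        fun t : 'M[F]_(n1 + n2) => (A *m t) i j - (t *m A) i j).
      move=> t; apply: (@cvg_addf F _ (nbhs t)).
        apply: (@continuous_coord F _ _ _ (fun t => A *m t)).
        by apply: continuous_mulmx; [exact: continuous_const | exact: continuous_idfun].
      apply: (@cvg_comp _ _ _ _ -%R); last exact: opp_continuous.
      apply: (@continuous_coord F _ _ _ (fun t => t *m A)).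
      by apply: continuous_mulmx; [exact: continuous_idfun | exact: continuous_const].
    by apply/funext => t; rewrite !mxE.
  apply: cl => B /(cle [set z | exists k, z = u k] _
    (ex_intro2 _ _ 0%N I (fun k _ => ex_intro _ k erefl))) [z [[k ->] Bz]].
  by exists (u k); split=> //=; rewrite uA subrr.
Qed.

Lemma unemb_continuous : continuous (@unemb F n1 n2).
Proof.
have c1 : continuous (fun x : triple F (n1 + n2) => x.1.1).
  exact/continuous_fst_comp/continuous_fst_comp/continuous_idfun.
have c2 : continuous (fun x : triple F (n1 + n2) => x.1.2).
  exact/continuous_snd_comp/continuous_fst_comp/continuous_idfun.
have c3 : continuous (fun x : triple F (n1 + n2) => x.2).
  exact/continuous_snd_comp/continuous_idfun.
have cs q q' m m' (f : triple F (n1 + n2) -> 'M[F]_(q, q')) (a : 'I_m -> 'I_q)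
    (b : 'I_m' -> 'I_q') (g : triple F (n1 + n2) -> 'M[F]_(m, m')) :
    continuous f -> (forall x i j, g x i j = f x (a i) (b j)) -> continuous g.
  move=> fc gE; apply: continuous_mx => i j.
  rewrite (_ : (fun t => _) = fun t => f t (a i) (b j)); last first.
    by apply/funext => t; rewrite gE.
  exact: continuous_coord.
apply: continuous_pair; (apply: continuous_pair; first apply: continuous_pair).
- by apply: (cs _ _ _ _ _ (lshift n2) (lshift n2) _ c1) => x i j; rewrite !mxE.
- by apply: (cs _ _ _ _ _ (lshift n2) id _ c2) => x i j; rewrite !mxE.
- by apply: (cs _ _ _ _ _ id (lshift n2) _ c3) => x i j; rewrite !mxE.
- by apply: (cs _ _ _ _ _ (@rshift n1 n2) (@rshift n1 n2) _ c1) => x i j; rewrite !mxE.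
- by apply: (cs _ _ _ _ _ (@rshift n1 n2) id _ c2) => x i j; rewrite !mxE.
- by apply: (cs _ _ _ _ _ id (@rshift n1 n2) _ c3) => x i j; rewrite !mxE.
Qed.

(** The matrix of a nearby x commutes with an idempotent e close to E0. An element g close to 1
    conjugates E0 to e, so g^-1 x has block diagonal matrix, and it is close enough to [emb y] for
    its pair to be in N. *)
Lemma slice_open_image y (N : set X12) r : slice O pi p y -> nbhs y N ->
  \forall x \near emb y, exists k y', [/\ KO r k, N y' & x = act (GLt k false) (emb y')].
Proof.
move=> sy yN.
have BX := ball_structure_triple OP (n1 + n2).
have [r0 [W0 W0n HW0]] : exists r0, exists2 W0, nbhs (emb y) W0 &
    forall g x, KO r0 g -> W0 x -> N (unemb (act (GLt g false) x)).
  have c : continuous (fun z => unemb (@pact F (n1 + n2) z)).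
    by apply: continuous_fun_comp unemb_continuous; exact: pact_continuous.
  have e1 : unemb (@pact F (n1 + n2) (1%:M, 1%:M, emb y)) = y.
    by rewrite -[RHS]embK /pact /= !mul1mx !mulmx1.
  have : nbhs ((1%:M, 1%:M), emb y)
      ((fun z => unemb (@pact F (n1 + n2) z)) @^-1` N).
    by apply: c; rewrite e1.
  case=> -[U W] /= [/(nbhs1_KO OP)[r0 Hr0] nW] UW.
  exists r0, W => // g x gK Wx; rewrite -pactE; apply: (UW (_, _)); split=> //=.
  exact: Hr0.
pose s := (maxn r r0).+1.
pose M x := peval p x.1.1.
have cM : continuous M.
  exact/continuous_peval/continuous_fst_comp/continuous_fst_comp/continuous_idfun.
(* On the first block p(A1)^(2^k) = 1 + (p(A1) - 1)^(2^k) tends to 1, and on the second p(A2)^(2^k)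
   tends to 0. *)
have [k0 Hk0] : exists k, mxb s (M (emb y) ^+ (2 ^ k) - E0).
  have [k1 H1] := slice_top_nilp1 OP sy s; have [k2 H2] := slice_top_nilp2 OP sy s.
  pose k := maxn k1 k2.
  have k1k : (k1 <= 2 ^ k)%N.
    exact: leq_trans (leq_maxl k1 k2) (ltnW (ltn_expl _ _)).
  have k2k : (k2 <= 2 ^ k)%N.
    exact: leq_trans (leq_maxr k1 k2) (ltnW (ltn_expl _ _)).
  exists k; rewrite /M /= peval_block exp_block_diag.
  rewrite -{1}(subrKC 1%:M (peval p y.1.1.1)) exp2n_add1//.
  rewrite opp_block_mx add_block_mx !oppr0 !addr0 addrAC subrr add0r.
  by apply: mxball_block; [exact: H1 | exact: (mxball0 OP).. | exact: H2].
have near1 : \forall x \near emb y, mxb s (M x ^+ (2 ^ k0) - E0).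
  have c : continuous (fun x => M x ^+ (2 ^ k0)) by exact: continuous_exp.
  have nb : nbhs (M (emb y) ^+ (2 ^ k0)) [set z | mxb s (z - E0)].
    apply/(nbhs_mxballP OP); exists s => z zs.
    have := mxballD OP zs Hk0.
    by rewrite addrA subrK.
  exact: c nb.
apply: filterS2 near1 W0n => x hx W0x.
have comm : x.1.1 *m M x ^+ (2 ^ k0) = M x ^+ (2 ^ k0) *m x.1.1.
  have xM : x.1.1 *m M x = M x *m x.1.1 by apply/esym/peval_comm.
  elim: (2 ^ k0)%N => [|k IH]; first by rewrite mul1mx mulmx1.
  by rewrite expmxS mulmxA xM -!mulmxA IH.
have [e [ee xe he]] := near_idempotent (ltn0Sn _) hx comm.
have E1 : (1%:M - E0) *m E0 = 0 by rewrite mulmxBl mul1mx E0_idem subrr.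
(* The standard intertwiner of two idempotents: g E0 = e g, and g = 1 when e = E0. *)
pose g := e *m E0 + (1%:M - e) *m (1%:M - E0).
have g1 : mxb s (g - 1%:M).
  rewrite (_ : g - 1%:M = (e - E0) *m E0 - (e - E0) *m (1%:M - E0)).
    have he0 : mxb s ((e - E0) *m E0) by apply: (mxballMr OP) => //; exact: E0_int.
    apply: (mxballB OP) => //; rewrite mulmxBr mulmx1; exact: (mxballB OP).
  have h1 : e *m E0 = (e - E0) *m E0 + E0 by rewrite mulmxBl E0_idem subrK.
  have h2 : (1%:M - e) *m (1%:M - E0) = (1%:M - E0) - (e - E0) *m (1%:M - E0).
    rewrite (_ : 1%:M - e = (1%:M - E0) - (e - E0)); last by rewrite opprB addrA subrK.
    by rewrite mulmxBl [X in X - _ = _]mulmxBr mulmx1 E1 subr0.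
  by rewrite /g h1 h2 addrA -[_ + E0 + _]addrA subrKC addrAC addrK.
have [gu _] := mxball_invmx OP (ltn0Sn _) g1.
pose G := GLin gu.
have GK : KO s G by exact: (KO_near OP).
have gE : g *m E0 = e *m g.
  have e1 : e *m (1%:M - e) = 0 by rewrite mulmxBr mulmx1 ee subrr.
  rewrite /g [LHS]mulmxDl [RHS]mulmxDr -!mulmxA E0_idem E1 mulmx0 addr0.
  by rewrite !mulmxA ee e1 mul0mx addr0.
pose x' := act (GLt G^-1%g false) x.
have x'E : x'.1.1 *m E0 = E0 *m x'.1.1.
  have -> : x'.1.1 = invmx g *m x.1.1 *m g.
    by rewrite /x'; case: x {hx W0x comm xe x'} => [[A v] f]; rewrite /= invmxK.
  apply: (can_inj (mulKmx gu)).
  transitivity (x.1.1 *m (g *m E0)); first by rewrite !mulmxA mulmxV// mul1mx.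
  by rewrite [RHS]mulmxA gE !mulmxA mulmxK// xe.
have [A12 A21] : ursubmx x'.1.1 = 0 /\ dlsubmx x'.1.1 = 0.
  move: x'E; rewrite -[x'.1.1]submxK !mulmx_block !mulmx0 !mul0mx !mulmx1 !mul1mx.
  rewrite !addr0 => /eq_block_mx[_ A12 A21 _].
  by rewrite block_mxKur block_mxKdl.
exists G, (unemb x'); split.
- by apply: (KO_le OP _ GK); rewrite /s leqW// leq_maxl.
- apply: HW0 => //; apply/KOV/(KO_le OP _ GK); by rewrite /s leqW// leq_maxr.
- by rewrite unembK// /x' -actM -[GLt G false]/(GLt G false) GLtM mulgV act1.
Qed.

End SliceOpenness.

(** The relation of the application is an equivalence only between elements of a subgroup, which is
    why covering is stated up to the direction of [e]. *)
Lemma irredundant_sublist (T : eqType) (e : T -> T -> Prop) (s : seq T) :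
  (forall x, x \in s -> e x x) -> 
  exists s', [/\ uniq s', {subset s' <= s},
    forall x, x \in s -> exists2 y, y \in s' & e y x \/ e x y &
    forall x y, x \in s' -> y \in s' -> e x y -> x = y].
Proof.
elim: s => [|x s IH] refl; first by exists [::]; split.
have [|s' [us' ss' cov irr]] := IH; first by move=> y ys; apply: refl; rewrite inE ys orbT.
have [[y ys' exy]|nex] := pselect (exists2 y, y \in s' & e y x \/ e x y).
  exists s'; split=> //; first by move=> z /ss' zs; rewrite inE zs orbT.
  by move=> z; rewrite inE => /orP[/eqP ->|/cov//]; exists y.
exists (x :: s'); split.
- rewrite /= us' andbT; apply/negP => xs'; apply: nex; exists x => //; left.
  by apply: refl; rewrite mem_head.
- move=> z; rewrite inE => /orP[/eqP ->|/ss' zs]; first exact: mem_head.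
  by rewrite inE zs orbT.
- move=> z; rewrite inE => /orP[/eqP ->|/cov[y ys' h]].
    by exists x; [exact: mem_head | left; apply: refl; exact: mem_head].
  by exists y; rewrite // inE ys' orbT.
- move=> y z; rewrite !inE => /orP[/eqP ->|ys'] /orP[/eqP ->|zs'] // eyz.
  + by case: nex; exists z => //; right.
  + by case: nex; exists y => //; left.
  + exact: irr.
Qed.

(** * Functions induced from the slice to the full space *)

Section Induction.
Variables (F : localFieldType) (O : set F) (pi : F).
Hypothesis char2 : 2%N \in [pchar F].
Hypothesis OP : integer_ring O pi.
Variables (R : realType) (n1 n2 : nat) (p : {poly F}).
Local Notation X12 := (triple F n1 * triple F n2)%type.
Local Notation X := (triple F (n1 + n2)).
Local Notation KO := (KO O pi).
Local Notation slice := (@slice F O pi n1 n2 p).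
Local Notation "g *a x" := (act (GLt g false) x) (at level 40, left associativity).
Implicit Types (y : X12) (x : X) (J : set (GLinear F (n1 + n2))) (psi : X12 -> R[i]).
Implicit Types (g k : GLinear F (n1 + n2)).

Lemma act_mul g k x : (g * k)%g *a x = g *a (k *a x).
Proof. by rewrite -actM. Qed.

Lemma act_one x : 1%g *a x = x.
Proof. exact: act1. Qed.

Lemma act_invK g x : g *a (g^-1%g *a x) = x.
Proof. by rewrite -act_mul mulgV act_one. Qed.

Definition on_slice J x y := exists k, [/\ J k, slice y & x = k *a emb y].

(* Only meaningful for [psi] invariant under the block diagonal elements of
   [J]; otherwise the value depends on the chosen [y]. *)
Definition ind J psi x : R[i] :=
  if pselect (exists y, on_slice J x y) is left ex then psi (projT1 (cid ex)) else 0.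

Definition blk_invariant J psi :=
  forall h1 h2 y, J (blk h1 h2) -> psi (act2 h1 h2 y) = psi y.

Record subgroup J : Prop := {
  sg1 : J 1%g ;
  sgM : forall g k, J g -> J k -> J (g * k)%g ;
  sgV : forall g, J g -> J g^-1%g }.

Lemma KO_subgroup r : subgroup (KO r).
Proof. by split; [exact: (KO1 OP) | move=> g k; exact: (KOM OP) | move=> g; exact: KOV]. Qed.

(** Two presentations of x differ by an element of J carrying a slice point to a slice point. It is
    block diagonal by [slice_transporter], and the invariance of psi absorbs it. *)
Lemma indE J psi x y : subgroup J -> blk_invariant J psi -> on_slice J x y ->
  ind J psi x = psi y.
Proof.
move=> sJ pJ xy; rewrite /ind; case: pselect => [ex|[]]; last by exists y.
case: (cid ex) => y' /= [k' [Jk' sy' xk']]; case: xy => k [Jk sy xk].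
have [|h1 [h2 [hE ->]]] := @slice_transporter F O pi char2 OP n1 n2 p (k'^-1 * k)%g _ _ sy sy'.
  by rewrite act_mul -xk xk' act_inv.
by rewrite pJ// -hE; apply: (sgM sJ) => //; exact: (sgV sJ).
Qed.

Lemma ind0 J psi x : ~ (exists y, on_slice J x y) -> ind J psi x = 0.
Proof. by rewrite /ind; case: pselect. Qed.

Lemma ind_neq0 J psi x : ind J psi x != 0 -> exists2 y, on_slice J x y & psi y != 0.
Proof.
rewrite /ind; case: pselect => [ex|]; last by rewrite eqxx.
by case: (cid ex) => y /= xy nz; exists y.
Qed.

Lemma eq_ind J psi psi' : (forall y, slice y -> psi y = psi' y) -> ind J psi = ind J psi'.
Proof.
move=> e; apply/funext => x; rewrite /ind; case: pselect => // ex.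
by case: (cid ex) => y /= [k [_ sy _]]; exact: e.
Qed.

Lemma on_sliceM J x y k : subgroup J -> J k -> on_slice J x y -> on_slice J (k *a x) y.
Proof.
move=> sJ Jk [k' [Jk' sy ->]]; exists (k * k')%g; split; rewrite ?act_mul //.
exact: (sgM sJ).
Qed.

Lemma ind_act J psi x k : subgroup J -> blk_invariant J psi -> J k ->
  ind J psi (k *a x) = ind J psi x.
Proof.
move=> sJ pJ Jk; have [[y xy]|nex] := pselect (exists y, on_slice J x y).
  by rewrite (indE sJ pJ xy); apply: indE => //; exact: on_sliceM.
rewrite (ind0 _ nex) ind0// => -[y ky]; apply: nex; exists y.
by rewrite -(act_inv k x); apply: on_sliceM => //; exact: (sgV sJ).
Qed.

Lemma on_slice_blk J y h1 h2 g : subgroup J -> J g -> slice y ->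
  on_slice J (g *a (blk h1 h2 *a emb y)) (act2 h1 h2 y).
Proof.
move=> sJ Jg sy; exists g.
by split; [exact: Jg | apply/slice_act2 | rewrite emb_act2].
Qed.

Lemma emb_continuous : continuous (@emb F n1 n2).
Proof.
have cA1 : continuous (fun y : X12 => y.1.1.1).
  exact/continuous_fst_comp/continuous_fst_comp/continuous_fst_comp/continuous_idfun.
have cA2 : continuous (fun y : X12 => y.2.1.1).
  exact/continuous_fst_comp/continuous_fst_comp/continuous_snd_comp/continuous_idfun.
have cv1 : continuous (fun y : X12 => y.1.1.2).
  exact/continuous_snd_comp/continuous_fst_comp/continuous_fst_comp/continuous_idfun.
have cv2 : continuous (fun y : X12 => y.2.1.2).
  exact/continuous_snd_comp/continuous_fst_comp/continuous_snd_comp/continuous_idfun.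
have cf1 : continuous (fun y : X12 => y.1.2).
  exact/continuous_snd_comp/continuous_fst_comp/continuous_idfun.
have cf2 : continuous (fun y : X12 => y.2.2).
  exact/continuous_snd_comp/continuous_snd_comp/continuous_idfun.
apply: continuous_pair; first apply: continuous_pair.
- apply: continuous_mx => i j; case: (split_ordP i) => i' ->; case: (split_ordP j) => j' ->.
  + rewrite (_ : (fun t => _) = fun t : X12 => t.1.1.1 i' j'); first exact: continuous_coord.
    by apply/funext => t; rewrite block_mxEul.
  + rewrite (_ : (fun t => _) = fun t : X12 => 0); first exact: continuous_const.
    by apply/funext => t; rewrite block_mxEur mxE.
  + rewrite (_ : (fun t => _) = fun t : X12 => 0); first exact: continuous_const.
    by apply/funext => t; rewrite block_mxEdl mxE.
  + rewrite (_ : (fun t => _) = fun t : X12 => t.2.1.1 i' j'); first exact: continuous_coord.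
    by apply/funext => t; rewrite block_mxEdr.
- apply: continuous_mx => i j; case: (split_ordP i) => i' ->.
  + rewrite (_ : (fun t => _) = fun t : X12 => t.1.1.2 i' j); first exact: continuous_coord.
    by apply/funext => t; rewrite col_mxEu.
  + rewrite (_ : (fun t => _) = fun t : X12 => t.2.1.2 i' j); first exact: continuous_coord.
    by apply/funext => t; rewrite col_mxEd.
- apply: continuous_mx => i j; case: (split_ordP j) => j' ->.
  + rewrite (_ : (fun t => _) = fun t : X12 => t.1.2 i j'); first exact: continuous_coord.
    by apply/funext => t; rewrite row_mxEl.
  + rewrite (_ : (fun t => _) = fun t : X12 => t.2.2 i j'); first exact: continuous_coord.
    by apply/funext => t; rewrite row_mxEr.
Qed.

Lemma compact_KO_orbit r (C : set X12) : compact C ->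
  compact [set x | exists k y, [/\ KO r k, C y & x = k *a emb y]].
Proof.
move=> cC.
pose M2 := ('M[F]_(n1 + n2) * 'M[F]_(n1 + n2))%type.
(* The congruence subgroup is realised by its pairs (g, g^-1), a closed subset of a product of two
   compact balls. *)
pose Q : set M2 := [set q | mxE_ball O pi r 1%:M q.1] `&` [set q | mxE_ball O pi r 1%:M q.2]
  `&` [set q | q.1 *m q.2 = 1%:M].
have BM := ball_structure_mx OP (n1 + n2) (n1 + n2).
have cQ : compact Q.
  have c1 : continuous (fun q : M2 => q.1) by exact/continuous_fst_comp/continuous_idfun.
  have c2 : continuous (fun q : M2 => q.2) by exact/continuous_snd_comp/continuous_idfun.
  apply: subclosed_compact _ (compact_setX (@compact_mxE_ball _ _ _ OP _ _ r 1%:M)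
    (@compact_mxE_ball _ _ _ OP _ _ r 1%:M)) _; last by move=> q [[]].
  have clb : closed [set M | mxE_ball O pi r (1%:M : 'M[F]_(n1 + n2)) M].
    by apply: (bs_closed BM (r := r)) => M N MN hM; exact: bs_trans BM _ _ _ _ hM MN.
  apply: closedI; first apply: closedI.
  - by apply: preimage_closed clb => q _; exact: c1.
  - by apply: preimage_closed clb => q _; exact: c2.
  - by apply: (bs_closed_fiber BM); exact: continuous_mulmx.
have cf : continuous (fun z : M2 * X12 => @pact F (n1 + n2) (z.1, emb z.2)).
  apply: continuous_fun_comp (@pact_continuous F (n1 + n2)); apply: continuous_pair.
    exact/continuous_fst_comp/continuous_idfun.
  by apply: continuous_fun_comp emb_continuous; exact/continuous_snd_comp/continuous_idfun.
have := continuous_compact (continuous_subspaceT cf) (compact_setX cQ cC).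
congr compact; apply/seteqP; split=> [_ [[[a b] y] [/= [[qa qb] ab] Cy] <-]|x].
  have [au _] := mulmx1_unit ab.
  have bE : b = invmx a by rewrite -[LHS](mulKmx au) ab mulmx1.
  exists (GLin au), y; split => //; first by split=> //=; rewrite -bE.
  by rewrite bE; exact: (pactE (GLin au)).
move=> [k [y [[k1 k2] Cy ->]]]; exists ((Defs.GLval k, invmx k), y); last exact: pactE.
by split=> //; split; [split | exact: GLmulV].
Qed.

(** At a point on the orbit of the slice, [slice_open_image] gives nearby points representatives
    with the same value of psi. A point off that orbit has a neighbourhood missing the compact,
    hence closed, set that carries the support. *)
Lemma ind_schwartz r psi : psi \in @schwartz R _ -> blk_invariant (KO r) psi ->
  ind (KO r) psi \in @schwartz R _.
Proof.
move=> pS pinv; have sK := KO_subgroup r.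
have [so sc] := slice_clopen OP n1 n2 p.
have cC : compact (slice `&` fsupport psi).
  by rewrite setIC; apply: compact_closedI => //; exact: schwartz_compact.
have cD := compact_KO_orbit (r := r) cC.
have hX : hausdorff_space X := bs_hausdorff (ball_structure_triple OP (n1 + n2)).
have supp x : ind (KO r) psi x != 0 ->
    exists k y, [/\ KO r k, (slice `&` fsupport psi) y & x = k *a emb y].
  move=> /ind_neq0[y [k [kK sy xE]] nz]; exists k, y; split=> //; split=> //.
  exact: fsupport_neq0.
apply: (schwartz_near hX cD) => //.
move=> x; have [[y [k [kK sy xE]]]|nex] := pselect (exists y, on_slice (KO r) x y).
  have nN : nbhs y (slice `&` [set y' | psi y' = psi y]).
    by apply: filterI; [exact: open_nbhs_nbhs | exact: (schwartz_lc pS y)].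
  have W := slice_open_image char2 OP r sy nN.
  have : nbhs x (act (GLt k^-1%g false) @^-1` [set z | exists k0 y', [/\ KO r k0,
      (slice `&` [set y' | psi y' = psi y]) y' & z = k0 *a emb y']]).
    by apply: act_continuous; rewrite xE act_inv; exact: W.
  apply: filterS => x' [k0 [y' [k0K [sy' py'] x'E]]].
  rewrite (indE (x := x) (y := y) sK pinv); last by exists k.
  rewrite (indE (x := x') (y := y') sK pinv) //; exists (k * k0)%g; split => //.
    exact: (sgM sK).
  by rewrite act_mul -x'E act_invK.
rewrite (ind0 _ nex).
have clD := compact_closed hX cD.
have : nbhs x (~` [set x |
    exists k y, [/\ KO r k, (slice `&` fsupport psi) y & x = k *a emb y]]).
  apply: open_nbhs_nbhs; split; first exact: closed_openC.
  by move=> [k [y [kK [sy _] xE]]]; apply: nex; exists y, k.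
by apply: filterS => x' nx'; apply: contrapT => /eqP /supp.
Qed.

(** [J] normalises [KO r], so the products k (KO r) H, with H the block diagonal group, cut J into
    finitely many classes. By [slice_transporter] the pieces k (KO r) slice for inequivalent k are
    disjoint, and on each one Phi is a translated induced function. The list is chosen before Phi,
    so that its length can be a ratio common to all functions. *)
Lemma ind_decomposition J r : subgroup J -> KO r `<=` J -> J `<=` KO 0 ->
  exists s : seq (GLinear F (n1 + n2)),
    [/\ (0 < size s)%N, forall k, k \in s -> J k &
    forall Phi : X -> R[i], (forall k x, KO r k -> Phi (k *a x) = Phi x) ->
      (forall x, Phi x != 0 -> exists y, on_slice J x y) ->
      forall x, Phi x = \sum_(k <- s) ind (KO r) (fun y => Phi (k *a emb y)) (k^-1%g *a x)].
Proof.
move=> sJ KJ JK; have sK := KO_subgroup r.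
have [s0 [s0J s0cov]] := KO_reps OP r JK.
pose e k j := exists u h1 h2, KO r u /\ j = (k * u * blk h1 h2)%g.
have e_refl k : e k k by exists 1%g, 1%g, 1%g; rewrite blk1 !mulg1; split=> //; exact: sg1.
have JKn k u : J k -> KO r u -> KO r (k * u * k^-1)%g by move=> /JK; exact: (KO_norm OP).
have e_sym k j : J k -> J j -> e k j -> e j k.
  move=> Jk Jj [u [h1 [h2 [uK jE]]]].
  have Jb : J (blk h1 h2).
    rewrite (_ : blk h1 h2 = (k * u)^-1 * j)%g; last by rewrite jE mulKg.
    by apply: (sgM sJ) => //; apply/(sgV sJ)/(sgM sJ) => //; exact: KJ.
  exists ((blk h1 h2)^-1 * u^-1 * (blk h1 h2)^-1^-1)%g, h1^-1%g, h2^-1%g; split.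
    by apply: JKn; [exact: (sgV sJ) | exact: KOV].
  by rewrite jE -blkV invgK !mulgA !mulgK.
have e_trans k j l : J k -> J j -> e k j -> e j l -> e k l.
  move=> Jk Jj [u [h1 [h2 [uK jE]]]] [w [g1 [g2 [wK lE]]]].
  have Jb : J (blk h1 h2).
    rewrite (_ : blk h1 h2 = (k * u)^-1 * j)%g; last by rewrite jE mulKg.
    by apply: (sgM sJ) => //; apply/(sgV sJ)/(sgM sJ) => //; exact: KJ.
  exists (u * (blk h1 h2 * w * (blk h1 h2)^-1))%g, (h1 * g1)%g, (h2 * g2)%g; split.
    by apply: (sgM sK) => //; exact: JKn.
  by rewrite lE jE -blkM !mulgA mulgVK.
have [s [us ss0 scov irr]] := @irredundant_sublist _ e s0 (fun k _ => e_refl k).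
have sJ' k : k \in s -> J k by move=> /ss0 /s0J.
have scovJ j : J j -> exists2 k, k \in s & e k j.
  move=> Jj; have [k0 k0s k0j] := s0cov j Jj.
  have k0J := s0J _ k0s.
  have ek0j : e k0 j.
    by exists (k0^-1 * j)%g, 1%g, 1%g; rewrite blk1 mulg1 mulVKg.
  have [k ks ek] := scov _ k0s; exists k => //.
  apply: (e_trans _ k0) => //; first exact: sJ'.
  by case: ek => // ek; apply: e_sym => //; exact: sJ'.
exists s; split=> //.
  have [k ks _] := scovJ _ (sg1 sJ).
  by case: (s) ks.
move=> Phi PhiK Phisupp x.
have Phi_inv k : J k -> blk_invariant (KO r) (fun y => Phi (k *a emb y)).
  move=> Jk h1 h2 y hK; have := PhiK _ (k *a emb y) (JKn k _ Jk hK).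
  by rewrite emb_act2 !act_mul act_inv.
have [[y [j [Jj sy xE]]]|nex] := pselect (exists y, on_slice J x y); last first.
  have [->|/Phisupp//] := eqVneq (Phi x) 0.
  rewrite big_seq big1// => k /sJ' Jk; apply: ind0 => -[y [u [uK sy xE]]].
  apply: nex; exists y, (k * u)%g; split=> //; first by apply: (sgM sJ) => //; exact: KJ.
  by rewrite act_mul -xE act_invK.
have [k ks [u [h1 [h2 [uK jE]]]]] := scovJ j Jj.
have Jk := sJ' k ks.
(* A second representative k' with a nonzero term would be equivalent to j, hence to k. *)
rewrite (bigD1_seq k)//= big1_seq ?addr0; last first.
  move=> k' /andP[k'k k's]; have Jk' := sJ' _ k's.
  apply: ind0 => -[y' [u' [u'K sy' xE']]].
  have Ey : ((k' * u')^-1 * j)%g *a emb y = emb y'.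
    by rewrite act_mul -xE -(act_invK k' x) xE' -(act_mul k') act_inv.
  have [g1 [g2 [gE _]]] := slice_transporter char2 OP sy sy' Ey.
  have ek'j : e k' j by exists u', g1, g2; split=> //; rewrite -gE mulVKg.
  have ekj : e k j by exists u, h1, h2.
  move/eqP: k'k; apply; apply: irr => //.
  by apply: (e_trans _ j) => //; exact: e_sym.
have xk : k^-1%g *a x = u *a (blk h1 h2 *a emb y).
  by rewrite xE jE !act_mul act_inv.
rewrite xk (indE sK (Phi_inv k Jk) (on_slice_blk h1 h2 sK uK sy)).
have := PhiK _ (k *a (blk h1 h2 *a emb y)) (JKn k u Jk uK).
by rewrite emb_act2 xE jE !act_mul act_inv.
Qed.

End Induction.

Lemma continuous_act2 (F : localFieldType) n1 n2 (h1 : GLinear F n1) (h2 : GLinear F n2) :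
  continuous (act2 h1 h2).
Proof.
apply: continuous_pair.
  by apply: continuous_fun_comp (@act_continuous F n1 _);
    exact/continuous_fst_comp/continuous_idfun.
by apply: continuous_fun_comp (@act_continuous F n2 _);
    exact/continuous_snd_comp/continuous_idfun.
Qed.

Lemma continuous_tau2 (F : localFieldType) n1 n2 : continuous (@tau2 F n1 n2).
Proof.
apply: continuous_pair.
  by apply: continuous_fun_comp (@act_continuous F n1 _);
    exact/continuous_fst_comp/continuous_idfun.
by apply: continuous_fun_comp (@act_continuous F n2 _);
    exact/continuous_snd_comp/continuous_idfun.
Qed.

Section ActTwo.
Variables (F : localFieldType) (n1 n2 : nat).
Implicit Types (y : triple F n1 * triple F n2).

Lemma act2M (h1 k1 : GLinear F n1) (h2 k2 : GLinear F n2) y :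
  act2 (h1 * k1)%g (h2 * k2)%g y = act2 h1 h2 (act2 k1 k2 y).
Proof. by rewrite /act2 /= -!actM. Qed.

Lemma act2_1 y : act2 1%g 1%g y = y.
Proof. by case: y => y1 y2; rewrite /act2 /=; congr (_, _); exact: act1. Qed.

Lemma act2K (h1 : GLinear F n1) (h2 : GLinear F n2) :
  cancel (act2 h1 h2) (act2 h1^-1%g h2^-1%g).
Proof. by move=> y; rewrite -act2M !mulVg act2_1. Qed.

Lemma tau2K : cancel (@tau2 F n1 n2) (@tau2 F n1 n2).
Proof. by case=> y1 y2; rewrite /tau2 /= -!actM !tau_tau !act1. Qed.

Lemma tau2_act2 (h1 : GLinear F n1) (h2 : GLinear F n2) y :
  tau2 (act2 h1 h2 y) = act2 (GLtrV h1) (GLtrV h2) (tau2 y).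
Proof. by rewrite /tau2 /act2 /= -!actM !tau_mul. Qed.

Lemma schwartz_act2 (R : realType) (f : triple F n1 * triple F n2 -> R[i])
    (h1 : GLinear F n1) (h2 : GLinear F n2) :
  f \in @schwartz R _ -> (fun y => f (act2 h1 h2 y)) \in @schwartz R _.
Proof.
move=> fS; exact: (schwartz_comp (@continuous_act2 F n1 n2 h1 h2)
  (@continuous_act2 F n1 n2 _ _) (act2K h1 h2) (TestFun fS)).
Qed.

Lemma schwartz_tau2 (R : realType) (f : triple F n1 * triple F n2 -> R[i]) :
  f \in @schwartz R _ -> (fun y => f (tau2 y)) \in @schwartz R _.
Proof.
move=> fS; exact: (schwartz_comp (@continuous_tau2 F n1 n2)
  (@continuous_tau2 F n1 n2) tau2K (TestFun fS)).
Qed.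

End ActTwo.

Section Ev.
Variables (R : realType) (X : topologicalType) (xi : distribution R X).

(** Extension of xi by 0 to functions that are not test functions, so that values at induced
    functions can be written before membership is proved. *)
Definition ev (f : X -> R[i]) : R[i] :=
  if pselect (f \in @schwartz R X) is left fS then xi (TestFun fS) else 0.

Lemma evE (Phi : testFun R X) : ev Phi = xi Phi.
Proof.
rewrite /ev; case: pselect => [fS|[]]; last exact: testFunP.
by congr (xi _); exact: testFun_inj.
Qed.

Lemma schwartz_lin (a : R[i]) (f g : X -> R[i]) : f \in @schwartz R X -> g \in @schwartz R X ->
  (fun x => a * f x + g x) \in @schwartz R X.
Proof. by move=> fS gS; exact: testFunP (a *: TestFun fS + TestFun gS). Qed.

Lemma ev_lin (a : R[i]) (f g : X -> R[i]) : f \in @schwartz R X -> g \in @schwartz R X ->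
  ev (fun x => a * f x + g x) = a * ev f + ev g.
Proof.
move=> fS gS; have := linearP xi a (TestFun fS) (TestFun gS).
by rewrite -!evE.
Qed.

Lemma schwartz0 : (fun=> 0) \in @schwartz R X.
Proof. exact: testFunP (0 : testFun R X). Qed.

Lemma ev_sum (I : Type) (s : seq I) (f : I -> X -> R[i]) :
  (forall i, f i \in @schwartz R X) ->
  (fun x => \sum_(i <- s) f i x) \in @schwartz R X /\
  ev (fun x => \sum_(i <- s) f i x) = \sum_(i <- s) ev (f i).
Proof.
move=> fS; elim: s => [|i s [IH1 IH2]].
  have -> : (fun x => \sum_(i <- [::]) f i x) = (fun=> 0).
    by apply/funext => x; rewrite big_nil.
  rewrite big_nil; split; first exact: schwartz0.
  by have := evE 0; rewrite linear0.
have -> : (fun x => \sum_(i <- i :: s) f i x) = fun x => 1 * f i x + \sum_(i <- s) f i x.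
  by apply/funext => x; rewrite big_cons mul1r.
rewrite big_cons; split; first exact: schwartz_lin.
by rewrite ev_lin // mul1r IH2.
Qed.

End Ev.

(** * Comparison of levels and of block diagonal translates *)

Section DescentFunctional.
Variables (F : localFieldType) (O : set F) (pi : F).
Hypothesis char2 : 2%N \in [pchar F].
Hypothesis OP : integer_ring O pi.
Variables (R : realType) (n1 n2 : nat) (p : {poly F}).
Local Notation X12 := (triple F n1 * triple F n2)%type.
Local Notation X := (triple F (n1 + n2)).
Local Notation KO := (KO O pi).
Local Notation slice := (@slice F O pi n1 n2 p).
Local Notation ind := (@ind F O pi R n1 n2 p).
Local Notation S12 := (@schwartz R X12).
Local Notation "g *a x" := (act (GLt g false) x) (at level 40, left associativity).
Variable xi : distribution R X.
Hypothesis xi_eq : equivariant xi.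
Implicit Types (psi : X12 -> R[i]) (y : X12) (x : X).


Lemma schwartz_act (f : X -> R[i]) h : f \in @schwartz R X ->
  (fun x => f (act h x)) \in @schwartz R X.
Proof. by move=> fS; exact: testFunP (translate h (TestFun fS)). Qed.

Lemma ev_act (f : X -> R[i]) h : f \in @schwartz R X ->
  ev xi (fun x => f (act h x)) = chi R h * ev xi f.
Proof. by move=> fS; have := xi_eq h (TestFun fS); rewrite -!evE. Qed.

Lemma schwartz_blk_invariant psi : psi \in S12 -> exists r, blk_invariant (KO r) psi.
Proof.
move=> pS.
pose P n := ('M[F]_n * 'M[F]_n)%type.
pose a (z : (P n1 * P n2) * X12) : X12 :=
  (@pact F n1 (z.1.1, z.2.1), @pact F n2 (z.1.2, z.2.2)).
have ac : continuous a.
  apply: continuous_pair.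
    apply: continuous_fun_comp (@pact_continuous F n1); apply: continuous_pair.
      exact/continuous_fst_comp/continuous_fst_comp/continuous_idfun.
    exact/continuous_fst_comp/continuous_snd_comp/continuous_idfun.
  apply: continuous_fun_comp (@pact_continuous F n2); apply: continuous_pair.
    exact/continuous_snd_comp/continuous_fst_comp/continuous_idfun.
  exact/continuous_snd_comp/continuous_snd_comp/continuous_idfun.
have a1 y : a ((1%:M, 1%:M), (1%:M, 1%:M), y) = y.
  by case: y => [[[A1 v1] f1] [[A2 v2] f2]]; rewrite /a /pact /= !mul1mx !mulmx1.
have := schwartz_action (p0 := ((1%:M, 1%:M), (1%:M, 1%:M))) pS ac a1.
case=> -[U1 U2] /= [/(nbhs1_KO OP)[r1 H1] /(nbhs1_KO OP)[r2 H2]] U.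
exists (maxn r1 r2) => h1 h2 y /KO_blkP[h1K h2K].
have hr (k1 : GLinear F n1) (k2 : GLinear F n2) z :
    KO (maxn r1 r2) k1 -> KO (maxn r1 r2) k2 -> psi z != 0 ->
    psi (act2 k1 k2 z) = psi z.
  move=> k1K k2K nz.
  have := U ((Defs.GLval k1, invmx k1), (Defs.GLval k2, invmx k2)) _ z nz.
  rewrite /a /= !pactE; apply; split.
    by apply: H1; exact: (KO_le OP (leq_maxl r1 r2) k1K).
  by apply: H2; exact: (KO_le OP (leq_maxr r1 r2) k2K).
have [p0|/hr] := eqVneq (psi y) 0; last exact.
have [pa0|] := eqVneq (psi (act2 h1 h2 y)) 0; first by rewrite p0 pa0.
by move=> /(hr _ _ _ (KOV h1K) (KOV h2K)); rewrite act2K.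
Qed.

Lemma blk_invariant_le r r' psi : (r <= r')%N -> blk_invariant (KO r) psi ->
  blk_invariant (KO r') psi.
Proof. by move=> rr h h1 h2 y hK; apply: h; exact: (KO_le OP rr hK). Qed.

(** With D = [blk h1 h2], translation by D turns the left-hand function into the one induced from
    psi by J = D (KO r) D^-1. Decomposed under [KO r'], it is a sum of N translates of the function
    induced at level r', on which xi takes equal values. N counts classes in J, not depending on
    psi. *)
Lemma ind_ratio r r' (h1 : GLinear F n1) (h2 : GLinear F n2) :
  (forall g, KO r g -> KO 0 (blk h1 h2 * g * (blk h1 h2)^-1)%g) ->
  (forall g, KO r' g -> KO r ((blk h1 h2)^-1 * g * blk h1 h2)%g) ->
  exists2 N, (0 < N)%N & forall psi, psi \in S12 ->
    blk_invariant (KO r) (fun y => psi (act2 h1 h2 y)) -> blk_invariant (KO r') psi ->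
    ev xi (ind (KO r) (fun y => psi (act2 h1 h2 y))) = N%:R * ev xi (ind (KO r') psi).
Proof.
move=> hr hr'; pose D := blk h1 h2.
have sK := KO_subgroup OP n1 n2; pose J := [set g | KO r (D^-1 * g * D)%g].
have sJ : subgroup J.
  split; rewrite /J /=.
  - by rewrite mulg1 mulVg; exact: (sg1 (sK r)).
  - move=> g k gJ kJ; rewrite (_ : (D^-1 * (g * k) * D = (D^-1 * g * D) * (D^-1 * k * D))%g).
      exact: (sgM (sK r)).
    by rewrite !mulgA mulgK.
  - move=> g gJ; rewrite (_ : (D^-1 * g^-1 * D = (D^-1 * g * D)^-1)%g).
      exact: (sgV (sK r)).
    by rewrite !invgM invgK mulgA.
have KJ : KO r' `<=` J by move=> g /hr'.
have JK : J `<=` KO 0.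
  move=> g /hr; rewrite -/D (_ : (D * (D^-1 * g * D) * D^-1 = g)%g) //.
  by rewrite !mulgA mulgV mul1g mulgK.
have [s [s0 sJ' dec]] := ind_decomposition char2 OP R p sJ KJ JK.
exists (size s) => // psi pS pinv pinv'.
pose psih y := psi (act2 h1 h2 y).
have phS : psih \in S12 by exact: schwartz_act2.
have iS := ind_schwartz char2 OP p phS pinv.
have iS' := ind_schwartz char2 OP p pS pinv'.
pose Phi x := ind (KO r) psih (D^-1%g *a x).
have PhiS : Phi \in @schwartz R X by exact: schwartz_act.
have PhiE k y : J k -> slice y -> Phi (k *a emb y) = psi y.
  move=> Jk sy; rewrite /Phi -[y in LHS](act2K h1^-1%g h2^-1%g) !invgK.
  set z := act2 h1^-1%g h2^-1%g y.
  rewrite emb_act2 -/D -!act_mul.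
  rewrite (indE char2 OP (y := z) (sK r) pinv).
    by rewrite /psih /z -{2}[y](act2K h1^-1%g h2^-1%g) !invgK.
  by exists (D^-1 * k * D)%g; split; [exact: Jk | apply/slice_act2 | ].
have PhiK k x : KO r' k -> Phi (k *a x) = Phi x.
  move=> kK; rewrite /Phi.
  rewrite (_ : D^-1%g *a (k *a x) = (D^-1 * k * D)%g *a (D^-1%g *a x)).
    have pinvh : blk_invariant (KO r) psih by exact: pinv.
    exact: (ind_act char2 OP p _ (sK r) pinvh (hr' _ kK)).
  by rewrite -!act_mul mulgK.
have Phisupp x : Phi x != 0 -> exists y, on_slice O pi p J x y.
  move=> /ind_neq0[y [k [kK sy xE]] _]; exists (act2 h1 h2 y), (D * k * D^-1)%g.
  split; [|by apply/slice_act2|].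
  - by rewrite /J /= !mulgA mulVg mul1g mulgVK.
  - by rewrite emb_act2 -/D -!act_mul mulgVK act_mul -xE act_invK.
have <- : ev xi Phi = ev xi (ind (KO r) psih).
  by rewrite (ev_act (GLt D^-1%g false) iS) /chi expr0 mul1r.
have PhiE2 : Phi = fun x => \sum_(k <- s) ind (KO r') psi (k^-1%g *a x).
  apply/funext => x; rewrite (dec Phi PhiK Phisupp) big_seq [RHS]big_seq.
  apply: eq_bigr => k ks; congr (_ _); apply: eq_ind => y sy.
  by apply: PhiE => //; exact: sJ'.
rewrite PhiE2 (ev_sum xi s (f := fun k x => ind (KO r') psi (k^-1%g *a x)) _).2.
  rewrite (eq_bigr (fun=> ev xi (ind (KO r') psi))).
    by rewrite big_const_seq iter_addr_0 count_predT mulr_natl.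
  by move=> k _; rewrite (ev_act (GLt k^-1%g false) iS') /chi expr0 mul1r.
by move=> k; exact: (schwartz_act (GLt k^-1%g false)).
Qed.

End DescentFunctional.

(** * The functional on pairs of smaller triples *)

Section SliceFunctional.
Variables (F : localFieldType) (O : set F) (pi : F).
Hypothesis char2 : 2%N \in [pchar F].
Hypothesis OP : integer_ring O pi.
Variables (R : realType) (n1 n2 : nat) (p : {poly F}).
Local Notation X12 := (triple F n1 * triple F n2)%type.
Local Notation X := (triple F (n1 + n2)).
Local Notation KO := (KO O pi).
Local Notation ind := (@ind F O pi R n1 n2 p).
Local Notation S12 := (@schwartz R X12).
Local Notation "g *a x" := (act (GLt g false) x) (at level 40, left associativity).
Variable xi : distribution R X.
Hypothesis xi_eq : equivariant xi.
Implicit Types (psi : X12 -> R[i]) (y : X12) (x : X).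

Let D r psi := ev xi (ind (KO r) psi).
Let sK r : subgroup (KO r) := KO_subgroup OP n1 n2 r.

Lemma ev_ind_ratio r r' : (r <= r')%N -> exists2 N, (0 < N)%N & forall psi, psi \in S12 ->
  blk_invariant (KO r) psi -> D r psi = N%:R * D r' psi.
Proof.
move=> rr'.
have [||N N0 HN] := @ind_ratio F O pi char2 OP R n1 n2 p xi xi_eq r r' 1%g 1%g.
- by move=> g gK; rewrite blk1 mul1g invg1 mulg1; exact: (KO_le OP (leq0n r)).
- by move=> g gK; rewrite blk1 mulg1 invg1 mul1g; exact: (KO_le OP rr').
exists N => // psi pS pinv; have := HN psi pS.
rewrite (_ : (fun y => psi (act2 1%g 1%g y)) = psi); last first.
  by apply/funext => y; rewrite act2_1.
by apply => //; exact: blk_invariant_le rr' pinv.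
Qed.

Lemma tau_emb k y : act (tau F (n1 + n2)) (k *a emb y) = GLtrV k *a emb (tau2 y).
Proof. by rewrite emb_tau2 -!actM tau_mul. Qed.

Lemma blk_invariant_tau2 r psi : blk_invariant (KO r) psi ->
  blk_invariant (KO r) (fun y => psi (tau2 y)).
Proof.
move=> pinv h1 h2 y hK; rewrite tau2_act2 pinv// -GLtrV_blk; exact: (KO_trV hK).
Qed.

Lemma ev_ind_tau2 r psi : psi \in S12 -> blk_invariant (KO r) psi ->
  D r (fun y => psi (tau2 y)) = - D r psi.
Proof.
move=> pS pinv; rewrite /D.
rewrite (_ : ind _ _ = fun x => ind (KO r) psi (act (tau F (n1 + n2)) x)).
  by rewrite (ev_act xi_eq) ?mulN1r //; exact: (ind_schwartz char2 OP).
apply/funext => x.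
have tauP z y : on_slice O pi p (KO r) z y ->
    on_slice O pi p (KO r) (act (tau F (n1 + n2)) z) (tau2 y).
  move=> [k [kK sy ->]]; exists (GLtrV k).
  by split; [exact: (KO_trV kK) | apply/slice_tau2 | exact: tau_emb].
have [[y xy]|nex] := pselect (exists y, on_slice O pi p (KO r) x y).
  by rewrite (indE char2 OP (sK r) (blk_invariant_tau2 pinv) xy)
     (indE char2 OP (sK r) pinv (tauP _ _ xy)).
rewrite !ind0 // => -[y /tauP]; rewrite -actM tau_tau act1 => xy.
by apply: nex; exists (tau2 y).
Qed.

Lemma blk_invariant_act2 r psi (k1 : GLinear F n1) (k2 : GLinear F n2) :
  KO 0 k1 -> KO 0 k2 -> blk_invariant (KO r) psi ->
  blk_invariant (KO r) (fun y => psi (act2 k1 k2 y)).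
Proof.
move=> k1K k2K pinv h1 h2 y hK; rewrite -act2M.
rewrite -[(k1 * h1)%g](mulgVK k1) -[(k2 * h2)%g](mulgVK k2) act2M pinv//.
by rewrite -!blkM -blkV; apply: (KO_norm OP) => //; exact: (KO_blk OP).
Qed.

Lemma ev_ind_KO0 r psi (k1 : GLinear F n1) (k2 : GLinear F n2) : KO 0 k1 -> KO 0 k2 ->
  psi \in S12 -> blk_invariant (KO r) psi -> D r (fun y => psi (act2 k1 k2 y)) = D r psi.
Proof.
move=> k1K k2K pS pinv; rewrite /D.
have pinv' := blk_invariant_act2 k1K k2K pinv.
have bK := KO_blk OP k1K k2K.
rewrite (_ : ind _ _ = fun x => ind (KO r) psi (blk k1 k2 *a x)).
  rewrite (ev_act xi_eq) ?mul1r //; exact: (ind_schwartz char2 OP).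
apply/funext => x.
have [[y [u [uK sy xE]]]|nex] := pselect (exists y, on_slice O pi p (KO r) x y).
  rewrite (indE char2 OP (y := y) (sK r) pinv'); last by exists u.
  rewrite (indE char2 OP (y := act2 k1 k2 y) (sK r) pinv) //.
  exists (blk k1 k2 * u * (blk k1 k2)^-1)%g; split.
  - exact: (KO_norm OP).
  - by apply/slice_act2.
  - by rewrite emb_act2 xE !act_mul act_inv.
rewrite !ind0 // => -[y [u [uK sy xE]]]; apply: nex.
exists (act2 k1^-1%g k2^-1%g y), ((blk k1 k2)^-1 * u * (blk k1 k2)^-1^-1)%g; split.
- by apply: (KO_norm OP) => //; exact: KOV.
- by apply/slice_act2.
- by rewrite emb_act2 -blkV !act_mul act_inv -xE act_inv.
Qed.

Lemma slice_functional : (exists psi r, [/\ psi \in S12, blk_invariant (KO r) psi &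
    D r psi != 0]) ->
  exists eta : distribution R X12, [/\ exists f, eta f != 0,
    forall (h1 : GLinear F n1) (h2 : GLinear F n2) (f g : testFun R X12),
      (forall y, g y = f (act2 h1 h2 y)) -> eta g = eta f &
    forall f g : testFun R X12, (forall y, g y = f (tau2 y)) -> eta g = - eta f].
Proof.
move=> [psi0 [r0 [p0S p0inv p0nz]]].
have p0D r : (r0 <= r)%N -> D r psi0 != 0.
  move=> /ev_ind_ratio[N _ HN]; apply: contraNneq p0nz => e.
  by rewrite (HN psi0) // e mulr0.
(* Some level at which psi is block invariant, with default 0 when there is none. *)
pose rr psi := xget 0%N [set r | blk_invariant (KO r) psi].
have rrP psi : psi \in S12 -> blk_invariant (KO (rr psi)) psi.
  move=> /(schwartz_blk_invariant OP)[r hr].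
  have ex : exists r, [set r | blk_invariant (KO r) psi] r by exists r.
  exact: (xgetPex 0%N ex).
(* The quotient cancels the integer relating two levels; by [EE] every level that is at least r0 and
   fits psi gives the same number. *)
pose E psi := let r := maxn r0 (rr psi) in D r psi / D r psi0.
have EE psi r : psi \in S12 -> (r0 <= r)%N -> blk_invariant (KO r) psi ->
    E psi = D r psi / D r psi0.
  have step r1 r2 : (r0 <= r1)%N -> (r1 <= r2)%N -> psi \in S12 ->
      blk_invariant (KO r1) psi -> D r1 psi / D r1 psi0 = D r2 psi / D r2 psi0.
    move=> r01 r12 pS pinv; have [N N0 HN] := ev_ind_ratio r12.
    rewrite (HN psi)// (HN psi0)//; last exact: (blk_invariant_le OP r01 p0inv).
    by rewrite -mulf_div divff ?mul1r// pnatr_eq0 -lt0n.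
  move=> pS r0r pinv; pose r' := maxn r0 (rr psi).
  have p'inv : blk_invariant (KO r') psi.
    exact: (blk_invariant_le OP (leq_maxr _ _) (rrP _ pS)).
  rewrite (step r (maxn r r'))// ?leq_maxl//.
  by apply: step => //; rewrite ?leq_maxr ?leq_maxl.
have invex (l : seq (X12 -> R[i])) : (forall f, f \in l -> f \in S12) ->
    forall m, exists r, [/\ (r0 <= r)%N, (m <= r)%N &
      forall f, f \in l -> blk_invariant (KO r) f].
  elim: l => [|f l IH] lS m; first by exists (maxn r0 m); rewrite leq_maxl leq_maxr.
  have [|r [r0r mr hr]] := IH _ m; first by move=> g gl; apply: lS; rewrite inE gl orbT.
  have fS : f \in S12 by apply: lS; exact: mem_head.
  exists (maxn r (rr f)); split.
  - exact: leq_trans r0r (leq_maxl _ _).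
  - exact: leq_trans mr (leq_maxl _ _).
  - move=> g; rewrite inE => /orP[/eqP ->|/hr]; last first.
      exact: (blk_invariant_le OP (leq_maxl _ _)).
    exact: (blk_invariant_le OP (leq_maxr _ _) (rrP _ fS)).
have E_lin a f g : f \in S12 -> g \in S12 -> E (fun y => a * f y + g y) = a * E f + E g.
  move=> fS gS; have hS := schwartz_lin a fS gS.
  have [|r [r0r _ hr]] := invex [:: f; g] _ 0%N.
    by move=> h; rewrite !in_cons in_nil orbF => /orP[] /eqP ->.
  have finv : blk_invariant (KO r) f by apply: hr; rewrite inE eqxx.
  have ginv : blk_invariant (KO r) g by apply: hr; rewrite !inE eqxx orbT.
  rewrite (EE _ r)//; last by move=> h1 h2 y hK; rewrite finv // ginv.
  rewrite (EE f r)// (EE g r)// mulrA -mulrDl; congr (_ / _).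
  rewrite /D -(ev_lin xi a (ind_schwartz char2 OP p fS finv)
    (ind_schwartz char2 OP p gS ginv)).
  congr (ev _ _); apply/funext => x; rewrite /ind.
  by case: pselect => // _; rewrite mulr0 addr0.
have E_tau f : f \in S12 -> E (fun y => f (tau2 y)) = - E f.
  move=> fS; have [|r [r0r _ hr]] := invex [:: f] _ 0%N.
    by move=> h; rewrite mem_seq1 => /eqP ->.
  have finv : blk_invariant (KO r) f by apply: hr; rewrite inE.
  rewrite (EE _ r (schwartz_tau2 fS) r0r (blk_invariant_tau2 finv)) (EE f r)//.
  by rewrite ev_ind_tau2// mulNr.
have E0 : E psi0 = 1 by rewrite (EE psi0 r0)// divff.
have E_act (h1 : GLinear F n1) (h2 : GLinear F n2) : exists2 c : R[i], 0 < c &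
    forall f, f \in S12 -> E (fun y => f (act2 h1 h2 y)) = c * E f.
  have [a Ha] := KO_conj OP (blk h1 h2); have [b Hb] := KO_conj OP (blk h1 h2)^-1%g.
  (* The working level depends on f. Treating f together with psi0, where E is 1, identifies the
     scalar with E of the translate of psi0, which is the same for all f. *)
  suff H f : f \in S12 -> exists2 c : R[i], 0 < c & E (fun y => f (act2 h1 h2 y)) = c * E f
      /\ E (fun y => psi0 (act2 h1 h2 y)) = c.
    have [c c0 [_ cE]] := H psi0 p0S.
    by exists c => // f /H[c' _ [-> <-]]; rewrite cE.
  move=> fS; pose fh y := f (act2 h1 h2 y); pose p0h y := psi0 (act2 h1 h2 y).
  have fhS : fh \in S12 by exact: schwartz_act2.
  have p0hS : p0h \in S12 by exact: schwartz_act2.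
  have [|r [r0r ar hr]] := invex [:: fh; p0h; f; psi0] _ a.
    by move=> h; rewrite !in_cons in_nil orbF => /or4P[] /eqP ->.
  have finv : blk_invariant (KO r) f by apply: hr; rewrite !inE eqxx !orbT.
  have fhinv : blk_invariant (KO r) fh by apply: hr; rewrite !inE eqxx.
  have p0hinv : blk_invariant (KO r) p0h by apply: hr; rewrite !inE eqxx orbT.
  have p0inv' : blk_invariant (KO r) psi0 by apply: hr; rewrite !inE eqxx !orbT.
  have rbr : (r <= b + r)%N := leq_addl _ _.
  have r0br := leq_trans r0r rbr.
  have [||N N0 HN] := @ind_ratio F O pi char2 OP R n1 n2 p xi xi_eq r (b + r) h1 h2.
  - by move=> g gK; apply: Ha; rewrite addn0; exact: (KO_le OP ar).
  - by move=> g gK; have := Hb r g gK; rewrite invgK.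
  have [N1 N10 HN1] := ev_ind_ratio rbr.
  have finv2 := blk_invariant_le OP rbr finv.
  have p0inv2 := blk_invariant_le OP rbr p0inv'.
  have N1nz : N1%:R != 0 :> R[i] by rewrite pnatr_eq0 -lt0n.
  (* Going from level r to b + r, the numerator changes by N and the denominator by N1. *)
  have key h : h \in S12 -> (fun y => h (act2 h1 h2 y)) \in S12 ->
      blk_invariant (KO r) (fun y => h (act2 h1 h2 y)) -> blk_invariant (KO r) h ->
      E (fun y => h (act2 h1 h2 y)) = N%:R / N1%:R * E h.
    move=> hS hhS hhinv hinv; rewrite (EE _ r)// (EE h (b + r))//; last first.
      exact: (blk_invariant_le OP rbr hinv).
    rewrite (HN1 psi0)// /D HN//; last exact: (blk_invariant_le OP rbr hinv).
    by rewrite -mulf_div.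
  exists (N%:R / N1%:R); first by rewrite divr_gt0 ?ltr0n.
  by split; [exact: key | rewrite key// E0 mulr1].
pose Pc (h1 : GLinear F n1) (h2 : GLinear F n2) :=
  forall f, f \in S12 -> E (fun y => f (act2 h1 h2 y)) = E f.
have PcM (h1 k1 : GLinear F n1) (h2 k2 : GLinear F n2) :
    Pc h1 h2 -> Pc k1 k2 -> Pc (h1 * k1)%g (h2 * k2)%g.
  move=> P1 P2 f fS; rewrite -(P1 f fS) -(P2 _ (schwartz_act2 h1 h2 fS)).
  by congr E; apply/funext => y; rewrite act2M.
have Pc_KO (k1 : GLinear F n1) (k2 : GLinear F n2) : KO 0 k1 -> KO 0 k2 -> Pc k1 k2.
  move=> k1K k2K f fS.
  have [|r [r0r _ hr]] := invex [:: f] _ 0%N.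
    by move=> h; rewrite mem_seq1 => /eqP ->.
  have finv : blk_invariant (KO r) f by apply: hr; rewrite inE.
  rewrite (EE _ r (schwartz_act2 k1 k2 fS) r0r (blk_invariant_act2 k1K k2K finv)).
  by rewrite (EE f r)// ev_ind_KO0.
(* The positive character [c] describing the action on [E] is invariant under
   the inverse transpose, hence trivial on diagonal matrices. *)
have Pc_trV (h1 : GLinear F n1) (h2 : GLinear F n2) :
    (GLtrV h1 = h1^-1)%g -> (GLtrV h2 = h2^-1)%g -> Pc h1 h2.
  move=> t1 t2; have [c c0 Hc] := E_act h1 h2; have [c' c'0 Hc'] := E_act h1^-1%g h2^-1%g.
  have cc' : c * c' = 1.
    have := Hc' _ (schwartz_act2 h1 h2 p0S); rewrite Hc// E0 mulr1 mulrC => <-.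
    rewrite -E0; congr E; apply/funext => y.
    by rewrite -act2M !mulgV act2_1.
  (* By assumption [tau2] carries (h1, h2) to its inverse. Applying [tau2] before or after the group
     element gives -c in one order and -c' in the other. *)
  have cE : c = c'.
    have := E_tau _ (schwartz_act2 h1 h2 p0S); rewrite Hc// E0 mulr1.
    rewrite (_ : (fun y => psi0 (act2 h1 h2 (tau2 y))) =
        fun y => psi0 (tau2 (act2 h1^-1%g h2^-1%g y))); last first.
      apply/funext => y; rewrite tau2_act2; congr (psi0 (act2 _ _ _)).
        by rewrite -t1; apply/val_inj; rewrite /= trmx_inv trmxK invmxK.
      by rewrite -t2; apply/val_inj; rewrite /= trmx_inv trmxK invmxK.
    rewrite (Hc' _ (schwartz_tau2 p0S)) E_tau// E0 mulrN1 => /eqP.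
    by rewrite eqr_opp => /eqP.
  have c1 : c = 1.
    move: cc'; rewrite -cE => /eqP; rewrite -expr2 sqrf_eq1 => /orP[/eqP//|/eqP cN].
    by move: c0; rewrite cN oppr_gt0 ltr10.
  by move=> f fS; rewrite Hc// c1 mul1r.
have diag_trV m (g : GLinear F m) : is_diag_mx (Defs.GLval g) -> (GLtrV g = g^-1)%g.
  move=> gd; apply/val_inj => /=; congr invmx.
  apply/matrixP => i j; rewrite mxE; have [->//|ij] := eqVneq i j.
  by move/is_diag_mxP: gd => gd; rewrite !gd// eq_sym.
have trV1 m : (GLtrV (1 : GLinear F m) = 1^-1)%g.
  by rewrite invg1; exact: (@sign_act1 F m true).
have Pc1 (h1 : GLinear F n1) : Pc h1 1%g.
  apply: (GL_generated OP (P := fun h1 => Pc h1 1%g)) => {h1} [h hK|h k hP kP|h hd].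
  - by apply: Pc_KO => //; exact: (KO1 OP).
  - by rewrite -[X in Pc _ X]mulg1; exact: PcM.
  - by apply: Pc_trV => //; exact: diag_trV.
have Pc2 (h2 : GLinear F n2) : Pc 1%g h2.
  apply: (GL_generated OP (P := fun h2 => Pc 1%g h2)) => {h2} [h hK|h k hP kP|h hd].
  - by apply: Pc_KO => //; exact: (KO1 OP).
  - by rewrite -[X in Pc X _]mulg1; exact: PcM.
  - by apply: Pc_trV => //; exact: diag_trV.
have Pcall (h1 : GLinear F n1) (h2 : GLinear F n2) : Pc h1 h2.
  by rewrite -[h1]mulg1 -[h2]mul1g; exact: PcM.
pose eta (f : testFun R X12) : R[i] := E f.
have eta_lin : linear_for *%R eta.
  move=> a f g; rewrite /eta -E_lin ?testFunP//.
pose etaL : distribution R X12 := HB.pack eta (GRing.isLinear.Build _ _ _ _ eta eta_lin).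
exists etaL; split.
- by exists (TestFun p0S); rewrite /= /eta E0 oner_eq0.
- move=> h1 h2 f g gE.
  exact: (etrans (congr1 E (funext gE)) (Pcall h1 h2 f (testFunP f))).
- move=> f g gE.
  exact: (etrans (congr1 E (funext gE)) (E_tau f (testFunP f))).
Qed.

End SliceFunctional.

(** * Distributions on a product *)

Section Coinvariants.
Variables (F : localFieldType) (R : realType).
Local Notation T m := (tau F m).

(** The difference of zeta and its transpose is equivariant for [chi], so the hypothesis makes it
    vanish. *)
Lemma transposition_invariance m (zeta : distribution R (triple F m)) :
  (forall z : distribution R (triple F m), equivariant z -> forall f, z f = 0) ->
  (forall g f, zeta (translate (GLt g false) f) = zeta f) ->
  forall f, zeta (translate (T m) f) = zeta f.
Proof.
move=> hyp inv f.
have trM h k (f' : testFun R (triple F m)) :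
    translate (h * k)%g f' = translate k (translate h f').
  by apply: testFun_inj => x; rewrite /= -actM.
pose z (f : testFun R (triple F m)) := zeta f - zeta (translate (T m) f).
have z_lin : linear_for *%R z.
  move=> a f1 f2; rewrite /z.
  rewrite (_ : translate _ _ = a *: translate (T m) f1 + translate (T m) f2).
    by rewrite (linearP zeta a f1) (linearP zeta a (translate (T m) f1)) /=
      mulrBr opprD addrACA.
  exact: testFun_inj.
pose zL : distribution R (triple F m) := HB.pack z (GRing.isLinear.Build _ _ _ _ z z_lin).
apply/eqP; rewrite eq_sym -subr_eq0; apply/eqP; apply: (hyp zL).
move=> h f'; rewrite (GLtE h).
have zG g f1 : z (translate (GLt g false) f1) = z f1.
  rewrite /z inv -trM (_ : (GLt g false * T m = T m * GLt (GLtrV g) false)%g).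
    by rewrite trM inv.
  rewrite tau_mul; congr (GLt _ false * _)%g.
  by apply/val_inj; rewrite /= trmx_inv trmxK invmxK.
rewrite trM /chi; case: (GLt_sign h) => /=; last first.
  rewrite (_ : translate 1%g _ = translate (GLt (GLt_lin h) false) f').
    by rewrite expr0 mul1r zG.
  by apply: testFun_inj => x; rewrite /= act1.
have TT f1 : translate (T m) (translate (T m) f1) = f1.
  by apply: testFun_inj => x; rewrite /= -actM tau_tau act1.
by rewrite expr1 mulN1r -[in RHS](zG (GLt_lin h)) /z TT opprB.
Qed.

End Coinvariants.

Section Tensor.
Variables (R : realType) (X1 X2 : topologicalType).

Lemma schwartz_tensor (f : X1 -> R[i]) (g : X2 -> R[i]) :
  hausdorff_space (X1 * X2)%type ->
  f \in @schwartz R X1 -> g \in @schwartz R X2 ->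
  (fun y => f y.1 * g y.2) \in @schwartz R (X1 * X2)%type.
Proof.
move=> hX fS gS.
apply: (schwartz_near hX (compact_setX (schwartz_compact fS) (schwartz_compact gS))).
  move=> [x1 x2] /=; rewrite mulf_eq0 negb_or => /andP[nf ng].
  by split; exact: fsupport_neq0.
move=> [x1 x2] /=.
exists ([set y | f y = f x1], [set y | g y = g x2]) => /=.
  by split; [exact: (schwartz_lc fS x1) | exact: (schwartz_lc gS x2)].
by move=> [y1 y2] [/= -> ->].
Qed.

End Tensor.

Section ProductVanishing.
Variables (F : localFieldType) (O : set F) (pi : F) (R : realType) (n1 n2 : nat).
Hypothesis OP : integer_ring O pi.
Local Notation X12 := (triple F n1 * triple F n2)%type.
Variable eta : distribution R X12.
Hypothesis hyp1 : forall z : distribution R (triple F n1), equivariant z -> forall f, z f = 0.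
Hypothesis hyp2 : forall z : distribution R (triple F n2), equivariant z -> forall f, z f = 0.
Hypothesis eta_act : forall (h1 : GLinear F n1) (h2 : GLinear F n2) (f g : testFun R X12),
  (forall y, g y = f (act2 h1 h2 y)) -> eta g = eta f.
Hypothesis eta_tau : forall f g : testFun R X12,
  (forall y, g y = f (tau2 y)) -> eta g = - eta f.

Let E1 := triple_ball O pi (m := n1).
Let E2 := triple_ball O pi (m := n2).
Let BE := ball_structure_prod (ball_structure_triple OP n1) (ball_structure_triple OP n2).

Definition tensor (f : testFun R (triple F n1)) (g : testFun R (triple F n2)) :
    testFun R X12 :=
  TestFun (schwartz_tensor (bs_hausdorff BE) (testFunP f) (testFunP g)).

Lemma eta_tensor f g : eta (tensor f g) = 0.
Proof.
have t1 (f' : testFun R (triple F n1)) (g' : testFun R (triple F n2)) :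
    eta (tensor (translate (tau F n1) f') g') = eta (tensor f' g').
  pose z (f : testFun R (triple F n1)) := eta (tensor f g').
  have z_lin : linear_for *%R z.
    move=> a f1 f2; rewrite /z -linearP; congr (eta _); apply: testFun_inj => y.
    rewrite -[LHS]/((a * f1 y.1 + f2 y.1) * g' y.2).
    by rewrite -[RHS]/(a * (f1 y.1 * g' y.2) + f2 y.1 * g' y.2) mulrDl mulrA.
  pose zL : distribution R (triple F n1) := HB.pack z (GRing.isLinear.Build _ _ _ _ z z_lin).
  apply: (@transposition_invariance F R n1 zL hyp1) => k f1.
  apply: (@eta_act k 1%g) => -[y1 y2] /=; congr (_ * g' _).
  by rewrite -[LHS]act1.
have t2 (f' : testFun R (triple F n1)) (g' : testFun R (triple F n2)) :
    eta (tensor f' (translate (tau F n2) g')) = eta (tensor f' g').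
  pose z (g : testFun R (triple F n2)) := eta (tensor f' g).
  have z_lin : linear_for *%R z.
    move=> a f1 f2; rewrite /z -linearP; congr (eta _); apply: testFun_inj => y.
    rewrite -[LHS]/(f' y.1 * (a * f1 y.2 + f2 y.2)).
    by rewrite -[RHS]/(a * (f' y.1 * f1 y.2) + f' y.1 * f2 y.2) mulrDr mulrCA.
  pose zL : distribution R (triple F n2) := HB.pack z (GRing.isLinear.Build _ _ _ _ z z_lin).
  apply: (@transposition_invariance F R n2 zL hyp2) => k f1.
  apply: (@eta_act 1%g k) => -[y1 y2] /=; congr (f' _ * _).
  by rewrite -[LHS]act1.
have : eta (tensor (translate (tau F n1) f) (translate (tau F n2) g)) = - eta (tensor f g).
  exact: eta_tau.
rewrite t1 t2 => /eqP; rewrite -addr_eq0 -mulr2n mulrn_eq0 /= => /eqP //.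
Qed.

(** Tensors of ball indicators span the test functions: cover the support by finitely many balls on
    which f is constant. Subtracting f c times the indicator of the ball of c, which is a tensor,
    clears that ball and shortens the cover. *)
Lemma eta_eq0 f : eta f = 0.
Proof.
have [s Hs] := schwartz_unif BE (testFunP f).
have [L HL] := bs_cover BE s (schwartz_compact (testFunP f)).
have {HL} : forall x, f x != 0 -> exists2 c, c \in L & prod_ball E1 E2 s c x.
  by move=> x /fsupport_neq0; exact: HL.
elim: L f Hs => [|c L IH] f Hs HL.
  rewrite (_ : f = 0) ?linear0//; apply: testFun_inj => x.
  by apply/eqP; apply: contraT => /HL[].
pose i1 : testFun R (triple F n1) := TestFun (bs_indic (ball_structure_triple OP n1) R
  (@compact_triple_ball _ _ _ OP _ s c.1)).
pose i2 : testFun R (triple F n2) := TestFun (bs_indic (ball_structure_triple OP n2) R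
  (@compact_triple_ball _ _ _ OP _ s c.2)).
have iE x : tensor i1 i2 x = (`[< prod_ball E1 E2 s c x >])%:R.
  rewrite /= -natrM mulnb; congr (nat_of_bool _)%:R.
  by apply/andP/asboolP => -[/asboolP h1 /asboolP h2].
have iinv x y : prod_ball E1 E2 s x y -> tensor i1 i2 x = tensor i1 i2 y.
  move=> xy; rewrite !iE; congr (nat_of_bool _)%:R; apply/asbool_equiv_eq; split => h.
    exact: bs_trans BE _ _ _ _ h xy.
  exact: bs_trans BE _ _ _ _ h (bs_sym BE xy).
pose f' := (- f c) *: tensor i1 i2 + f.
have f'E x : f' x = - f c * tensor i1 i2 x + f x by [].
have : eta f' = 0.
  apply: IH => [x y xy|x]; first by rewrite !f'E (iinv x y)// (Hs x y).
  rewrite f'E iE; case: asboolP => [cx|ncx].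
    by rewrite -(Hs _ _ cx) mulr1 addNr eqxx.
  rewrite mulr0 add0r => /HL[c']; rewrite in_cons => /orP[/eqP -> //|c'L c'x].
  by exists c'.
by rewrite /f' linearP eta_tensor /= mulr0 add0r.
Qed.

End ProductVanishing.

(** * Supports of equivariant distributions *)

Section Transport.
Variables (R : realType) (X : topologicalType) (a b : X -> X).
Hypotheses (ac : continuous a) (bc : continuous b) (aK : cancel a b) (bK : cancel b a).

Definition pullback (Phi : testFun R X) : testFun R X :=
  TestFun (schwartz_comp ac bc aK Phi).

Lemma vanishes_at_transport (xi xi' : distribution R X) (c : R[i]) x :
  (forall Phi, xi (pullback Phi) = c * xi' Phi) ->
  vanishes_at xi' (a x) -> vanishes_at xi x.
Proof.
move=> xiE [U [oU vU] Uax]; exists (a @^-1` U) => //.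
split; first by apply: open_comp oU => y _; exact: ac.
move=> Phi sPhi; pose Phi' := TestFun (schwartz_comp bc ac bK Phi).
rewrite (_ : Phi = pullback Phi'); last by apply: testFun_inj => y /=; rewrite aK.
rewrite xiE vU ?mulr0// => y hy; rewrite -(bK y); apply: sPhi => B /bc /hy[z [/= nz Bz]].
by exists (b z).
Qed.

End Transport.

Section Supports.
Variables (F : localFieldType) (O : set F) (pi : F).
Hypothesis char2 : 2%N \in [pchar F].
Hypothesis OP : integer_ring O pi.
Variable R : realType.
Local Notation "g *a x" := (act (GLt g false) x) (at level 40, left associativity).

Definition no_equivariant m := forall z : distribution R (triple F m), equivariant z ->
  forall f, z f = 0.

Lemma vanishes_at_act n (xi : distribution R (triple F n)) h x : equivariant xi ->
  vanishes_at xi (act h x) -> vanishes_at xi x.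
Proof.
move=> xi_eq.
have hK : cancel (act h^-1%g) (act h) by move=> y; rewrite -actM mulgV act1.
apply: (vanishes_at_transport (ac := @act_continuous F n h)
  (bc := @act_continuous F n h^-1%g) (aK := actK h) hK) => Phi.
exact: (xi_eq h Phi).
Qed.

Lemma cpball0 n : cpball O pi (0 : 'M[F]_n).
Proof.
move=> i im; rewrite /char_poly /char_poly_mx map_mx0 subr0 det_scalar coefXn.
by rewrite (ltn_eqF im); exact: (fball_zero OP).
Qed.

(** All induced functions are killed by xi, and [ind_decomposition] writes a test function supported
    near the point as a sum of translates of induced ones. *)
Lemma block_vanishes n1 n2 p (xi : distribution R (triple F (n1 + n2))) A v phi :
  no_equivariant n1 -> no_equivariant n2 -> equivariant xi ->
  peval p A = block_mx 1%:M 0 0 0 -> vanishes_at xi (A, v, phi).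
Proof.
move=> hyp1 hyp2 xi_eq pA.
have ind_eq0 r psi : psi \in @schwartz R _ -> blk_invariant (KO O pi r) psi ->
    ev xi (ind O pi p (KO O pi r) psi) = 0.
  move=> pS pinv; apply/eqP; apply: contraT => nz.
  have [|eta [[f nf] eact etau]] := slice_functional char2 OP (p := p) xi_eq.
    by exists psi, r.
  by rewrite (eta_eq0 OP hyp1 hyp2 eact etau) eqxx in nf.
have [A12 A21] : ursubmx A = 0 /\ dlsubmx A = 0.
  have : A *m peval p A = peval p A *m A by apply/esym/peval_comm.
  rewrite pA -[A]submxK !mulmx_block !mulmx0 !mul0mx !mulmx1 !mul1mx !addr0.
  by move=> /eq_block_mx[_ e1 e2 _]; rewrite block_mxKur block_mxKdl.
pose y0 := unemb (A, v, phi).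
have y0E : emb y0 = (A, v, phi) by rewrite unembK.
have sy0 : slice O pi p y0.
  have := pA; rewrite -[A]submxK A12 A21 peval_block => /eq_block_mx[e1 _ _ e2].
  by rewrite /slice /= e1 e2 subrr; split; exact: cpball0.
have [so _] := slice_clopen OP n1 n2 p.
have nW := slice_open_image char2 OP 0 sy0 (open_nbhs_nbhs (conj so sy0)).
rewrite y0E in nW.
apply: vanishes_atP; eexists; first exact: nW.
move=> Phi /= PhiW.
have [r Hr] := schwartz_KO OP (testFunP Phi).
have sK := KO_subgroup OP n1 n2.
have KK : @KO F O pi (n1 + n2) r `<=` KO O pi 0 by move=> g; exact: (KO_le OP (leq0n r)).
have [s [_ sJ /(_ Phi Hr) dec]] :=
  ind_decomposition char2 OP R p (sK 0) KK (@subset_refl _ _).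
have supp x : Phi x != 0 -> exists y, on_slice O pi p (KO O pi 0) x y.
  by move=> /PhiW[k [y [kK sy xE]]]; exists y, k.
pose psi (k : GLinear F (n1 + n2)) y := Phi (k *a emb y).
have psiS k : psi k \in @schwartz R _.
  pose Pk := translate (GLt k false) Phi.
  have BE := ball_structure_prod (ball_structure_triple OP n1) (ball_structure_triple OP n2).
  apply: (schwartz_near (bs_hausdorff BE) (continuous_compact
    (continuous_subspaceT (@unemb_continuous F n1 n2)) (schwartz_compact (testFunP Pk)))).
    by move=> y nz; exists (emb y); [exact: fsupport_neq0 | rewrite embK].
  move=> y; exact: (@emb_continuous F n1 n2 y _ (schwartz_lc (testFunP Pk) (emb y))).
have psiinv k : KO O pi 0 k -> blk_invariant (KO O pi r) (psi k).
  move=> kK h1 h2 y hK.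
  have := Hr _ (k *a emb y) (KO_norm OP kK hK).
  by rewrite /psi emb_act2 !act_mul act_inv.
(* [ev_sum] wants a test function at every index, while block invariance of [psi k] is established
   for k in [KO 0]; hence the default 0. *)
pose f k x := if `[< KO O pi 0 k >] then ind O pi p (KO O pi r) (psi k) (k^-1%g *a x) else 0.
have fS k : f k \in @schwartz R _ /\ ev xi (f k) = 0.
  rewrite /f; case: asboolP => [kK|_]; last first.
    split; first exact: schwartz0.
    by have := evE xi 0; rewrite linear0.
  have iS := ind_schwartz char2 OP p (psiS k) (psiinv k kK).
  split; first exact: (schwartz_act (GLt k^-1%g false) iS).
  by rewrite (ev_act xi_eq _ iS) (ind_eq0 _ _ (psiS k) (psiinv k kK)) mulr0.
rewrite -evE (_ : Phi = (fun x => \sum_(k <- s) f k x) :> (_ -> _)).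
  by rewrite (ev_sum xi s (fun k => (fS k).1)).2 big1 // => k _; exact: (fS k).2.
apply/funext => x; rewrite (dec supp) big_seq [RHS]big_seq; apply: eq_bigr => k ks.
by rewrite /f asboolT //; exact: sJ.
Qed.

(** An idempotent other than 0 and 1 has rank and corank both below n, so the hypothesis covers both
    blocks. *)
Lemma idempotent_vanishes n p (xi : distribution R (triple F n)) A v phi :
  (forall m, (m < n)%N -> no_equivariant m) -> equivariant xi ->
  peval p A *m peval p A = peval p A -> peval p A != 0 -> peval p A != 1%:M ->
  vanishes_at xi (A, v, phi).
Proof.
move=> hyp xi_eq EE E0 E1.
have r0 : (0 < \rank (peval p A))%N by rewrite lt0n mxrank_eq0.
have rn : (\rank (peval p A) < n)%N.
  rewrite ltn_neqAle rank_leq_row andbT; apply: contra E1 => full.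
  have Eu : peval p A \in unitmx by rewrite -row_free_unit /row_free.
  by apply/eqP; apply: (can_inj (mulKmx Eu)); rewrite EE mulmx1.
have [n1 rE] : exists n1, \rank (peval p A) = n1 by exists (\rank (peval p A)).
rewrite rE in r0 rn.
have [n2 nE] : exists n2, n = (n1 + n2)%N by exists (n - n1)%N; rewrite subnKC // ltnW.
subst n.
have n20 : (n2 < n1 + n2)%N by rewrite -[X in (X < _)%N]add0n ltn_add2r.
have [g gu gE] := idempotent_conj EE rE.
apply: (@vanishes_at_act _ xi (GLt (GLin gu) false)) => //.
apply: (block_vanishes (p := p)); [exact: hyp|exact: hyp|exact: xi_eq|].
by rewrite /= peval_conj.
Qed.

Lemma support_nilpotent n (xi : distribution R (triple F n)) A v phi x (w : 'cV[F]_n) :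
  (forall m, (m < n)%N -> no_equivariant m) -> equivariant xi ->
  ~ vanishes_at xi (A, v, phi) -> w != 0 -> A *m w = x *: w ->
  exists N, (A - x%:M) ^+ N = 0.
Proof.
move=> hyp xi_eq nv w0 Aw; apply: contrapT => nN.
have [|p [EE E0 E1]] := fitting_idempotent w0 Aw.
  by move=> N; apply/eqP => eN; apply: nN; exists N.
by apply: nv; exact: idempotent_vanishes EE E0 E1.
Qed.

Definition shear n (l : F) (x : triple F n) : triple F n :=
  (x.1.1 + l *: (x.1.2 *m x.2), x.1.2, x.2).

Lemma shear_continuous n l : continuous (@shear n l).
Proof.
have c1 : continuous (fun x : triple F n => x.1.1).
  exact/continuous_fst_comp/continuous_fst_comp/continuous_idfun.
have c2 : continuous (fun x : triple F n => x.1.2).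
  exact/continuous_snd_comp/continuous_fst_comp/continuous_idfun.
have c3 : continuous (fun x : triple F n => x.2).
  exact/continuous_snd_comp/continuous_idfun.
apply: continuous_pair => //; apply: continuous_pair => //.
apply: continuous_mx => i j.
rewrite (_ : (fun t => _) = fun t : triple F n => t.1.1 i j + l * (t.1.2 *m t.2) i j).
  move=> t; apply: (@cvg_addf F _ (nbhs t)); first exact: (continuous_coord c1).
  apply: (@cvg_mulf F _ (nbhs t) (fun=> l)); first exact: cvg_cst.
  by apply: (@continuous_coord F _ _ _ (fun t => t.1.2 *m t.2)); exact: continuous_mulmx.
by apply/funext => t; rewrite !mxE.
Qed.

Lemma shearK n l : cancel (@shear n l) (shear (- l)).
Proof. by case=> [[A v] phi]; rewrite /shear /= scaleNr addrK. Qed.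

(** The sign element replaces v by phi^T and phi by v^T, so v phi becomes its transpose, just as A
    does. *)
Lemma shear_act n l h (x : triple F n) : act h (shear l x) = shear l (act h x).
Proof.
case: h x => g [] [[A v] phi]; rewrite /act /shear /=; congr (_, _, _).
  rewrite linearD linearZ /= trmx_mul mulmxDr mulmxDl; congr (_ + _).
  by rewrite -scalemxAr -scalemxAl !mulmxA.
rewrite mulmxDr mulmxDl; congr (_ + _).
by rewrite -scalemxAr -scalemxAl !mulmxA.
Qed.

Lemma shear_support n (xi : distribution R (triple F n)) l : equivariant xi ->
  exists2 xi' : distribution R (triple F n), equivariant xi' &
    forall x, vanishes_at xi' (shear l x) -> vanishes_at xi x.
Proof.
move=> xi_eq.
have shearK' : cancel (@shear n (- l)) (shear l) by have := @shearK n (- l); rewrite opprK.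
pose pb := pullback (@shear_continuous n l) (@shear_continuous n (- l)) (@shearK n l) (R := R).
pose z (f : testFun R (triple F n)) := xi (pb f).
have z_lin : linear_for *%R z.
  by move=> a f1 f2; rewrite /z -linearP; congr (xi _); exact: testFun_inj.
pose zL : distribution R (triple F n) := HB.pack z (GRing.isLinear.Build _ _ _ _ z z_lin).
exists zL.
  move=> h f; rewrite /= /z -xi_eq; congr (xi _); apply: testFun_inj => x.
  exact: (congr1 (testFun_val f) (shear_act l h x)).
move=> x; apply: (vanishes_at_transport (ac := @shear_continuous n l)
  (bc := @shear_continuous n (- l)) (aK := @shearK n l) (c := 1) shearK') => f.
by rewrite mul1r.
Qed.

End Supports.

Theorem corollary3p4 (R : realType) (F : localFieldType) (n : nat) :
  2%N \in [pchar F] -> (0 < n)%N ->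
  (forall (E : localFieldType) (m : nat), 2%N \in [pchar E] -> (m < n)%N ->
     forall xi : distribution R (triple E m), equivariant xi ->
       forall Phi : testFun R (triple E m), xi Phi = 0) ->
  forall xi : distribution R (triple F n), equivariant xi ->
  forall (A : 'M[F]_n) (v : 'cV[F]_n) (phi : 'rV[F]_n),
    dsupport xi (A, v, phi) ->
    forall k : nat, pairing (A ^+ k *m v) phi = 0.
Proof.
move=> char2 _ hyp xi xi_eq A v phi suppx k.
have [O [pi OP]] := exists_integer_ring char2.
have hypF m : (m < n)%N -> @no_equivariant F R m by move=> mn z; exact: hyp.
have nv : ~ vanishes_at xi (A, v, phi).
  by move=> [U [oU vU] Ux]; apply: suppx; exists U.
apply/eqP; apply: contraT => /(rank_one_eigenvalue OP)[a0 Ha].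
(* The pulled back distribution is again equivariant and does not vanish at the sheared point, so
   the sheared matrix minus its eigenvalue pi^-a is nilpotent. *)
have nil a : (a0 <= a)%N -> exists l N,
    (A + l *: (v *m phi) - (pi ^- a)%:M) ^+ N = 0.
  move=> /Ha[l [w [w0 Aw]]]; exists l.
  have [xi' xi'_eq hxi'] := shear_support l xi_eq.
  apply: (support_nilpotent (v := v) (phi := phi) char2 OP hypF xi'_eq) w0 Aw.
  exact: contra_not (hxi' (A, v, phi)) nv.
(* Two consecutive exponents supply the two distinct scalars that [krylov_unit] compares. *)
have [l1 [N1 nil1]] := nil a0 (leqnn _).
have [l2 [N2 nil2]] := nil a0.+1 (leqnSn _).
have x12 : pi ^- a0 != pi ^- a0.+1.
  by rewrite (inj_eq invr_inj); exact: (pi_exp_inj OP).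
(* The transposed relations let [krylov_unit] apply to [phi^T] as a vector for [A^T]. *)
have trnil l a N : (A + l *: (v *m phi) - a%:M) ^+ N = 0 ->
    (A^T + l *: (phi^T *m v^T) - a%:M) ^+ N = 0.
  move=> /(congr1 trmx); rewrite trmx_exp trmx0 linearB linearD linearZ /=.
  by rewrite trmx_mul tr_scalar_mx.
case: nv; apply: (cyclic_vanishes OP) => //.
  exact: krylov_unit x12 nil1 nil2.
exact: krylov_unit x12 (trnil _ _ _ nil1) (trnil _ _ _ nil2).
Qed.
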